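(* Let $X$ be a Polish space, $\Omega=C([0,+\infty)\to X)$, and let $\mathscr{P}$ be the space of Borel probability measures on $\Omega$. Every strong Krylov set-valued map $\mathscr{C}:X\to2^{\mathscr{P}}$ has a strong Markov selection, i.e. a measurable selection $x\mapsto P_x\in\mathscr{C}(x)$ such that for every $x\in X$ and every positive stopping time $\tau$, $$\theta_\tau P_x(\cdot)=\int_\Omega P_{w(\tau(w))}(\cdot)\,P_x(dw),$$ or, in terms of conditional probabilities, $$P_x[\theta_\tau^{-1}(\cdot)\,|\,\mathcal{F}_\tau](w)=P_{w(\tau(w))}(\cdot)\quad(P_x,\mathcal{F}_\tau)\text{-a.s.}$$
   Context: $\Omega$ is the space of continuous paths $w:[0,+\infty)\to X$ with the compact-open topology; $\Omega_x=\{w\in\Omega:w(0)=x\}$; $\mathcal{F}$ is its Borel $\sigma$-algebra and $\mathcal{F}_t$ is generated by the coordinate maps $w\mapsto w(r)$, $0\le r\le t$. A stopping time is a map $\tau:\Omega\to[0,\infty)$ with $\{\tau\le s\}\in\mathcal{F}_s$ for all $s\ge0$; $\mathcal{F}_\tau=\{A\in\mathcal{F}:A\cap\{\tau\le s\}\in\mathcal{F}_s\ \forall s\ge0\}$; $(\theta_\tau w)(\cdot)=w(\tau(w)+\cdot)$; $\theta_\tau P$ is the push-forward of $P$ under $\theta_\tau$. $P[\,\cdot\,|\mathcal{F}_\tau]$ is the regular conditional probability distribution, and ''$(P,\mathcal{F}_\tau)$-a.s.'' means outside a $P$-null set belonging to $\mathcal{F}_\tau$. $\mathscr{P}$ carries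 the weak (weak$^*$) topology generated by $P\mapsto Pf=\int f\,dP$, $f\in C_b(\Omega)$ (bounded continuous functions). Fix a countable family $\Phi$ of bounded continuous functions on $X$ that is closed under multiplication and strongly separates points of $X$ (for every $x\in X$ and every neighbourhood $O$ of $x$ there are $g_1,\dots,g_k\in\Phi$ with $\inf_{y\notin O}\max_{l}|g_l(y)-g_l(x)|>0$), a countable dense subset $\Lambda$ of $(0,+\infty)$, and an enumeration $(\lambda_n,\varphi_n)$, $n\ge1$, of $\Lambda\times\Phi$. For a stopping time $\tau$ put $$\zeta_n^\tau(P)=\int_\Omega\int_0^{\tau(w)}e^{-\lambda_nt}\varphi_n(w(t))\,dt\,P(dw).$$ For a set-valued map $\mathscr{C}$ let $h_x[f]=\sup\{Pf:P\in\mathscr{C}(x)\}$, $f\in C_b(\Omega)$. For $P\in\mathscr{P}$ let $$K(P,\tau,\mathscr{C})=\Big\{Q\in\mathscr{P}:\ Qf\le\int_\Omega h_{w(\tau(w))}[f]\,P(dw)\ \ \forall f\in C_b(\Omega)\Big\},$$ and for $x\in X$, $P\in\mathscr{C}(x)$ let $$\Gamma[P,x,\tau](\mathscr{C})=\{Q\in\mathscr{C}(x):\ \theta_\tau Q\in K(P,\tau,\mathscr{C})\ \text{and}\ \zeta_n^\tau(Q)\ge\zeta_n^\tau(P)\ \ \forall n\ge1\}.$$ $\mathscr{C}:X\to2^{\mathscr{P}}$ is a strong Krylov map if: (C1) each $\mathscr{C}(x)$ is a non-empty compact convex subset of $\mathscr{P}$; (C2) $\{x\in X:\mathscr{C}(x)\cap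 K\ne\emptyset\}$ is Borel in $X$ for every closed $K\subset\mathscr{P}$; (C3) $P(\Omega_x)=1$ for every $P\in\mathscr{C}(x)$, $x\in X$; (KP1) for all $x\in X$ and all positive stopping times $\tau$, if $P\in\mathscr{C}(x)$ then $\theta_\tau P\in K(P,\tau,\mathscr{C})$; (KP2) for all $x\in X$ and all positive stopping times $\tau$, if $P\in\mathscr{C}(x)$ then $\{\theta_\tau Q:Q\in\Gamma[P,x,\tau](\mathscr{C})\}=K(P,\tau,\mathscr{C})$. A measurable selection is a Borel measurable map $x\mapsto P_x\in\mathscr{P}$ with $P_x\in\mathscr{C}(x)$ for all $x$. *)

(* Defs.v *)
From HB Require Import structures.
From mathcomp Require Import all_boot all_order all_algebra.
From mathcomp Require Import all_classical all_reals all_analysis.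
From mathcomp Require Import measurable_realfun.
Set Implicit Arguments.
Unset Strict Implicit.
Unset Printing Implicit Defensive.
Import Order.TTheory GRing.Theory Num.Theory.
Import numFieldNormedType.Exports.

Local Open Scope classical_set_scope.
Local Open Scope ring_scope.

Definition is_metric (R : realType) (X : Type) (d : X -> X -> R) : Prop :=
  [/\ forall x y, 0 <= d x y,
      forall x y, d x y = 0 <-> x = y,
      forall x y, d x y = d y x &
      forall x y z, d x z <= d x y + d y z].

Definition metrizes (R : realType) (X : topologicalType) (d : X -> X -> R) :=
  forall (x : X) (A : set X),
    nbhs x A <-> exists2 e : R, 0 < e & [set y | d x y < e] `<=` A.

Definition complete_metric (R : realType) (X : topologicalType)
    (d : X -> X -> R) : Prop :=
  forall u : nat -> X,
    (forall e : R, 0 < e -> exists N : nat, forall m n : nat,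
       (N <= m)%N -> (N <= n)%N -> d (u m) (u n) < e) ->
    exists l : X, u @ \oo --> l.

Definition polish (R : realType) (X : topologicalType) : Prop :=
  (exists2 D : set X, countable D & dense D) /\
  exists d : X -> X -> R, [/\ is_metric d, metrizes d & complete_metric d].

Notation borel S := (g_sigma_algebraType (@open S)).

Notation time R := (set_type (`[0%R, +oo[%classic : set R)).

Section time.
Context {R : realType}.

Definition time_val (t : time R) : R := set_val t.

Lemma mk_time_subproof (r : R) : Num.max 0 r \in (`[0, +oo[%classic : set R).
Proof. by rewrite inE /= in_itv /= andbT le_max lexx. Qed.

Definition mk_time (r : R) : time R := exist _ (Num.max 0 r) (mk_time_subproof r).

Lemma time_val_ge0 (t : time R) : 0 <= time_val t.
Proof. by case: t => r r0; move: (set_mem r0) => /=; rewrite in_itv /= andbT. Qed.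

Lemma mk_timeK (r : R) : 0 <= r -> time_val (mk_time r) = r.
Proof. by move=> r0; rewrite /time_val /= set_valE /=; apply/max_idPr. Qed.

Lemma time_val_continuous : continuous time_val.
Proof. exact: initial_continuous. Qed.

Lemma mk_time_continuous : continuous mk_time.
Proof.
apply: continuous_comp_initial => r.
rewrite (_ : _ \o _ = (fun r => Num.max 0 r))//.
by apply: continuous_max; [exact: cvg_cst|exact: cvg_id].
Qed.

Definition tadd (s t : time R) : time R := mk_time (time_val s + time_val t).

Lemma time_val_tadd (s t : time R) :
  time_val (tadd s t) = time_val s + time_val t.
Proof. by apply: mk_timeK; apply: addr_ge0; exact: time_val_ge0. Qed.

Lemma tadd_continuous (s : time R) : continuous (tadd s).
Proof.
move=> t; apply: (@continuous_comp _ _ _ (fun t => time_val s + time_val t)).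
  by apply: (@cvgD R R^o _ (nbhs t) _ (fun=> time_val s) time_val);
    [exact: cvg_cst|exact: time_val_continuous].
exact: mk_time_continuous.
Qed.

End time.

Definition cpath (R : realType) (X : topologicalType) : Type :=
  continuousType (time R) X.
HB.instance Definition _ (R : realType) (X : topologicalType) :=
  Choice.on (cpath R X).
HB.instance Definition _ (R : realType) (X : topologicalType) :=
  Topological.copy (cpath R X)
    (@initial_topology (cpath R X) {compact-open, time R -> X}
       (fun w : continuousType (time R) X => (w : time R -> X))).
HB.instance Definition _ (R : realType) (X : ptopologicalType) :=
  isPointed.Build (cpath R X) (mkcts (@cst_continuous (time R) X point)).

Definition eval_at (R : realType) (X : topologicalType) (t : time R)
  (w : cpath R X) : X := (w : continuousType (time R) X) t.

Lemma shift_subproof (R : realType) (X : topologicalType) (s : time R)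
  (w : cpath R X) : continuous (fun t => eval_at (tadd s t) w).
Proof.
move=> t; apply: continuous_comp; first exact: tadd_continuous.
exact: cts_fun.
Qed.

Definition shift (R : realType) (X : topologicalType) (s : time R)
  (w : cpath R X) : cpath R X := mkcts (@shift_subproof R X s w).

Definition start_at (R : realType) (X : ptopologicalType) (x : X) :
  set (cpath R X) := [set w | eval_at (mk_time 0) w = x].

Section laws.
Context {R : realType} {X : ptopologicalType}.
Local Notation Omega := (cpath R X).

Definition filtration (t : time R) : set (set Omega) :=
  <<s \bigcup_(r in [set r : time R | time_val r <= time_val t])
        preimage_set_system [set: Omega] (eval_at r)
          (@measurable _ (borel X)) >>.

Definition stopping_time (tau : Omega -> time R) : Prop :=
  forall s : time R, filtration s [set w | time_val (tau w) <= time_val s].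

Definition positive_time (tau : Omega -> time R) : Prop :=
  forall w, 0 < time_val (tau w).

Definition stopped_field (tau : Omega -> time R) : set (set Omega) :=
  [set A | @measurable _ (borel Omega) A /\
    forall s : time R, filtration s (A `&` [set w | time_val (tau w) <= time_val s])].

Definition eval_tau (tau : Omega -> time R) (w : Omega) : X :=
  eval_at (tau w) w.

Definition theta (tau : Omega -> time R) (w : Omega) : Omega :=
  shift (tau w) w.

Definition Cb : set (Omega -> R) := [set f | continuous f /\ bounded_fun f].

End laws.
Arguments Cb : clear implicits.

Definition law (R : realType) (X : ptopologicalType) : Type :=
  probability (borel (cpath R X)) R.
HB.instance Definition _ (R : realType) (X : ptopologicalType) :=
  Pointed.on (law R X).

Section weak.
Context {R : realType} {X : ptopologicalType}.
Local Notation Omega := (cpath R X).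

Definition mean (P : law R X) (f : Omega -> R) : R :=
  (\int[P : probability (borel Omega) R]_w f w)%R.

Definition mean_Cb (P : law R X) : {ptws (Cb R X : Type) -> R} :=
  fun f => mean P (set_val f).

End weak.

(* The coarsest topology making P |-> Pf continuous for every f in C_b. *)
HB.instance Definition _ (R : realType) (X : ptopologicalType) :=
  Topological.copy (law R X) (initial_topology (@mean_Cb R X)).

Section krylov.
Context {R : realType} {X : ptopologicalType}.
Local Notation Omega := (cpath R X).
Local Notation law := (law R X).

(* A library measure also carries (meaningless) values on non-measurable sets;
   as Borel measures, m1 and m2 are the same when they agree on Borel sets. *)
Definition same_measure (m1 m2 : set Omega -> \bar R) : Prop :=
  forall A, @measurable _ (borel Omega) A -> m1 A = m2 A.

Definition push_theta (tau : Omega -> time R) (P : law) : set Omega -> \bar R :=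
  @pushforward _ _ (borel Omega) (borel Omega) R P (theta tau).

(* The Borel measure m is (up to [same_measure]) a member of S. *)
Definition measure_in (m : set Omega -> \bar R) (S : set law) : Prop :=
  exists2 Q : law, S Q & same_measure Q m.

(* With t = 1, this includes invariance of S under [same_measure]: a convex set
   is one of Borel measures, irrespective of values on non-measurable sets. *)
Definition convex_laws (S : set law) : Prop :=
  forall (P Q M : law) (t : R), S P -> S Q -> 0 <= t <= 1 ->
    same_measure M (fun A => t%:E * P A + (1 - t)%:E * Q A)%E -> S M.

(* The functional h_x[f]; the supremum is that of a non-empty bounded set as soon
   as [C x] is non-empty. *)
Definition upper (C : X -> set law) (x : X) (f : Omega -> R) : R :=
  sup [set mean P f | P in C x].

Definition Kset (P : law) (tau : Omega -> time R) (C : X -> set law) : set law :=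
  [set Q | forall f, Cb R X f ->
     mean Q f <= mean P (fun w => upper C (eval_tau tau w) f)].

(* [mk_time t] is t itself for t in the range of integration. *)
Definition zeta (lambda : R) (phi : X -> R) (tau : Omega -> time R) (P : law)
    : R :=
  mean P (fun w =>
    \int[lebesgue_measure]_(t in `[0%R, time_val (tau w)])
      (expR (- (lambda * t)) * phi (eval_at (mk_time t) w)))%R.

Definition Gamma (lambda : nat -> R) (phi : nat -> X -> R) (P : law) (x : X)
    (tau : Omega -> time R) (C : X -> set law) : set law :=
  [set Q | [/\ C x Q, measure_in (push_theta tau Q) (Kset P tau C) &
    forall n, zeta (lambda n) (phi n) tau P <= zeta (lambda n) (phi n) tau Q]].

Definition strongly_separates (Phi : set (X -> R)) : Prop :=
  forall (x : X) (O : set X), nbhs x O ->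
    exists (k : nat) (g : 'I_k.+1 -> X -> R), (forall l, Phi (g l)) /\
      (0 < ereal_inf
         [set (\big[Num.max/0%R]_(l < k.+1) `|g l y - g l x|)%:E | y in ~` O])%E.

Definition separating_family (Phi : set (X -> R)) : Prop :=
  [/\ countable Phi,
      forall g, Phi g -> continuous g /\ bounded_fun g,
      forall g1 g2, Phi g1 -> Phi g2 -> Phi (fun x => g1 x * g2 x) &
      strongly_separates Phi].

Definition dense_rates (Lambda : set R) : Prop :=
  [/\ countable Lambda, Lambda `<=` `]0, +oo[ & `]0, +oo[ `<=` closure Lambda].

Record strong_krylov (lambda : nat -> R) (phi : nat -> X -> R)
    (C : X -> set law) : Prop := StrongKrylov {
  krylov_C1 : forall x, [/\ C x !=set0, compact (C x) & convex_laws (C x)] ;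
  krylov_C2 : forall F : set law, closed F ->
    @measurable _ (borel X) [set x | C x `&` F !=set0] ;
  krylov_C3 : forall x P, C x P -> P (start_at x) = 1%E ;
  krylov_KP1 : forall x tau, stopping_time tau -> positive_time tau ->
    forall P, C x P -> measure_in (push_theta tau P) (Kset P tau C) ;
  krylov_KP2 : forall x tau, stopping_time tau -> positive_time tau ->
    forall P, C x P ->
    [set M : law | exists2 Q, Gamma lambda phi P x tau C Q &
                              same_measure M (push_theta tau Q)] = Kset P tau C }.

Definition measurable_selection (C : X -> set law) (S : X -> law) : Prop :=
  measurable_fun [set: borel X] (S : borel X -> borel law) /\
  forall x, C x (S x).

(* kappa is a version of the regular conditional distribution of P given G, for
   a sub-sigma-algebra G. *)
Definition is_rcpd (P : law) (G : set (set Omega)) (kappa : Omega -> law)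
    : Prop :=
  (forall B, @measurable _ (borel Omega) B ->
     measurable_fun [set: g_sigma_algebraType G]
       (fun w : g_sigma_algebraType G => kappa w B)) /\
  (forall A B, G A -> @measurable _ (borel Omega) B ->
     P (A `&` B) =
       (\int[P : probability (borel Omega) R]_(w in A) kappa w B)%E).

(* First the integrated form, then the conditional one; in the latter "almost
   surely" means outside a null set N of the stopped sigma-algebra, independent
   of the event, and the equality holds for every version kappa. *)
Definition strong_markov (S : X -> law) : Prop :=
  forall x tau, stopping_time tau -> positive_time tau ->
    same_measure (push_theta tau (S x))
      (fun A => \int[S x : probability (borel Omega) R]_w
                  S (eval_tau tau w) A)%E /\
    forall kappa, is_rcpd (S x) (stopped_field tau) kappa ->
      exists N, [/\ stopped_field tau N, S x N = 0%E &
        forall w, ~ N w ->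
          same_measure (push_theta tau (kappa w)) (S (eval_tau tau w))].

End krylov.

(* Main.v *)
(** Let F_n(w) be the integral of exp(-lambda_n t) phi_n(w(t)) over [0, +oo).
    Maximising F_0, F_1, ... successively shrinks C(x) to a set of laws D(x).
    At deterministic times (KP1) and (KP2) survive every stage of the
    maximisation, and since Laplace transforms determine one-dimensional
    marginals, D(x) is a single law S_x and S has the Markov property at
    deterministic times.

    At a stopping time tau, (KP2) prescribes the law of the future path and
    the integrals up to tau, but not the joint law of the future and tau, so
    that the discount exp(-lambda_n tau) cannot be handled directly.  However
    the paths being continuous, tau is predictable: up to a small probability
    it can be announced shortly before it occurs, at a time of a fine grid.
    Running a supermartingale along that grid and using (KP2) only between the
    announcement and tau, where the discount is almost constant, shows that the
    discounted payoff at tau of f = sum c_m F_m (c_m >= 0) is at most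
    sup {P f : P in C(x)}.  With tau delayed off an event A of its past and an
    induction on n, this gives E_x[F_n o theta_tau ; A] = E_x[S_{w(tau)} F_n ; A],
    and then the strong Markov property as in the deterministic case. *)
From HB Require Import structures.
Require Import Defs.
From mathcomp Require Import all_boot all_order all_algebra.
From mathcomp Require Import all_classical all_reals all_analysis.
From mathcomp Require Import measurable_realfun.
From mathcomp Require Import ring lra.
Set Implicit Arguments.
Unset Strict Implicit.
Unset Printing Implicit Defensive.
Import Order.TTheory GRing.Theory Num.Theory.
Import numFieldNormedType.Exports.
Local Open Scope classical_set_scope.
Local Open Scope ring_scope.

(** (KP2) gives only the one-sided bounds zeta(Q) >= zeta(P), hence the restriction to nonnegative
    weights. The cone of such combinations is stable under adding j F_n, and by compactness j -> oo
    turns a bound by the n-th stage D_n of the maximisation into one by D_(n+1). So at stopping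
    times the induction does not transport (KP2) itself but two of its consequences: the payoff
    bound over the whole cone, and the inequality (KP1) for D_n. Put Delta = S_{w(tau)} F_n - F_n o
    theta_tau. The payoff bound for tau delayed by c off A, with c -> oo, gives
    E[exp(-lambda_n tau) Delta ; A] <= 0 for every A in F_tau; the discount is positive and
    F_tau-measurable, so slicing it into level sets gives E[Delta ; A] <= 0. (KP1) for D_n says
    E[Delta] >= 0. Applied to A and to its complement, these force E[Delta ; A] = 0, which in turn
    feeds both inductive statements at n + 1. *)

Lemma bounded_fun_bound (T : Type) (R : realType) (f : T -> R) :
  bounded_fun f -> exists2 c : R, 0 <= c & forall x, `|f x| <= c.
Proof.
move=> [c [_ cf]]; exists (Num.max 0 (c + 1)); first by rewrite le_max lexx.
by move=> x; rewrite le_max (cf (c + 1))// ?orbT// ltrDl.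
Qed.

(** * Bounded measurable functions and monotone classes *)

Section bounded_measurable.
Context d (T : measurableType d) (R : realType).
Implicit Types (f g : T -> R).

Definition bmf f := measurable_fun setT f /\ exists M : R, forall x, `|f x| <= M.

Lemma bmf_cst (c : R) : bmf (fun=> c).
Proof. by split; [exact: measurable_cst|exists `|c|]. Qed.

Lemma bmfD f g : bmf f -> bmf g -> bmf (fun x => f x + g x).
Proof.
move=> [mf [M fM]] [mg [N gN]]; split; first exact: measurable_funD.
by exists (M + N) => x; rewrite (le_trans (ler_normD _ _))// lerD.
Qed.

Lemma bmfM f g : bmf f -> bmf g -> bmf (fun x => f x * g x).
Proof.
move=> [mf [M fM]] [mg [N gN]]; split; first exact: measurable_funM.
by exists (M * N) => x; rewrite normrM ler_pM.
Qed.

Lemma bmfZ (c : R) f : bmf f -> bmf (fun x => c * f x).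
Proof. by move=> bf; apply: bmfM => //; exact: bmf_cst. Qed.

Lemma bmfN f : bmf f -> bmf (fun x => - f x).
Proof.
by move=> /(bmfZ (-1)); under [X in bmf X -> _]eq_fun do rewrite mulN1r.
Qed.

Lemma bmfB f g : bmf f -> bmf g -> bmf (fun x => f x - g x).
Proof. by move=> bf bg; apply: bmfD => //; exact: bmfN. Qed.

Lemma bmf_indic (A : set T) : measurable A -> bmf (\1_A : T -> R).
Proof.
move=> mA; split; first exact: measurable_indic.
by exists 1 => x; rewrite indicE normr_nat lern1; case: (_ \in _).
Qed.

Lemma bmf_sum (I : Type) (s : seq I) (F : I -> T -> R) :
  (forall i, bmf (F i)) -> bmf (fun x => \sum_(i <- s) F i x).
Proof.
move=> bF; elim: s => [|i s IH].
  by under eq_fun do rewrite big_nil; exact: bmf_cst.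
by under eq_fun do rewrite big_cons; exact: bmfD.
Qed.

Lemma bmf_lim (f_ : nat -> T -> R) f (M : R) :
  (forall n, measurable_fun setT (f_ n)) -> (forall n x, `|f_ n x| <= M) ->
  (forall x, f_ n x @[n --> \oo] --> f x) -> bmf f.
Proof.
move=> mf fM ff; split; first by apply: (measurable_fun_cvg mf) => x _; exact: ff.
exists M => x; have cn : `|f_ n x| @[n --> \oo] --> `|f x| by apply: cvg_norm; exact: ff.
rewrite -(cvg_lim _ cn)//; apply: limr_le; first by apply/cvg_ex; eexists; exact: cn.
by apply: nearW => n; exact: fM.
Qed.

End bounded_measurable.

Lemma bmf_comp d1 d2 (T1 : measurableType d1) (T2 : measurableType d2)
    (R : realType) (f : T2 -> R) (g : T1 -> T2) :
  bmf f -> measurable_fun setT g -> bmf (fun x => f (g x)).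
Proof.
by move=> [mf [M fM]] mg; split; [exact: measurableT_comp mf mg|exists M].
Qed.

Section finite_integral.
Context d (T : measurableType d) (R : realType).
Variables (mu : {measure set T -> \bar R}) (D : set T).
Hypotheses (mD : measurable D) (muD : (mu D < +oo)%E).
Implicit Types (f g : T -> R).

Lemma bmf_integrable f : bmf f -> mu.-integrable D (EFin \o f).
Proof.
move=> [mf [M fM]]; apply: measurable_bounded_integrable => //.
  exact: measurable_funTS.
exists M; split; first exact: num_real.
by move=> y My x _; exact: le_trans (fM x) (ltW My).
Qed.

Lemma bint_cvg (f_ : nat -> T -> R) f (M : R) :
  (forall n, measurable_fun setT (f_ n)) -> (forall n x, `|f_ n x| <= M) ->
  (forall x, D x -> f_ n x @[n --> \oo] --> f x) ->
  (\int[mu]_(x in D) f_ n x)%R @[n --> \oo] --> (\int[mu]_(x in D) f x)%R.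
Proof.
move=> mf fM ff; rewrite /Rintegral; apply: fine_cvg.
have mf_ n : measurable_fun D (EFin \o f_ n).
  by apply/measurable_EFinP; exact: measurable_funTS.
have [] := @dominated_convergence _ _ _ mu D mD (fun n => EFin \o f_ n)
    (EFin \o f) (cst M%:E) mf_.
- apply/measurable_EFinP; apply: (@measurable_fun_cvg _ _ _ D f_ f).
    by move=> n; exact: measurable_funTS.
  exact: ff.
- by apply: aeW => x Dx; apply: cvg_EFin; [exact: nearW|exact: ff].
- have := @bmf_integrable (fun=> M); apply; exact: bmf_cst.
- by apply: aeW => x n _; rewrite /= lee_fin.
by move=> fi _ ci; rewrite fineK//; exact: integrable_fin_num.
Qed.

Lemma bintD f g : bmf f -> bmf g ->
  (\int[mu]_(x in D) (f x + g x) =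
   \int[mu]_(x in D) f x + \int[mu]_(x in D) g x)%R.
Proof. by move=> bf bg; rewrite RintegralD//; exact: bmf_integrable. Qed.

Lemma bintB f g : bmf f -> bmf g ->
  (\int[mu]_(x in D) (f x - g x) =
   \int[mu]_(x in D) f x - \int[mu]_(x in D) g x)%R.
Proof. by move=> bf bg; rewrite RintegralB//; exact: bmf_integrable. Qed.

Lemma bintZ c f : bmf f ->
  (\int[mu]_(x in D) (c * f x) = c * \int[mu]_(x in D) f x)%R.
Proof. by move=> bf; rewrite RintegralZl//; exact: bmf_integrable. Qed.

Lemma bint_sum (I : Type) (s : seq I) (F : I -> T -> R) :
  (forall i, bmf (F i)) ->
  (\int[mu]_(x in D) (\sum_(i <- s) F i x) = \sum_(i <- s) \int[mu]_(x in D) F i x)%R.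
Proof.
move=> bF; elim: s => [|i s IH].
  under eq_Rintegral do rewrite big_nil.
  by rewrite big_nil Rintegral_cst// mul0r.
under eq_Rintegral do rewrite big_cons.
by rewrite big_cons bintD// ?IH//; exact: bmf_sum.
Qed.

Lemma le_bint f g : bmf f -> bmf g -> (forall x, D x -> f x <= g x) ->
  (\int[mu]_(x in D) f x <= \int[mu]_(x in D) g x)%R.
Proof. by move=> bf bg; apply: le_Rintegral => //; exact: bmf_integrable. Qed.

Lemma bint_indic A : measurable A ->
  (\int[mu]_(x in D) (\1_A x : R) = fine (mu (A `&` D)))%R.
Proof. by move=> mA; rewrite /Rintegral integral_indic. Qed.

End finite_integral.

Section bounded_class.
Context d (T : measurableType d) (R : realType).

(** The functional monotone class, closed under bounded pointwise limits rather than monotone ones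
    only, so that approximations need not be arranged monotonically. *)
Definition bounded_class (H : set (T -> R)) :=
  [/\ H (cst 1),
      forall a f g, H f -> H g -> H (fun x => a * f x + g x) &
      forall (f_ : nat -> T -> R) f (M : R), (forall n, H (f_ n)) ->
        (forall n x, `|f_ n x| <= M) ->
        (forall x, f_ n x @[n --> \oo] --> f x) -> H f].

Variable H : set (T -> R).
Hypothesis HH : bounded_class H.

Lemma bclass_ext f g : H f -> f =1 g -> H g.
Proof. by move=> Hf /funext <-. Qed.
Lemma bclass1 : H (cst 1). Proof. by case: HH. Qed.
Lemma bclassL a f g : H f -> H g -> H (fun x => a * f x + g x).
Proof. by case: HH => _ + _; apply. Qed.
Lemma bclass0 : H (fun=> 0).
Proof.
have := bclassL (-1) bclass1 bclass1.
by under [X in H X -> _]eq_fun do rewrite mulr1 addNr.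
Qed.
Lemma bclassD f g : H f -> H g -> H (fun x => f x + g x).
Proof.
move=> Hf Hg; have := bclassL 1 Hf Hg.
by under [X in H X -> _]eq_fun do rewrite mul1r.
Qed.
Lemma bclassZ a f : H f -> H (fun x => a * f x).
Proof.
move=> Hf; have := bclassL a Hf bclass0.
by under [X in H X -> _]eq_fun do rewrite addr0.
Qed.
Lemma bclass_cst a : H (fun=> a).
Proof.
have := bclassZ a bclass1; by under [X in H X -> _]eq_fun do rewrite mulr1.
Qed.
Lemma bclass_sum (I : Type) (s : seq I) (F : I -> T -> R) :
  (forall i, H (F i)) -> H (fun x => \sum_(i <- s) F i x).
Proof.
move=> HF; elim: s => [|i s IH].
  by under eq_fun do rewrite big_nil; exact: bclass0.
by under eq_fun do rewrite big_cons; exact: bclassD.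
Qed.
Lemma bclass_lim (f_ : nat -> T -> R) f (M : R) : (forall n, H (f_ n)) ->
        (forall n x, `|f_ n x| <= M) ->
        (forall x, f_ n x @[n --> \oo] --> f x) -> H f.
Proof. by case: HH => _ _; apply. Qed.

(** Dynkin's theorem: complements are a linear operation on indicators, and disjoint unions are
    bounded limits of sums. *)
Lemma bclass_sets (G : set (set T)) : @measurable _ T = <<s G >> ->
  setI_closed G -> (forall A, G A -> H (\1_A)) ->
  forall A, measurable A -> H (\1_A).
Proof.
move=> mG GI HG A; rewrite mG; apply: (@dynkin_induction _ _ G [set A | H \1_A] mG GI) => /=.
- by rewrite indicT; exact: bclass1.
- exact: HG.
- move=> S _ HS; apply: (@bclass_ext _ _ (bclassL (-1) HS bclass1)) => x.
  by rewrite !indicE in_setC /cst/=;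
    case: (_ \in _) => /=; rewrite ?mulr1 ?mulr0 ?addNr ?add0r.
- move=> F mF tF HF.
  have key x n : (\sum_(i < n) \1_(F i) x = \1_(\bigcup_(i < n) F i) x :> R).
    elim: n => [|n IH].
      by rewrite big_ord0 indicE memNset// => -[].
    rewrite big_ord_recr/= IH !indicE.
    have [xn|xn] := boolP (x \in F n).
      have -> : (x \in \bigcup_(i < n) F i) = false.
        apply/negbTE/negP; rewrite inE => -[i/= ilt Fi].
        have := tF i n I I; move: xn; rewrite inE => xn.
        by move=> /(_ (ex_intro _ x (conj Fi xn))) e; rewrite e ltnn in ilt.
      have -> : (x \in \bigcup_(i < n.+1) F i).
        by rewrite inE; exists n => //=; move: xn; rewrite inE.
      by rewrite add0r.
    rewrite addr0; congr (_%:R); congr nat_of_bool.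
    apply/idP/idP; rewrite !inE => -[i/= ilt Fi]; exists i => //=.
      exact: ltnW.
    move: ilt; rewrite ltnS leq_eqVlt => /predU1P[ei|//]; subst i.
    by move: xn; rewrite notin_setE.
  apply: (@bclass_lim (fun n => \1_(\bigcup_(i < n) F i)) (\1_(\bigcup_k F k)) 1).
  + move=> n; have HFn (i : 'I_n) := HF i.
    by apply: (@bclass_ext _ _ (bclass_sum (index_enum _) HFn)) => x; rewrite key.
  + by move=> n x; rewrite indicE normr_nat lern1; case: (_ \in _).
  + move=> x; rewrite [X in _ --> X]indicE.
    have [xF|xF] := boolP (x \in \bigcup_k F k); last first.
      apply: cvg_near_cst; apply: nearW => n; rewrite indicE.
      case: (boolP (x \in _)) => //; rewrite inE => -[i _ Fi].
      by move: xF; rewrite notin_setE; case; exists i.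
    move: (xF); rewrite inE => -[k _ Fk].
    apply: cvg_near_cst; exists k.+1 => // n /= kn; rewrite indicE.
    by rewrite (_ : x \in _)//= inE; exists k.
Qed.

(** The sum counts the integers in [0, y), that is, the ceiling of y: a way to discretise a function
    by indicators of its superlevel sets alone. *)
Lemma count_below (y : R) N : 0 <= y <= N%:R ->
  y <= \sum_(k < N) (k%:R < y)%R%:R <= y + 1.
Proof.
elim: N => [|N IH].
  rewrite big_ord0 => /andP[y0 yN].
  by rewrite yN addr_ge0.
move=> /andP[y0 yN]; rewrite big_ord_recr/=.
have [yN'|yN'] := leP y N%:R.
  by rewrite addr0 IH// y0.
have -> : \sum_(i < N) ((i : nat)%:R < y)%R%:R = N%:R :> R.
  transitivity (\sum_(i < N) (1 : R)); last by rewrite sumr_const card_ord.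
  by apply: eq_bigr => i _; rewrite (lt_trans _ yN')// ltr_nat.
by rewrite -natrD addn1 yN -natr1 lerD2r ltW.
Qed.

Lemma bclass_bmf (G : set (set T)) : @measurable _ T = <<s G >> ->
  setI_closed G -> (forall A, G A -> H (\1_A)) ->
  forall f, bmf f -> H f.
Proof.
move=> mG GI HG f [mf [M fM]].
have HA := bclass_sets mG GI HG.
have M0 : 0 <= M by exact: le_trans (normr_ge0 _) (fM point).
(* Rescaling into [0, 1]; the 1 in the denominator keeps it positive when M = 0. *)
pose g x := (f x + M) / (2 * M + 1).
have c0 : 0 < 2 * M + 1 by rewrite ltr_wpDl// mulr_ge0.
have g01 x : 0 <= g x <= 1.
  have := fM x; rewrite ler_norml => /andP[fM1 fM2]; rewrite /g.
  rewrite divr_ge0 ?(ltW c0)//=; last by lra.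
  by rewrite ler_pdivrMr// mul1r; lra.
have mg : measurable_fun setT g.
  by apply: measurable_funM => //; apply: measurable_funD.
suff Hg : H g.
  apply: (@bclass_ext _ _ (bclassL (2 * M + 1) Hg (bclass_cst (- M)))) => x.
  rewrite /g mulrC divfK ?gt_eqF//.
  by rewrite addrK.
(* By [count_below] this average of indicators exceeds g by at most 1 / (n + 1). *)
pose g_ n x : R := n.+1%:R^-1 * \sum_(k < n.+1) \1_[set x | k%:R < n.+1%:R * g x] x.
have gk n x : g x <= g_ n x <= g x + n.+1%:R^-1.
  have n0 : 0 < n.+1%:R :> R by rewrite ltr0n.
  have := @count_below (n.+1%:R * g x) n.+1.
  have /andP[g0 g1] := g01 x.
  rewrite mulr_ge0 ?ler0n//= ler_piMr ?ler0n// => /(_ isT) /andP[c1 c2].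
  have e : \sum_(k < n.+1) \1_[set x0 | (k : nat)%:R < n.+1%:R * g x0] x =
      \sum_(k < n.+1) ((k : nat)%:R < n.+1%:R * g x)%R%:R :> R.
    by apply: eq_bigr => k _; rewrite indicE; congr (_ %:R); congr nat_of_bool;
      apply/idP/idP; rewrite inE.
  rewrite /g_ e -(ler_pM2l n0) mulVKf ?gt_eqF// c1 /=.
  by rewrite -(ler_pM2l n0) mulVKf ?gt_eqF// mulrDr mulfV ?gt_eqF.
apply: (@bclass_lim g_ _ 2).
- move=> n; apply: bclassZ; apply: bclass_sum => k; apply: HA.
  rewrite -[X in measurable X]setTI.
  have : measurable_fun setT (fun x => n.+1%:R * g x) by exact: measurable_funM.
  move=> /(_ measurableT `](k : nat)%:R, +oo[%classic (measurable_itv _)).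
  by congr measurable; apply/seteqP; split=> x /=; rewrite in_itv/= andbT.
- move=> n x; have /andP[g1 g2] := gk n x; have /andP[g3 g4] := g01 x.
  have : n.+1%:R^-1 <= 1 :> R by rewrite invf_le1 ?ltr0n// ler1n.
  move=> n1; rewrite ger0_norm; last exact: le_trans g3 g1.
  by rewrite (le_trans g2)// (_ : 2 = 1 + 1)// lerD.
- move=> x; apply/cvgrPdist_le => e e0.
  have := near_infty_natSinv_lt (PosNum e0); apply: filterS => n /= ne.
  have /andP[g1 g2] := gk n x.
  by rewrite distrC ger0_norm ?subr_ge0// lerBlDl (le_trans g2)// lerD2l ltW.
Qed.

End bounded_class.

(** * Indicators as limits of polynomials *)

Section threshold.
Context (R : realType).
Implicit Types (a y : R) (n : nat).

Lemma bernoulli_ineq a n : -1 <= a -> 1 + n%:R * a <= (1 + a) ^+ n.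
Proof.
move=> a1; elim: n => [|n IH]; first by rewrite mul0r addr0 expr0.
rewrite exprS; have a0 : 0 <= 1 + a by lra.
apply: (@le_trans _ _ ((1 + a) * (1 + n%:R * a))); last by rewrite ler_wpM2l.
have : 0 <= n%:R * (a * a) by rewrite mulr_ge0// -expr2 sqr_ge0.
by rewrite -natr1; nra.
Qed.

(* On [0, 1] these polynomials converge pointwise to the indicator of y < 1/2;
   they turn closure under products into indicators. *)
Definition threshold n y := (1 - y ^+ n) ^+ (n * 2 ^ n).

Lemma threshold_ge0_le1 n y : 0 <= y <= 1 -> 0 <= threshold n y <= 1.
Proof.
move=> /andP[y0 y1]; have := exprn_ge0 n y0; have := exprn_ile1 n y0 y1.
move=> h1 h2; rewrite /threshold exprn_ge0 ?exprn_ile1//; lra.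
Qed.

(** Bernoulli on both sides. Below 1/2, the value is at least 1 - n (2y)^n. From 1/2 on, with a =
    2^-n, it is at most (1 - a)^(n 2^n), whose product with (1 + a)^(n 2^n) >= 1 + n is at most 1.
    The factor n in the exponent is what sends y = 1/2 itself to 0. *)
Lemma cvg_threshold y : 0 <= y <= 1 ->
  threshold n y @[n --> \oo] --> ((y < 2^-1)%R%:R : R).
Proof.
move=> y01; have /andP[y0 y1] := y01.
case: ltP => [y2|y2] /=.
(* The square root splits n (2y)^n into (n w^n) w^n: the first factor is bounded by Bernoulli for
   1/w, the second tends to 0. *)
- pose w := Num.sqrt (2 * y).
  have w1 : w < 1.
    by rewrite /w -[ltRHS]sqrtr1 ltr_sqrt//; lra.
  have w0 : 0 <= w by exact: sqrtr_ge0.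
  have [w00|wn0] := eqVneq w 0.
    have yy : y = 0.
      move/eqP: w00; rewrite sqrtr_eq0 => ?; lra.
    apply: cvg_near_cst; exists 1%N => // n /= n0.
    by rewrite /threshold yy expr0n eqn0Ngt n0/= subr0 expr1n.
  have wp : 0 < w by rewrite lt_def wn0.
  pose h := w^-1 - 1.
  have h0 : 0 < h by rewrite /h subr_gt0 invf_gt1.
  have nw n : n%:R * w ^+ n <= h^-1.
    have /(bernoulli_ineq n) : -1 <= h by lra.
    rewrite [X in _ <= X ^+ _](_ : _ = w^-1); last by rewrite /h addrC subrK.
    rewrite exprVn => b.
    rewrite -(ler_pM2r h0) mulVf ?gt_eqF// mulrAC -(ler_pM2r (_ : 0 < (w ^+ n)^-1)); last first.
      by rewrite invr_gt0 exprn_gt0.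
    rewrite mulfK ?mul1r; last by rewrite expf_neq0.
    lra.
  apply: (@squeeze_cvgr _ _ _ _ (fun n => 1 - h^-1 * w ^+ n) (fun=> 1)).
  + apply: nearW => n; have /andP[_ ->] := threshold_ge0_le1 n y01.
    rewrite andbT /threshold.
    have yn1 : -1 <= - y ^+ n by rewrite lerN2 exprn_ile1.
    apply: le_trans (bernoulli_ineq _ yn1); rewrite mulrN lerD2l lerN2.
    have -> : (n * 2 ^ n)%:R * y ^+ n = (n%:R * w ^+ n) * w ^+ n.
      rewrite natrM natrX -!mulrA -exprMn; congr (_ * _).
      by rewrite -exprD addnn -mul2n exprM sqr_sqrtr// mulr_ge0.
    by rewrite ler_wpM2r// exprn_ge0.
  + rewrite -[X in _ --> X]subr0; apply: cvgB; first exact: cvg_cst.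
    rewrite -(mulr0 h^-1); apply: cvgM; first exact: cvg_cst.
    by apply: cvg_expr; rewrite ger0_norm.
  + exact: cvg_cst.
- apply: (@squeeze_cvgr _ _ _ _ (fun=> 0) (fun n => n.+1%:R^-1)).
  + apply: nearW => n; have /andP[-> _] := threshold_ge0_le1 n y01.
    rewrite /threshold /=.
    pose a : R := 2^-1 ^+ n.
    have a0 : 0 < a by rewrite exprn_gt0// invr_gt0.
    have a1 : a <= 1 by rewrite exprn_ile1// ?invr_ge0// invf_le1// ler1n.
    apply: (@le_trans _ _ ((1 - a) ^+ (n * 2 ^ n))).
      have yn1 : y ^+ n <= 1 by rewrite exprn_ile1.
      have ayn : a <= y ^+ n by rewrite lerXn2r// nnegrE// invr_ge0.
      by rewrite lerXn2r ?nnegrE//; lra.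
    have /(bernoulli_ineq (n * 2 ^ n)) b : -1 <= a by lra.
    have e : (n * 2 ^ n)%:R * a = n%:R.
      by rewrite natrM natrX -mulrA /a -exprMn divff// expr1n mulr1.
    rewrite e addrC natr1 in b.
    have n1 : 0 < n.+1%:R :> R by rewrite ltr0n.
    rewrite -[leRHS]mul1r ler_pdivlMr//.
    apply: (@le_trans _ _ ((1 - a) ^+ (n * 2 ^ n) * (1 + a) ^+ (n * 2 ^ n))).
      by rewrite ler_wpM2l// exprn_ge0// subr_ge0.
    by rewrite -exprMn exprn_ile1//; nra.
  + exact: cvg_cst.
  + exact: cvg_harmonic.
Qed.

End threshold.

Section multiplicative_class.
Context d (T : measurableType d) (R : realType).
Variables (H M : set (T -> R)).
Hypothesis HH : bounded_class H.
Hypothesis MM : forall f g, M f -> M g -> M (fun x => f x * g x).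
Hypothesis Mb : forall f, M f -> bounded_fun f.
Hypothesis MH : M `<=` H.

Let M1 f := M f \/ f = cst 1.

Let M1M f g : M1 f -> M1 g -> M1 (fun x => f x * g x).
Proof.
move=> [Mf|->] [Mg|->].
- by left; exact: MM.
- by left; under eq_fun do rewrite mulr1.
- by left; under eq_fun do rewrite mul1r.
- by right; apply/funext => x; rewrite mulr1.
Qed.

(** The indicator of phi < a is a bounded limit of polynomials in phi, and psi times such a
    polynomial is a combination of elements of [M1]. Carrying the factor psi makes the induction on
    the list close; [M1] adjoins the constant 1, which M may lack. *)
Lemma mclass_cylinder (l : seq ((T -> R) * R)) :
  (forall p, p \in map fst l -> M p) ->
  H (fun x => \prod_(p <- l) (p.1 x < p.2)%R%:R).
Proof.
move=> lM; suff : forall psi, M1 psi -> H (fun x => psi x * \prod_(p <- l) (p.1 x < p.2)%R%:R).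
  move=> /(_ (cst 1) (or_intror erefl)) h; apply: (bclass_ext h) => x.
  by rewrite mul1r.
elim: l lM => [_ psi|[phi a] l IH lM psi M1psi].
  move=> [/MH h|->]; apply: bclass_ext; first exact: h.
  - by move=> x; rewrite big_nil mulr1.
  - exact: (bclass1 HH).
  - by move=> x; rewrite big_nil mulr1.
have Mphi : M phi by apply: lM; rewrite inE eqxx.
pose W x : R := \prod_(p <- l) (p.1 x < p.2)%R%:R.
have {}IH : forall psi, M1 psi -> H (fun x => psi x * W x).
  by apply: IH => p pl; apply: lM; rewrite inE pl orbT.
have Mk k : M1 (fun x => psi x * phi x ^+ k).
  elim: k => [|k IHk]; first by under eq_fun do rewrite expr0 mulr1.
  by under eq_fun do rewrite exprSr mulrA; apply: M1M => //; left.
have Hp (p : {poly R}) : H (fun x => psi x * p.[phi x] * W x).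
  have Hi (i : 'I_(size p)) : H (fun x => p`_i * (psi x * phi x ^+ i * W x)).
    by apply: (bclassZ HH); apply: IH; exact: Mk.
  apply: (bclass_ext (bclass_sum HH (index_enum _) Hi)) => x.
  rewrite horner_coef mulr_sumr mulr_suml; apply: eq_bigr => i _.
  by rewrite !mulrA (mulrC (psi x)).
have [c c0 cphi] := bounded_fun_bound (Mb Mphi).
have [b b0 bpsi] : exists2 b : R, 0 <= b & forall x, `|psi x| <= b.
  case: M1psi => [/Mb/bounded_fun_bound//|->]; exists 1 => // x.
  by rewrite /= normr1.
(* An affine change of phi that takes values in [0, 1] and sends the level a to 1/2. *)
pose dl := (2 * (c + `|a| + 1))^-1.
have dl0 : 0 < dl by rewrite invr_gt0 mulr_gt0// ltr_wpDl// addr_ge0.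
pose y x := 2^-1 + dl * (phi x - a).
have y01 x : 0 <= y x <= 1.
  have : `|dl * (phi x - a)| <= 2^-1.
    rewrite normrM (gtr0_norm dl0) /dl invfM -mulrA ler_piMr ?invr_ge0//.
    rewrite mulrC ler_pdivrMr ?mul1r; last by rewrite ltr_wpDl// addr_ge0.
    by rewrite (le_trans (ler_normB _ _))// -addrA lerD// lerDl.
  by rewrite ler_norml /y => /andP[? ?]; apply/andP; split; lra.
pose p n : {poly R} := (1 - ((2^-1)%:P + dl *: ('X - a%:P)) ^+ n) ^+ (n * 2 ^ n).
have pE n x : (p n).[phi x] = threshold n (y x) by rewrite /p !hornerE.
have W1 x : 0 <= W x <= 1.
  rewrite /W; elim: (l) => [|q s IHs]; first by rewrite big_nil ler01 lexx.
  by rewrite big_cons; case: (_ < _); rewrite ?mul1r ?mul0r ?lexx ?ler01.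
apply: (@bclass_lim _ _ _ _ HH (fun n x => psi x * (p n).[phi x] * W x) _ b) => //.
  move=> n x; rewrite pE !normrM -mulrA.
  have /andP[w0 w1] := W1 x; have /andP[t0 t1] := threshold_ge0_le1 n (y01 x).
  rewrite (ger0_norm w0) (ger0_norm t0) -[leRHS]mulr1; apply: ler_pM => //.
    exact: mulr_ge0.
  by rewrite mulr_ile1.
move=> x; rewrite big_cons /= mulrA; apply: cvgM; last exact: cvg_cst.
apply: cvgM; first exact: cvg_cst.
under eq_fun do rewrite pE.
have -> : (phi x < a) = (y x < 2^-1).
  by rewrite /y gtrDl pmulr_rlt0// subr_lt0.
exact: cvg_threshold.
Qed.

End multiplicative_class.

Lemma continuous_prod (T : topologicalType) (R : realType) (I : Type) (s : seq I)
    (F : I -> T -> R) : (forall i, continuous (F i)) ->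
  continuous (fun x => \prod_(i <- s) F i x).
Proof.
move=> cF; elim: s => [|i s IH].
  rewrite (_ : (fun x => _) = fun=> 1); last by apply/funext => x; rewrite big_nil.
  by move=> x; exact: cvg_cst.
rewrite (_ : (fun x => _) = fun x => F i x * \prod_(i <- s) F i x); last first.
  by apply/funext => x; rewrite big_cons.
by move=> x; apply: cvgM; [exact: cF|exact: IH].
Qed.

(** * The path space and its filtration *)

Section metrizable.
Context (R : realType) (X : topologicalType) (dst : X -> X -> R).
Hypotheses (dm : is_metric dst) (dt : metrizes dst).

Let dist_ge0 x y : 0 <= dst x y. Proof. by case: dm. Qed.
Let distxx x : dst x x = 0. Proof. by case: dm => _ h _ _; apply/h. Qed.
Let distC x y : dst x y = dst y x. Proof. by case: dm. Qed.
Let dist_tri y x z : dst x z <= dst x y + dst y z. Proof. by case: dm. Qed.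

Lemma metrizes_ball x e : 0 < e -> nbhs x [set y | dst x y < e].
Proof. by move=> e0; apply/dt; exists e. Qed.

Lemma metrizes_open_ball x e : open [set y | dst x y < e].
Proof.
rewrite openE => y /= xy; apply/dt; exists (e - dst x y); first by rewrite subr_gt0.
by move=> z /=; rewrite ltrBrDl; apply: le_lt_trans; exact: dist_tri.
Qed.

(** Its infimum is the distance to the complement of U capped at 1; adjoining 1 keeps the set
    non-empty when U is the whole space. *)
Let cozs (U : set X) (x : X) : set R := [set Num.min 1 (dst x y) | y in ~` U] `|` [set 1].

Let cozs_inf U x : has_inf (cozs U x).
Proof.
split; first by exists 1; right.
by exists 0 => _ [[y _ <-]|->]//; rewrite le_min ler01 dist_ge0.
Qed.

Definition cozero (U : set X) (x : X) : R := inf (cozs U x).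

Lemma cozero_ge0 U x : 0 <= cozero U x.
Proof.
apply: lb_le_inf; first by exists 1; right.
by move=> _ [[y _ <-]|->]//; rewrite le_min ler01 dist_ge0.
Qed.

Lemma cozero_le1 U x : cozero U x <= 1.
Proof. by apply: ge_inf; [by have [] := cozs_inf U x|right]. Qed.

Lemma cozero_lip U x y : cozero U x <= cozero U y + dst x y.
Proof.
rewrite -lerBlDr; apply: lb_le_inf; first by exists 1; right.
move=> _ [[z Uz <-]|->]; last first.
  by rewrite lerBlDr (le_trans (cozero_le1 _ _))// lerDl.
rewrite lerBlDr; apply: (@le_trans _ _ (Num.min 1 (dst x z))).
  by apply: ge_inf; [by have [] := cozs_inf U x|left; exists z].
have := dist_tri y x z; have := dist_ge0 x y; rewrite /Num.min.
by case: ifPn; case: ifPn; rewrite -?leNgt; lra.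
Qed.

Lemma cozero_continuous U : continuous (cozero U).
Proof.
move=> x; apply/cvgrPdist_lt => e e0; have := metrizes_ball x e0.
apply: filterS => y /= xy; apply: le_lt_trans xy.
have := cozero_lip U x y; have := cozero_lip U y x; rewrite (distC y x) => ? ?.
by rewrite ler_norml; apply/andP; split; lra.
Qed.

Lemma cozero_gt0 U x : open U -> (0 < cozero U x) <-> U x.
Proof.
move=> oU; split.
  apply: contraPP => Ux; apply/negP; rewrite -leNgt.
  apply: ge_inf; first by have [] := cozs_inf U x.
  by left; exists x => //; rewrite distxx; apply/min_idPr.
move=> Ux; have /dt[e e0 eU] : nbhs x U by exact: open_nbhs_nbhs.
apply: (@lt_le_trans _ _ (Num.min 1 e)); first by rewrite lt_min ltr01.
apply: lb_le_inf; first by exists 1; right.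
move=> _ [[y Uy <-]|->]; last by rewrite ge_min lexx.
rewrite le_min ge_min lexx /= ge_min; apply/orP; right; rewrite leNgt.
by apply/negP => /eU.
Qed.

Lemma countable_base (D : set X) : countable D -> dense D -> forall x0 : X,
  exists U : nat -> set X, (forall n, open (U n)) /\
    forall x A, nbhs x A -> exists2 n, U n x & U n `<=` A.
Proof.
move=> cD dD x0.
have /pfcard_geP[D0|[e]] := cD.
  have [] := dD setT; [by exists x0|exact: openT|].
  by move=> x []; rewrite D0.
pose U n := if unpickle n is Some (i, k) then
  [set y : X | dst (e i) y < (k.+1%:R : R)^-1] else set0.
exists U; split.
  move=> n; rewrite /U; case: unpickle => [[i k]|]; last exact: open0.
  exact: metrizes_open_ball.
move=> x A /dt[r r0 rA].
have r20 : 0 < r / 2 by rewrite divr_gt0.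
have [k _ kr] := near_infty_natSinv_lt (PosNum r20).
have {}kr : k.+1%:R^-1 < r / 2 :> R by exact: (kr k (leqnn k)).
have [||q [qx Dq]] := dD [set y | dst x y < k.+1%:R^-1].
- by exists x; rewrite /= distxx invr_gt0.
- exact: metrizes_open_ball.
have [|i _ eiq] := @surj _ _ _ _ e q; first exact: Dq.
exists (pickle (i, k)); rewrite /U pickleK eiq; first by rewrite /= distC.
move=> y /= qy; apply: rA => /=; apply: (le_lt_trans (dist_tri q _ _)).
by rewrite [r]splitr ltrD// (lt_trans _ kr).
Qed.

End metrizable.

Section paths.
Context {R : realType} {X : ptopologicalType}.
Local Notation Omega := (cpath R X).
Implicit Types (w : Omega) (r a b : R) (U : set X).

(** Times are real here: [mk_time] sends negative ones to 0, which spares continuity and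
    measurability statements any sign condition. *)
Definition at_time w r : X := eval_at (mk_time r) w.

Lemma at_time_continuous w : continuous (at_time w).
Proof.
move=> r; apply: continuous_comp; first exact: mk_time_continuous.
exact: cts_fun.
Qed.

Lemma along_path_continuous (Y : topologicalType) (phi : X -> Y) w :
  continuous phi -> continuous (fun r => phi (at_time w r)).
Proof.
move=> cphi r; apply: (@continuous_comp _ _ _ (at_time w) phi); last exact: cphi.
exact: at_time_continuous.
Qed.

Lemma time_valK (t : time R) : mk_time (time_val t) = t.
Proof.
have /= h := mk_timeK (time_val_ge0 t).
by apply: val_inj; exact: h.
Qed.

Lemma eval_atE (t : time R) w : eval_at t w = at_time w (time_val t).
Proof. by rewrite /at_time time_valK. Qed.

Lemma mk_time_le0 r : r <= 0 -> mk_time r = mk_time 0.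
Proof.
by move=> r0; apply: val_inj => /=; rewrite maxxx; apply/max_idPl.
Qed.

Lemma at_time_le0 w r : r <= 0 -> at_time w r = at_time w 0.
Proof. by move=> r0; rewrite /at_time mk_time_le0. Qed.

Lemma at_time_shift (s : time R) w r : 0 <= r ->
  at_time (Defs.shift s w) r = at_time w (time_val s + r).
Proof.
move=> r0; have -> : at_time (Defs.shift s w) r = eval_at (tadd s (mk_time r)) w by [].
by rewrite /tadd mk_timeK.
Qed.

Lemma path_ext w w' : (forall r, 0 <= r -> at_time w r = at_time w' r) -> w = w'.
Proof.
move=> h; have e : forall t, eval_at t w = eval_at t w'.
  by move=> t; rewrite !eval_atE h// time_val_ge0.
case: w w' e {h} => [f [[cf]]] [g [[cg]]] e.
have fg : f = g by apply/funext => t; exact: (e t).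
move: cf cg {e}; rewrite fg => cf cg.
by rewrite (Prop_irrelevance cf cg).
Qed.

Lemma open_segment a b U : open U ->
  open [set w : Omega | forall r, a <= r <= b -> U (at_time w r)].
Proof.
move=> oU.
have cK : compact (mk_time @` `[a, b] : set (time R)).
  apply: continuous_compact; last exact: segment_compact.
  by apply: continuous_subspaceT; exact: mk_time_continuous.
exists [set g : {compact-open, time R -> X} | g @` (mk_time @` `[a, b]) `<=` U].
  exact: compact_open_open.
apply/seteqP; split => w /= h.
  move=> r rab; apply: h; exists (mk_time r) => //; exists r => //.
move=> _ [_ [r /= rab <-] <-]; apply: h; by rewrite in_itv in rab.
Qed.

Lemma evaluation_continuous r : continuous (at_time^~ r : Omega -> X).
Proof.
move=> w A /=; rewrite nbhsE => -[U [oU Uw] UA].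
have := @open_segment r r _ oU; rewrite openE => /(_ w) h.
have /h : forall r0, r <= r0 <= r -> U (at_time w r0).
  by move=> r0; rewrite -eq_le => /eqP <-.
by apply: filterS => w' /= /(_ r); rewrite lexx => /(_ isT)/UA.
Qed.

(** Compact-open neighbourhoods control phi along a path uniformly on [a, b]: near each r a short
    segment is kept in an open set where phi varies by less than e / 2, and finitely many segments
    suffice. *)
Lemma near_segment (phi : X -> R) (w0 : Omega) a b (e : R) : continuous phi -> 0 < e ->
  \forall w \near w0, forall r, a <= r <= b ->
    `|phi (at_time w r) - phi (at_time w0 r)| < e.
Proof.
move=> cphi e0.
have e20 : 0 < e / 2 by rewrite divr_gt0.
have H r : `[a, b]%classic r -> \forall x' \near r & i \near w0,
    `|phi (at_time i x') - phi (at_time w0 x')| < e.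
  move=> _; have : continuous (fun s => phi (at_time w0 s)).
    by move=> s; apply: continuous_comp; [exact: at_time_continuous|exact: cphi].
  move=> /(_ r)/cvgrPdist_lt/(_ _ e20)/nbhs_ballP[dl dl0 hdl].
  have dl20 : 0 < dl / 2 by rewrite divr_gt0.
  have oU : open [set x | `|phi x - phi (at_time w0 r)| < e / 2].
    rewrite openE => x /= hx; have := cphi x => /cvgrPdist_lt.
    move=> /(_ (e / 2 - `|phi x - phi (at_time w0 r)|)).
    rewrite subr_gt0 => /(_ hx); apply: filterS => y; rewrite ltrBrDr => h.
    apply: le_lt_trans h; rewrite (distrC (phi x)); exact: ler_distD.
  have oW := @open_segment (r - dl / 2) (r + dl / 2) _ oU.
  exists (ball r (dl / 2), [set w : Omega | forall s, r - dl / 2 <= s <= r + dl / 2 ->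
    `|phi (at_time w s) - phi (at_time w0 r)| < e / 2]) => /=.
    split; first exact: nbhsx_ballx.
    apply: open_nbhs_nbhs; split => // s sr; rewrite distrC; apply: hdl.
    rewrite /ball /= distrC ltr_norml; move/andP : sr => [? ?].
    by apply/andP; split; lra.
  move=> [s w] /= [rs ws].
  have srd : r - dl / 2 <= s <= r + dl / 2.
    move: rs; rewrite /ball /= distrC ltr_norml => /andP[? ?].
    by apply/andP; split; lra.
  have rs' : ball r dl s by apply: le_ball rs; lra.
  rewrite [e]splitr; apply: le_lt_trans (ltrD (ws _ srd) (hdl _ rs')).
  exact: ler_distD.
have := @segment_compact _ a b; move/compact_near_coveringP.
move=> /(_ _ (nbhs w0) (fun (w : Omega) r =>
  `|phi (at_time w r) - phi (at_time w0 r)| < e) _ H).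
apply: filterS => w h r rab; apply: h => /=.
by rewrite in_itv.
Qed.

Variables (V : nat -> set X).
Hypotheses (oV : forall n, open (V n))
  (bV : forall x A, nbhs x A -> exists2 n, V n x & V n `<=` A).

(** The codes are countable and, by the next lemma, the boxes form a base of the topology. A code
    with reversed endpoints imposes no condition. *)
Definition path_box (l : seq (rat * rat * nat)) : set Omega :=
  [set w | forall p, p \in l -> forall r, ratr p.1.1 <= r <= ratr p.1.2 ->
     V p.2 (at_time w r)].

(** It suffices that the filter generated by the boxes around w0 converges to w0. On a compact K
    sent into O, each time has a rational segment around it which w0 maps into a basic set inside O;
    compactness of K leaves finitely many of them. *)
Lemma path_box_base (w0 : Omega) (A : set Omega) : nbhs w0 A ->
  exists2 l, path_box l w0 & path_box l `<=` A.
Proof.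
pose FF : set_system Omega := [set A | exists2 l, path_box l w0 & path_box l `<=` A].
have FFf : Filter FF.
  split.
  - by exists [::].
  - move=> P Q [l lw lP] [m mw mQ]; exists (l ++ m).
      by move=> p; rewrite mem_cat => /orP[/lw|/mw].
    move=> w h; split; [apply: lP|apply: mQ] => p pl; apply: h;
      by rewrite mem_cat pl ?orbT.
  - by move=> P Q PQ [l lw lP]; exists l => //; exact: subset_trans PQ.
suff : FF --> w0 by move=> h /h.
have : {compact-open, (fun w : Omega => (w : time R -> X)) @ FF --> (w0 : time R -> X)}.
  apply/compact_open_cvgP => K O cK oO w0K.
  move/compact_near_coveringP : cK => /(_ _ FF (fun w t => O (eval_at t w)) FFf) cK.
  have : \near FF, K `<=` (fun t => O (eval_at t FF)).
    apply: cK => t Kt.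
    have Ot : O (eval_at t w0) by apply: w0K; exists t.
    have [n Vn VO] := bV (open_nbhs_nbhs (conj oO Ot)).
    have : nbhs (at_time w0 (time_val t)) (V n).
      by apply: open_nbhs_nbhs; split => //; rewrite -eval_atE.
    move=> /at_time_continuous/nbhs_ballP[e e0 he].
    have [q1 /andP[q1l q1r]] : exists q : rat, time_val t - e < ratr q < time_val t.
      have : time_val t - e < time_val t by rewrite gtrBl.
      by move=> /rat_in_itvoo[q]; rewrite in_itv/= => ?; exists q.
    have [q2 /andP[q2l q2r]] : exists q : rat, time_val t < ratr q < time_val t + e.
      have : time_val t < time_val t + e by rewrite ltrDl.
      by move=> /rat_in_itvoo[q]; rewrite in_itv/= => ?; exists q.
    exists ([set t' | ratr q1 < time_val t' < ratr q2], path_box [:: (q1, q2, n)]) => /=.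
      split; last first.
        exists [:: (q1, q2, n)] => // p; rewrite inE => /eqP -> /= r /andP[r1 r2].
        have /he : ball (time_val t) e r; last by [].
        by rewrite /ball/= ltr_norml; apply/andP; split; lra.
      have : nbhs (time_val t) `]ratr q1, ratr q2[%classic.
        have tq : time_val t \in `]ratr q1, ratr q2[ by rewrite in_itv/= q1r q2l.
        exact: (near_in_itvoo tq).
      move=> tq; have /= := @time_val_continuous R t _ tq.
      rewrite nbhs_simpl /= [X in nbhs _ X -> _](_ : _ =
        [set t' | ratr q1 < time_val t' < ratr q2])//.
    move=> [t' w] /= [/andP[t'1 t'2] wl]; apply: VO; rewrite eval_atE.
    by apply: (wl (q1, q2, n)); rewrite ?inE//= !ltW.
  apply: filterS => w h _ [t Kt <-]; exact: h.
move=> cF A'; rewrite nbhsE => -[B [ [G oG GB] Bw0] BA].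
have /cF : nbhs ((w0 : time R -> X) : {compact-open, time R -> X}) G.
  by apply: open_nbhs_nbhs; split => //; move: Bw0; rewrite -GB.
by apply: (@filterS _ FF) => w /= Gw; apply: BA; rewrite -GB.
Qed.

End paths.

Lemma countable_bigcap_measurable d (T : measurableType d) (I : countType)
    (P : set I) (F : I -> set T) :
  (forall i, measurable (F i)) -> measurable (\bigcap_(i in P) F i).
Proof.
move=> mF; rewrite -[X in measurable X]setCK setC_bigcap bigcup_mkcond.
apply: measurableC; apply: countable_bigcupT_measurable => [|i]; first exact: countableP.
by case: ifP => // _; exact: measurableC.
Qed.

Lemma open_borel (S : ptopologicalType) (A : set S) :
  open A -> @measurable _ (borel S) A.
Proof. by move=> oA; exact: sub_sigma_algebra. Qed.

Lemma measurable_to_borel d (T : measurableType d) (S : ptopologicalType) (f : T -> borel S) :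
  (forall A : set S, open A -> measurable (f @^-1` A)) -> measurable_fun setT f.
Proof.
move=> h; apply: (@measurability _ _ T (borel S) setT f (@open S)) => //.
by move=> _ [A oA <-]; rewrite setTI; exact: h.
Qed.

Lemma continuous_measurable_borel (S : ptopologicalType) (R : realType) (f : S -> R) :
  continuous f -> measurable_fun setT (f : borel S -> R).
Proof.
move=> cf; apply: (measurability _ (RGenOInfty.measurableE R)).
move=> _ [_ [a ->] <-]; rewrite setTI; apply: open_borel.
by move/continuousP : cf; apply; exact: interval_open.
Qed.

Lemma continuous_bmf (S : ptopologicalType) (R : realType) (f : S -> R) :
  continuous f -> bounded_fun f -> bmf (f : borel S -> R).
Proof.
move=> cf bf; split; first exact: continuous_measurable_borel.
by have [c _ ?] := bounded_fun_bound bf; exists c.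
Qed.

Section coordinates.
Context {R : realType} {X : ptopologicalType}.
Local Notation Omega := (cpath R X).
Variable dst : X -> X -> R.
Hypotheses (dm : is_metric dst) (dt : metrizes dst).
Variables (V : nat -> set X).
Hypotheses (oV : forall n, open (V n))
  (bV : forall x A, nbhs x A -> exists2 n, V n x & V n `<=` A).

Local Notation coz := (cozero dst).
Local Notation code := (rat * rat * nat)%type.

Let box1 (p : code) : set Omega :=
  [set w | forall r, ratr p.1.1 <= r <= ratr p.1.2 -> V p.2 (at_time w r)].

(** A continuous function of w whose positivity set is [box1 p]; the adjoined 1 gives the right
    value on an empty segment. *)
Let seg (p : code) (w : Omega) : R :=
  inf ([set coz (V p.2) (at_time w r) | r in [set r | ratr p.1.1 <= r <= ratr p.1.2]] `|` [set 1]).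

Let seg_hasinf p (w : Omega) :
  has_inf ([set coz (V p.2) (at_time w r) | r in [set r | ratr p.1.1 <= r <= ratr p.1.2]] `|` [set 1]).
Proof.
split; first by exists 1; right.
by exists 0 => _ [[r _ <-]|->//]; exact: cozero_ge0.
Qed.

Let seg_ge0_le1 p (w : Omega) : 0 <= seg p w <= 1.
Proof.
apply/andP; split.
  apply: lb_le_inf; first by exists 1; right.
  by move=> _ [[r _ <-]|->]//; exact: cozero_ge0.
by apply: ge_inf; [by have [] := seg_hasinf p w|right].
Qed.

Let seg_lip p (w w' : Omega) (e : R) : 0 <= e -> (forall r, ratr p.1.1 <= r <= ratr p.1.2 ->
    `|coz (V p.2) (at_time w r) - coz (V p.2) (at_time w' r)| <= e) ->
  seg p w <= seg p w' + e.
Proof.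
move=> e0 h; rewrite -lerBlDr; apply: lb_le_inf; first by exists 1; right.
move=> _ [[r pr <-]|->]; last first.
  by rewrite lerBlDr; have /andP[_ ?] := seg_ge0_le1 p w; rewrite (@le_trans _ _ 1)// lerDl.
rewrite lerBlDr; apply: (@le_trans _ _ (coz (V p.2) (at_time w r))).
  by apply: ge_inf; [by have [] := seg_hasinf p w|left; exists r].
by have := h _ pr; rewrite ler_norml => /andP[? ?]; lra.
Qed.

Let seg_continuous p : continuous (seg p).
Proof.
move=> w; apply/(@cvgrPdist_le _ _ _ (nbhs w)) => e e0.
have := near_segment w (ratr p.1.1) (ratr p.1.2) (cozero_continuous dm dt (U := V p.2)) e0.
apply: filterS => w' h.
have h1 : seg p w <= seg p w' + e.
  by apply: seg_lip => [|r /h/ltW]; [exact: ltW|rewrite distrC].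
have h2 : seg p w' <= seg p w + e.
  by apply: seg_lip => [|r /h/ltW]; [exact: ltW|].
by rewrite ler_norml; apply/andP; split; lra.
Qed.

Let seg_gt0 p w : (0 < seg p w) <-> box1 p w.
Proof.
split=> [sp r pr|h].
  apply/(cozero_gt0 dm dt) => //; apply: (lt_le_trans sp).
  by apply: ge_inf; [by have [] := seg_hasinf p w|left; exists r].
have [ab|ab] := leP (ratr p.1.1 : R) (ratr p.1.2); last first.
  apply: (@lt_le_trans _ _ 1) => //; apply: lb_le_inf; first by exists 1; right.
  move=> _ [[r /andP[r1 r2] <-]|->]//.
  by have := lt_le_trans (le_lt_trans r2 ab) r1; rewrite ltxx.
have cc : continuous (fun r => coz (V p.2) (at_time w r)).
  by apply: along_path_continuous; exact: cozero_continuous.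
have [c cab hc] := EVT_min ab (continuous_subspaceT cc).
have c0 : 0 < coz (V p.2) (at_time w c).
  by apply/(cozero_gt0 dm dt) => //; apply: h; rewrite in_itv in cab.
apply: (lt_le_trans c0); apply: lb_le_inf; first by exists 1; right.
move=> _ [[r pr <-]|->]; last exact: cozero_le1.
by apply: hc; rewrite in_itv.
Qed.

Let boxf (l : seq code) (w : Omega) : R := \prod_(p <- l) seg p w.

Let boxf_ge0_le1 l w : 0 <= boxf l w <= 1.
Proof.
rewrite /boxf; elim: l => [|p l /andP[h1 h2]]; first by rewrite big_nil ler01 lexx.
rewrite big_cons; have /andP[h3 h4] := seg_ge0_le1 p w.
by rewrite mulr_ge0//= mulr_ile1.
Qed.

Let boxf_continuous l : continuous (boxf l).
Proof. by apply: continuous_prod => p; exact: seg_continuous. Qed.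

Let boxf_gt0 l w : (0 < boxf l w) <-> path_box V l w.
Proof.
rewrite /boxf; elim: l => [|p l IH]; first by rewrite big_nil; split.
rewrite big_cons; have /andP[s0 _] := seg_ge0_le1 p w; split.
  move=> h; have sp : 0 < seg p w.
    by rewrite lt_def s0 andbT; apply/eqP => e; rewrite e mul0r ltxx in h.
  move=> q; rewrite inE => /predU1P[->|]; first exact/seg_gt0.
  by move: h; rewrite pmulr_rgt0// => /IH; exact.
move=> h; apply: mulr_gt0; first by apply/seg_gt0; apply: h; rewrite inE eqxx.
by apply/IH => q ql; apply: h; rewrite inE ql orbT.
Qed.

(** As the integer component grows, a fixed list of boxes yields the indicator of their union in the
    limit. If the list also exhausts the boxes contained in an open set, the limit is the indicator
    of that set. *)
Let gfam (c : seq (seq code) * nat) (w : Omega) : R :=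
  1 - \prod_(l <- c.1) (1 - Num.min 1 (c.2%:R * boxf l w)).

Let gfam_ge0_le1 c w : 0 <= gfam c w <= 1.
Proof.
rewrite /gfam; suff : 0 <= \prod_(l <- c.1) (1 - Num.min 1 (c.2%:R * boxf l w)) <= 1 by lra.
elim: (c.1) => [|l s /andP[h1 h2]]; first by rewrite big_nil ler01 lexx.
rewrite big_cons; have /andP[b0 b1] := boxf_ge0_le1 l w.
have m0 : 0 <= Num.min 1 (c.2%:R * boxf l w) by rewrite le_min ler01 mulr_ge0.
have m1 : Num.min 1 (c.2%:R * boxf l w) <= 1 by rewrite ge_min lexx.
by rewrite mulr_ge0 ?mulr_ile1//; lra.
Qed.

Let gfam_continuous c : continuous (gfam c).
Proof.
have cB (f : Omega -> R) : continuous f -> continuous (fun w => 1 - f w).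
  move=> cf w; apply: (@cvgB R R^o _ (nbhs w) _ (fun=> 1) f); last exact: cf.
  exact: cvg_cst.
apply: (cB); apply: (@continuous_prod Omega R _ c.1 (fun l w => 1 - Num.min 1 (c.2%:R * boxf l w))).
move=> l; apply: cB => w.
apply: (@continuous_min _ _ (fun=> 1) (fun w => c.2%:R * boxf l w)).
  exact: cst_continuous.
by apply: (@continuousM R Omega (fun=> c.2%:R) (boxf l)); [exact: cst_continuous|exact: boxf_continuous].
Qed.

Let gfam_Cb c : Cb R X (gfam c).
Proof.
split; first exact: gfam_continuous.
exists 1; split; first exact: num_real.
move=> x x1 w _; have /andP[? ?] := gfam_ge0_le1 c w.
by rewrite /= ger0_norm//; lra.
Qed.

Let open_approx (A : set Omega) : open A ->
  exists c : nat -> seq (seq code) * nat, forall w, gfam (c n) w @[n --> \oo] --> (\1_A w : R).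
Proof.
move=> oA.
pose L n : seq (seq code) := [seq l <- pmap unpickle (iota 0 n) | `[< path_box V l `<=` A >]].
exists (fun n => (L n, n)) => w; rewrite indicE.
have [wA|wA] := boolP (w \in A); last first.
  apply: cvg_near_cst; apply: nearW => n; rewrite /gfam big_seq big1 ?subrr//.
  move=> l /=; rewrite mem_filter => /andP[/asboolP lA _].
  have -> : boxf l w = 0.
    apply/eqP; rewrite eq_le; have /andP[-> _] := boxf_ge0_le1 l w; rewrite andbT leNgt.
    by apply/negP => /boxf_gt0/lA; move: wA; rewrite notin_setE.
  rewrite mulr0 (_ : Num.min 1 0 = 0) ?subr0//; exact/min_idPr.
rewrite inE in wA.
have [l lw lA] := path_box_base oV bV (@open_nbhs_nbhs _ w A (conj oA wA)).
have bl : 0 < boxf l w by apply/boxf_gt0.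
apply: cvg_near_cst; near=> n.
have lL : l \in L n.
  rewrite mem_filter; apply/andP; split; first exact/asboolP.
  rewrite mem_pmap; apply/mapP; exists (pickle l); last by rewrite pickleK.
  rewrite mem_iota add0n /=; near: n; exact: nbhs_infty_gt.
rewrite /gfam /= (big_rem _ lL)/= (_ : Num.min 1 _ = 1) ?subrr ?mul0r ?subr0//.
apply/min_idPl; rewrite -ler_pdivrMr//.
near: n; exact: nbhs_infty_ger.
Unshelve. all: by end_near. Qed.

(** Countability is the point: it allows a measurable selection by successive maximisation, and
    exceptional null sets that do not depend on the event. *)
Lemma determining_Cb : exists D : nat -> Omega -> R, (forall k, Cb R X (D k)) /\
  forall H : set (borel Omega -> R), bounded_class H -> (forall k, H (D k)) ->
    forall f, bmf f -> H f.
Proof.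
exists (fun k => if unpickle k is Some c then gfam c else gfam ([::], 0%N)); split.
  by move=> k; case: unpickle => *; exact: gfam_Cb.
move=> H HH HD f bf.
apply: (bclass_bmf HH (G := @open Omega)) => //.
  by move=> A B; exact: openI.
move=> A /open_approx[c hc]; apply: (bclass_lim HH _ _ hc) => [n|n w].
  by have := HD (pickle (c n)); rewrite pickleK.
by have /andP[h0 h1] := gfam_ge0_le1 (c n) w; rewrite ger0_norm//; exact: h1.
Qed.

(** Open sets are countable unions of boxes, and a box is read off at rational times by continuity.
    Positive times are enough because w(0) is the limit of w(1 / (n + 1)). *)
Lemma borel_coordinates (S : set (set Omega)) : sigma_algebra setT S ->
  (forall r, 0 < r -> forall U, open U -> S [set w | U (at_time w r)]) ->
  @measurable _ (borel Omega) `<=` S.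
Proof.
move=> sS SU; apply: smallest_sub => //.
pose W := g_sigma_algebraType S.
have SE : @measurable _ W = S by rewrite /measurable /= sigma_algebra_id.
have mpos r U : 0 < r -> measurable_fun setT (fun w : W => coz U (at_time w r)).
  move=> r0; have : measurable_fun setT ((fun w : W => at_time w r) : W -> borel X).
    apply: measurable_to_borel => A oA; rewrite SE; exact: SU.
  move=> m1; apply: (measurableT_comp _ m1).
  by apply: continuous_measurable_borel; exact: cozero_continuous.
have mall r U : measurable_fun setT (fun w : W => coz U (at_time w r)).
  have [r0|r0] := ltP 0 r; first exact: mpos.
  under eq_fun do rewrite at_time_le0//.
  apply: (@measurable_fun_cvg _ _ _ _ (fun n (w : W) => coz U (at_time w n.+1%:R^-1))).
    by move=> n; apply: mpos; rewrite invr_gt0.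
  move=> w _; have cc : continuous (fun r => coz U (at_time w r)).
    by apply: along_path_continuous; exact: cozero_continuous.
  exact: (continuous_cvg _ (cc 0) cvg_harmonic).
have mbox1 p : S (box1 p).
  rewrite -SE.
  (* On a compact segment positivity means a uniform lower bound, which can be tested at rational
     times. *)
  rewrite (_ : box1 p = \bigcup_m \bigcap_(q in [set q : rat | p.1.1 <= q <= p.1.2])
     [set w : W | m.+1%:R^-1 <= coz (V p.2) (at_time w (ratr q))]); last first.
    apply/seteqP; split => w.
      move=> /seg_gt0 sp; have [m _ /(_ m (leqnn m)) ms] := near_infty_natSinv_lt (PosNum sp).
      exists m => // q /= /andP[q1 q2]; rewrite (le_trans (ltW ms))//=.
      apply: ge_inf; first by have [] := seg_hasinf p w.
      by left; exists (ratr q) => //=; rewrite !ler_rat q1.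
    move=> [m _ hm] r /andP[r1 r2]; apply/(cozero_gt0 dm dt) => //.
    apply: (@lt_le_trans _ _ m.+1%:R^-1); first by rewrite invr_gt0.
    (* The left end is rational itself; any other r has rationals of the segment just to its
       left. *)
    have [re|rne] := eqVneq r (ratr p.1.1).
      by rewrite re; apply: hm; rewrite /= lexx -(ler_rat R) -re.
    have r1' : ratr p.1.1 < r by rewrite lt_def rne.
    rewrite leNgt; apply/negP => hlt.
    have cc : continuous (fun r => coz (V p.2) (at_time w r)).
      by apply: along_path_continuous; exact: cozero_continuous.
    have := cc r => /cvgrPdist_lt/(_ (m.+1%:R^-1 - coz (V p.2) (at_time w r))).
    rewrite subr_gt0 => /(_ hlt) /nbhs_ballP[e e0 he].
    have : Num.max (ratr p.1.1) (r - e) < r by rewrite gt_max r1' gtrBl.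
    move=> /rat_in_itvoo[q]; rewrite in_itv /= gt_max => /andP[/andP[q1 q2] q3].
    have /he/= : ball r e (ratr q).
      by rewrite /ball /= ltr_norml; apply/andP; split; lra.
    have : m.+1%:R^-1 <= coz (V p.2) (at_time w (ratr q)).
      by apply: hm; rewrite /= -!(ler_rat R) (ltW q1)/= (le_trans (ltW q3) r2).
    move=> h1; rewrite distrC => /ltr_normlW; rewrite ltrD2r => h2.
    by have := le_lt_trans h1 h2; rewrite ltxx.
  apply: bigcup_measurable => m _.
  apply: countable_bigcap_measurable => q.
  rewrite -[X in measurable X]setTI.
  have := mall (ratr q) (V p.2) measurableT `[m.+1%:R^-1, +oo[%classic (measurable_itv _).
  congr measurable; apply/seteqP; split => w /=; by rewrite in_itv /= andbT.
have mbox l : S (path_box V l).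
  elim: l => [|p l IH].
    rewrite -SE (_ : path_box V [::] = setT)//; apply/seteqP; split => //.
  rewrite -SE (_ : path_box V _ = box1 p `&` path_box V l).
    by apply: measurableI; rewrite SE.
  apply/seteqP; split => w.
    move=> h; split; first by apply: h; rewrite inE eqxx.
    by move=> q ql; apply: h; rewrite inE ql orbT.
  by move=> [h1 h2] q; rewrite inE => /predU1P[-> //|]; exact: h2.
move=> A oA; rewrite -SE.
pose B (o : option (seq code)) : set W := if o is Some l then
    (if `[< path_box V l `<=` A >] then path_box V l else set0) else set0.
have mB o : measurable (B o).
  by case: o => [l|]//=; case: ifP => // _; rewrite SE.
rewrite (_ : A = \bigcup_n B (unpickle n)); first exact: bigcup_measurable.
apply/seteqP; split => w.
  move=> Aw; have [l lw lA] := path_box_base oV bV (@open_nbhs_nbhs _ w A (conj oA Aw)).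
  by exists (pickle l) => //; rewrite pickleK /=; case: asboolP.
by move=> [n _]; case: (unpickle n) => [l|]//=; case: asboolP => // lA /lA.
Qed.

End coordinates.

(* f (rho x) x is the limit of its values along discretisations of rho. *)
Lemma diag_measurable d (W : measurableType d) (R : realType) (f : R -> W -> R)
    (rho : W -> R) :
  (forall r, measurable_fun setT (f r)) -> (forall x, continuous (f^~ x)) ->
  measurable_fun setT rho -> measurable_fun setT (fun x => f (rho x) x).
Proof.
move=> mf cf mrho.
pose k n x : int := Num.floor (n.+1%:R * rho x).
pose rn n x : R := (k n x)%:~R / n.+1%:R.
apply: (@measurable_fun_cvg _ _ _ _ (fun n x => f (rn n x) x)).
  move=> n _ B mB; rewrite setTI.
  have -> : (fun x => f (rn n x) x) @^-1` B =
    \bigcup_(z : int) ([set x | k n x = z] `&` (f (z%:~R / n.+1%:R) @^-1` B)).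
    apply/seteqP; split => x /=; first by move=> h; exists (k n x).
    by move=> [z _ [/= e]]; rewrite /rn e.
  apply: countable_bigcupT_measurable => [|z]; first exact: countableP.
  apply: measurableI; last first.
    by have := mf (z%:~R / n.+1%:R) measurableT B mB; rewrite setTI.
  have m1 : measurable_fun setT (fun x => n.+1%:R * rho x) by exact: measurable_funM.
  have := m1 measurableT `[z%:~R, (z + 1)%:~R[%classic (measurable_itv _).
  rewrite setTI; congr measurable; apply/seteqP; split => x /=; rewrite in_itv /=.
    by move=> h; apply/eqP; rewrite /k floor_eq.
  by move=> /eqP; rewrite /k floor_eq.
move=> x _; apply: (continuous_cvg _ (cf x (rho x))).
apply/cvgrPdist_le => e e0.
have := near_infty_natSinv_lt (PosNum e0); apply: filterS => n /= ne.
apply: le_trans (ltW ne).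
have n0 : 0 < n.+1%:R :> R by [].
have := floor_itv (n.+1%:R * rho x) => /andP[h1 h2].
rewrite /rn /k ler_norml -(ler_pM2l n0) mulrN mulrBr mulrCA !mulfV ?gt_eqF// mulr1.
rewrite -(ler_pM2l n0 (rho x - _)) mulrBr mulrCA !mulfV ?gt_eqF// mulr1.
move: h2; rewrite intrD /= => h2; apply/andP; split; lra.
Qed.

Section omega_measurability.
Context {R : realType} {X : ptopologicalType} (hX : polish R X).
Local Notation Omega := (cpath R X).

Lemma polish_metric : exists d : X -> X -> R, [/\ is_metric d, metrizes d &
  exists2 V : nat -> set X, (forall n, open (V n)) &
   (forall x A, nbhs x A -> exists2 n, V n x & V n `<=` A)].
Proof.
have [[D cD dD] [d [dm dt _]]] := hX; exists d; split => //.
by have [V [oV bV]] := countable_base dm dt cD dD point; exists V.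
Qed.

Lemma Omega_determining : exists D : nat -> Omega -> R, (forall k, Cb R X (D k)) /\
  forall H : set (borel Omega -> R), bounded_class H -> (forall k, H (D k)) ->
    forall f, bmf f -> H f.
Proof. by have [d [dm dt [V oV bV]]] := polish_metric; exact: (determining_Cb dm dt oV bV). Qed.

Lemma Omega_coordinates (S : set (set Omega)) : sigma_algebra setT S ->
  (forall r, 0 < r -> forall U, open U -> S [set w | U (at_time w r)]) ->
  @measurable _ (borel Omega) `<=` S.
Proof. by have [d [dm dt [V oV bV]]] := polish_metric; exact: (borel_coordinates dm dt oV bV). Qed.

Lemma open_cozero (U : set X) : open U -> exists f : X -> R,
  [/\ continuous f, forall x, 0 <= f x <= 1 & forall x, 0 < f x <-> U x].
Proof.
move=> oU; have [d [dm dt _]] := polish_metric; exists (cozero d U); split.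
- exact: cozero_continuous.
- by move=> x; rewrite cozero_ge0//= cozero_le1.
- by move=> x; exact: cozero_gt0.
Qed.

Lemma range01_bounded (T : Type) (f : T -> R) : (forall x, 0 <= f x <= 1) -> bounded_fun f.
Proof.
move=> f01; exists 1; split; first exact: num_real.
move=> c c1 x _; have /andP[? ?] := f01 x.
by rewrite /= ger0_norm//; lra.
Qed.

Lemma measurable_to_X d (W : measurableType d) (g : W -> borel X) :
  (forall f : X -> R, continuous f -> bounded_fun f -> measurable_fun setT (fun x => f (g x))) ->
  measurable_fun setT g.
Proof.
move=> h; apply: measurable_to_borel => A /open_cozero[f [cf f01 fA]].
have := h f cf (range01_bounded f01) measurableT `]0, +oo[%classic (measurable_itv _).
rewrite setTI; congr measurable; apply/seteqP.
by split => x /=; rewrite in_itv/= andbT; apply fA.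
Qed.

Lemma measurable_to_Omega d (W : measurableType d) (g : W -> borel Omega) :
  (forall r, 0 < r -> measurable_fun setT ((fun x => at_time (g x) r) : W -> borel X)) ->
  measurable_fun setT g.
Proof.
move=> h; apply: measurable_to_borel => A oA.
have := @Omega_coordinates [set A | measurable (g @^-1` A)]; apply; last exact: open_borel.
- split => /=.
  + by rewrite preimage_set0.
  + by move=> B mB; rewrite setTD preimage_setC; exact: measurableC.
  + by move=> B mB; rewrite preimage_bigcup; exact: bigcup_measurable.
- move=> r r0 U oU /=; have := h r r0 measurableT U (open_borel oU).
  by rewrite setTI.
Qed.

Lemma at_time_measurable r :
  measurable_fun setT (at_time^~ r : borel Omega -> borel X).
Proof.
apply: measurable_to_borel => A oA; apply: open_borel.
by have /continuousP := @evaluation_continuous R X r; apply.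
Qed.

Lemma continuous_at_time_bmf r (f : X -> R) : continuous f -> bounded_fun f ->
  bmf ((fun w => f (at_time w r)) : borel Omega -> R).
Proof.
move=> cf bf; apply: (bmf_comp (f := f : borel X -> R)); last exact: at_time_measurable.
exact: continuous_bmf.
Qed.

Lemma filtration_sigma (t : time R) : sigma_algebra [set: Omega] (filtration t).
Proof. exact: smallest_sigma_algebra. Qed.

Definition Fsp (t : time R) : measurableType _ := g_sigma_algebraType (@filtration R X t).

Lemma FspE (t : time R) : @measurable _ (Fsp t) = filtration t.
Proof. by rewrite /measurable /= sigma_algebra_id//; exact: filtration_sigma. Qed.

Lemma filtration_coord (t : time R) r (B : set X) : r <= time_val t ->
  @measurable _ (borel X) B -> filtration t [set w : Omega | B (at_time w r)].
Proof.
move=> rt mB; apply: sub_sigma_algebra.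
exists (mk_time r) => /=; first by rewrite /time_val set_valE /= ge_max time_val_ge0.
by exists B => //; rewrite setTI.
Qed.

Lemma filtration_at (t : time R) r : r <= time_val t ->
  measurable_fun setT (at_time^~ r : Fsp t -> borel X).
Proof.
by move=> rt _ B mB; rewrite setTI FspE; exact: filtration_coord.
Qed.

Lemma filtration_borel (t : time R) (A : set Omega) : filtration t A -> @measurable _ (borel Omega) A.
Proof.
move: A; apply: smallest_sub; first exact: sigma_algebra_measurable.
move=> _ [r _ [B mB <-]]; rewrite setTI.
have := at_time_measurable (time_val r) measurableT mB; rewrite setTI.
by rewrite (_ : eval_at r = at_time^~ (time_val r))//; apply/funext => w; rewrite eval_atE.
Qed.

Lemma filtration_mono (s t : time R) : time_val s <= time_val t ->
  @filtration R X s `<=` filtration t.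
Proof.
move=> st; apply: smallest_sub; first exact: filtration_sigma.
by move=> A [r rs h]; apply: sub_sigma_algebra; exists r => //=; exact: le_trans rs st.
Qed.

(* An event of F_t cannot separate two paths which agree up to time t. *)
Lemma galmarino (t : time R) (A : set Omega) (w w' : Omega) : filtration t A ->
  (forall r, 0 <= r <= time_val t -> at_time w r = at_time w' r) -> A w -> A w'.
Proof.
move=> FA ww'; suff : A w <-> A w' by case.
move: A FA; apply: (@smallest_sub _ _ _ [set A | A w <-> A w']).
  split => /=; first by split.
  - by move=> B h; rewrite /setD /=; tauto.
  - by move=> F h; split => -[n _ Fn]; exists n => //; apply/h.
move=> _ [r rt [B mB <-]]; rewrite setTI /= !eval_atE ww'//.
by rewrite time_val_ge0.
Qed.

Lemma measurable_of_sublevel d (W : measurableType d) (f : W -> R) :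
  (forall x, measurable [set w | f w <= x]) -> measurable_fun setT f.
Proof.
move=> h; apply: (measurability _ (RGenOInfty.measurableE R)).
move=> _ [_ [a ->] <-]; rewrite setTI.
rewrite (_ : _ @^-1` _ = ~` [set w | f w <= a]); first exact: measurableC.
by apply/seteqP; split => w /=; rewrite in_itv/= andbT ltNge => /negP.
Qed.

Lemma stopping_timeP (T : Omega -> R) : (forall w, 0 <= T w) ->
  (forall s, 0 <= s -> filtration (mk_time s) [set w | T w <= s]) ->
  stopping_time (fun w => mk_time (T w)).
Proof.
move=> T0 h s; have := h (time_val s) (time_val_ge0 s); rewrite time_valK.
by congr filtration; apply/seteqP; split => w /=; rewrite mk_timeK.
Qed.

Lemma stopping_cst (c : time R) : stopping_time (fun _ : Omega => c).
Proof.
move=> s; have [cs|cs] := boolP (time_val c <= time_val s).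
  rewrite (_ : [set w | _] = setT); last by apply/seteqP; split.
  by rewrite -FspE; exact: measurableT.
rewrite (_ : [set w | _] = set0); last by apply/seteqP; split.
by rewrite -FspE; exact: measurable0.
Qed.

Section stopping.
Variables (tau : Omega -> time R) (st : stopping_time tau).
Local Notation T w := (time_val (tau w)).

Lemma stopping_le s : filtration (mk_time s) [set w | T w <= s].
Proof.
have [s0|s0] := leP 0 s; first by have := @st (mk_time s); rewrite mk_timeK.
rewrite (_ : [set w | _] = set0); first by rewrite -FspE; exact: measurable0.
by apply/seteqP; split => w //= h; have := time_val_ge0 (tau w); lra.
Qed.

Lemma stopping_measurable : measurable_fun setT ((fun w => T w) : borel Omega -> R).
Proof.
by apply: measurable_of_sublevel => x; apply: (@filtration_borel (mk_time x)); exact: stopping_le.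
Qed.

Lemma stopping_min_measurable (s : time R) :
  measurable_fun setT ((fun w => Num.min (T w) (time_val s)) : Fsp s -> R).
Proof.
apply: measurable_of_sublevel => x.
have [xs|xs] := leP (time_val s) x.
  rewrite (_ : [set w | _] = setT); first exact: measurableT.
  by apply/seteqP; split => w //= _; rewrite ge_min xs orbT.
rewrite (_ : [set w | _] = [set w | T w <= x]); last first.
  by apply/seteqP; split => w /=; rewrite ge_min [X in _ || X]leNgt xs orbF.
rewrite FspE; apply: (@filtration_mono (mk_time x)); last exact: stopping_le.
by rewrite /time_val set_valE /= ge_max time_val_ge0 ltW.
Qed.

Lemma eval_tauE w : eval_tau tau w = at_time w (T w).
Proof. by rewrite /eval_tau eval_atE. Qed.

Lemma at_time_theta w r : 0 <= r -> at_time (theta tau w) r = at_time w (T w + r).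
Proof. by move=> r0; rewrite /theta at_time_shift. Qed.

Lemma at_time_stopping_measurable (rho : borel Omega -> R) : measurable_fun setT rho ->
  measurable_fun setT ((fun w => at_time w (rho w)) : borel Omega -> borel X).
Proof.
move=> mrho; apply: measurable_to_X => f cf bf.
apply: (@diag_measurable _ _ _ (fun r (w : borel Omega) => f (at_time w r))) => //.
  by move=> r; have [] := continuous_at_time_bmf r cf bf.
by move=> w; exact: along_path_continuous.
Qed.

Lemma eval_tau_measurable : measurable_fun setT (eval_tau tau : borel Omega -> borel X).
Proof.
rewrite (_ : eval_tau tau = fun w => at_time w (T w)); last by apply/funext => w; rewrite eval_tauE.
exact: (at_time_stopping_measurable stopping_measurable).
Qed.

Lemma theta_measurable : measurable_fun setT (theta tau : borel Omega -> borel Omega).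
Proof.
apply: measurable_to_Omega => r r0.
under eq_fun do rewrite at_time_theta ?ltW//.
apply: (@at_time_stopping_measurable (fun w => T w + r)).
by apply: measurable_funD => //; exact: stopping_measurable.
Qed.

Lemma stopped_sigma : sigma_algebra setT (stopped_field tau).
Proof.
split.
- split; first exact: measurable0.
  by move=> s; rewrite set0I -FspE; exact: measurable0.
- move=> A [mA hA]; rewrite setTD; split; first exact: measurableC.
  move=> s; rewrite (_ : ~` A `&` _ = [set w | T w <= time_val s] `\`
     (A `&` [set w | T w <= time_val s])).
    by rewrite -FspE; apply: measurableD; rewrite FspE; [exact: st|exact: hA].
  by apply/seteqP; split => w /=; rewrite /setD /=; tauto.
- move=> F hF; split; first by apply: bigcup_measurable => n _; have [] := hF n.
  move=> s; rewrite setI_bigcupl -FspE; apply: bigcup_measurable => n _.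
  by rewrite FspE; have [_] := hF n; exact.
Qed.

Lemma stoppedC A : stopped_field tau A -> stopped_field tau (~` A).
Proof. by move=> h; rewrite -setTD; have [_ + _] := stopped_sigma; exact. Qed.

Lemma stoppedT : stopped_field tau [set: Omega].
Proof. by rewrite -setC0; apply: stoppedC; have [] := stopped_sigma. Qed.

Definition stopped_type : measurableType _ := g_sigma_algebraType (stopped_field tau).

Lemma stopped_typeE : @measurable _ stopped_type = stopped_field tau.
Proof. by rewrite /measurable /= sigma_algebra_id//; exact: stopped_sigma. Qed.

Lemma stopped_le s : stopped_field tau [set w | T w <= s].
Proof.
split; first by apply: (@filtration_borel (mk_time s)); exact: stopping_le.
move=> r; rewrite (_ : [set w | _] `&` _ = [set w | T w <= Num.min s (time_val r)]); last first.
  by apply/seteqP; split => w /=; rewrite le_min; [move=> [-> ->]|move=> /andP].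
apply: (@filtration_mono (mk_time (Num.min s (time_val r)))); last exact: stopping_le.
by rewrite /time_val set_valE /= ge_max time_val_ge0/= ge_min lexx orbT.
Qed.

(** On the event tau + c <= S, both tau and the time of evaluation coincide with their truncations
    at S, and the position at the truncated time is F_S-measurable. *)
Lemma stopped_at c (U : set X) : 0 <= c -> @measurable _ (borel X) U ->
  stopped_field (fun w => mk_time (T w + c)) [set w | U (at_time w (T w + c))].
Proof.
move=> c0 mU; split.
  have := @at_time_stopping_measurable (fun w => T w + c).
  move=> /(_ (measurable_funD stopping_measurable (measurable_cst _)) measurableT U mU).
  by rewrite setTI.
move=> s; set S := time_val s.
have -> : [set w | U (at_time w (T w + c))] `&` [set w | time_val (mk_time (T w + c)) <= S] =
  [set w | U (at_time w (Num.min (Num.min (T w) S + c) S))] `&` [set w | T w <= S - c].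
  apply/seteqP; split => w /=; rewrite mk_timeK ?addr_ge0 ?time_val_ge0// lerBrDr => -[h1 h2];
    split => //; move: h1; (rewrite (_ : Num.min (T w) S = T w); last by apply/min_idPl; lra);
    by rewrite (_ : Num.min _ S = T w + c)//; apply/min_idPl.
rewrite -FspE; apply: measurableI; last first.
  rewrite FspE; apply: (@filtration_mono (mk_time (S - c))); last exact: stopping_le.
  by rewrite /time_val set_valE /= ge_max time_val_ge0/= -/S gerBl.
have m1 : measurable_fun setT ((fun w => at_time w (Num.min (Num.min (T w) S + c) S)) : Fsp s -> borel X).
  apply: measurable_to_X => f cf bf.
  apply: (@diag_measurable _ _ _ (fun r (w : Fsp s) => f (at_time w (Num.min r S))) (fun w => Num.min (T w) S + c)).
  - move=> r; apply: (@measurableT_comp _ _ _ _ (borel X) _ f).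
      exact: continuous_measurable_borel.
    by apply: filtration_at; rewrite ge_min lexx orbT.
  - move=> w r; apply: (@continuous_comp _ _ _ (fun r => Num.min r S) (fun r => f (at_time w r))).
      by apply: continuous_min; [exact: cvg_id|exact: cvg_cst].
    exact: along_path_continuous.
  - by apply: measurable_funD => //; exact: stopping_min_measurable.
by have := m1 measurableT U mU; rewrite setTI.
Qed.

Lemma stopped_eval_tau : measurable_fun setT (eval_tau tau : stopped_type -> borel X).
Proof.
move=> _ U mU; rewrite setTI stopped_typeE.
have := stopped_at (lexx 0) mU.
rewrite (_ : (fun w => mk_time (T w + 0)) = tau); last first.
  by apply/funext => w; rewrite addr0 time_valK.
by congr stopped_field; apply/seteqP; split => w /=; rewrite eval_tauE addr0.
Qed.

(** This is how inequalities for stopping times get localised on A: a large delay off A makes the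
    discounted contribution of the complement negligible. *)
Lemma stopping_delay (A : set Omega) c : 0 <= c -> stopped_field tau A ->
  stopping_time (fun w => mk_time (T w + (if w \in A then 0 else c))).
Proof.
move=> c0 hA; apply: stopping_timeP => [w|s s0].
  by case: ifP => _; rewrite ?addr0 ?addr_ge0 ?time_val_ge0.
have -> : [set w | T w + (if w \in A then 0 else c) <= s] =
   (A `&` [set w | T w <= s]) `|` (~` A `&` [set w | T w <= s - c]).
  apply/seteqP; split => w /=.
    case: ifPn; rewrite ?inE ?notin_setE => wA; first by rewrite addr0; left.
    by rewrite lerBrDr; right.
  move=> [[wA h]|[wA h]]; first by rewrite mem_set// addr0.
  by rewrite memNset// -lerBrDr.
rewrite -FspE; apply: measurableU; rewrite FspE.
  by have [_ /(_ (mk_time s))] := hA; rewrite mk_timeK.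
have [sc|sc] := ltP s c.
  rewrite (_ : _ `&` _ = set0); first by rewrite -FspE; exact: measurable0.
  apply/seteqP; split => w //= [_ h]; have := time_val_ge0 (tau w); lra.
have [_ /(_ (mk_time (s - c)))] := stoppedC hA; rewrite mk_timeK ?subr_ge0// => h.
apply: filtration_mono h; rewrite !mk_timeK ?subr_ge0//; lra.
Qed.

Lemma stopped_delay c : 0 <= c ->
  stopped_field tau `<=` stopped_field (fun w => mk_time (T w + c)).
Proof.
move=> c0 A [mA hA]; split => // s.
rewrite (_ : [set w | time_val _ <= _] = [set w | T w <= time_val s] `&` [set w | T w <= time_val s - c]).
  rewrite setIA -FspE; apply: measurableI; first by rewrite FspE.
  rewrite FspE; apply: (@filtration_mono (mk_time (time_val s - c))); last exact: stopping_le.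
  by rewrite {1}/time_val set_valE /= ge_max time_val_ge0/= gerBl.
apply/seteqP; split => w /=; rewrite mk_timeK ?addr_ge0 ?time_val_ge0//.
  by move=> h; split; lra.
by move=> [_ h]; lra.
Qed.

End stopping.
End omega_measurability.

(** * Discounted integrals and Laplace transforms *)

Section discounting.
Context (R : realType).
Notation mu := (@lebesgue_measure R).
Implicit Types (l c s t : R) (g : R -> R).

Definition Iint l g s : R := (\int[mu]_(t in `[0%R, s]) (expR (- (l * t)) * g t))%R.

Definition Finf l g : R := (\int[mu]_(t in `[0%R, +oo[) (expR (- (l * t)) * g t))%R.

(** The discount factor, frozen at 1 for negative times: for l >= 0 it is bounded by 1 on the whole
    line and agrees with exp(-l t) on the domain of integration. *)
Definition ex l t : R := expR (- (l * Num.max 0 t)).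

Lemma ex_ge0 l t : 0 <= ex l t. Proof. exact: expR_ge0. Qed.

Lemma exE l t : 0 <= t -> ex l t = expR (- (l * t)).
Proof. by move=> t0; rewrite /ex (max_idPr t0). Qed.

Lemma ex_le1 l t : 0 <= l -> ex l t <= 1.
Proof. by move=> l0; rewrite expR_le1 oppr_le0 mulr_ge0// le_max lexx. Qed.

Lemma ex_continuous l : continuous (ex l).
Proof.
move=> t; apply: (@continuous_comp _ _ _ (fun t => - (l * Num.max 0 t)) expR); last exact: continuous_expR.
apply: cvgN; apply: cvgM; first exact: cvg_cst.
by apply: continuous_max; [exact: cvg_cst|exact: cvg_id].
Qed.

Lemma ex_bmf l : 0 <= l -> bmf (ex l).
Proof.
move=> l0; split; first by apply: continuous_measurable_fun; exact: ex_continuous.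
by exists 1 => t; rewrite ger0_norm ?ex_ge0// ex_le1.
Qed.

Lemma IintE l g s : Iint l g s = (\int[mu]_(t in `[0%R, s]) (ex l t * g t))%R.
Proof.
apply: eq_Rintegral => t; rewrite inE /= in_itv /= => /andP[t0 _].
by rewrite exE.
Qed.

Lemma FinfE l g : Finf l g = (\int[mu]_(t in `[0%R, +oo[) (ex l t * g t))%R.
Proof.
apply: eq_Rintegral => t; rewrite inE /= in_itv /= andbT => t0.
by rewrite exE.
Qed.

Lemma Iint_le0 l g s : s <= 0 -> Iint l g s = 0.
Proof.
rewrite le_eqVlt => /predU1P[->|s0]; first by rewrite /Iint set_itv1 Rintegral_set1.
by rewrite /Iint set_itv_ge ?Rintegral_set0// bnd_simp -ltNge.
Qed.

Lemma itv_fin (a b : R) : (mu `[a, b] < +oo)%E.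
Proof. by rewrite lebesgue_measure_itv/=; case: ifP => //; rewrite -EFinB ltry. Qed.

Lemma continuous_bounded_bmf g c : continuous g -> (forall t, `|g t| <= c) -> bmf g.
Proof. by move=> cg gc; split; [exact: continuous_measurable_fun|exists c]. Qed.

Lemma integrable_scale (D : set R) (f : R -> R) a : measurable D ->
  mu.-integrable D (EFin \o f) -> mu.-integrable D (EFin \o (fun t => a * f t)).
Proof.
move=> mD fi; have : mu.-integrable D (fun x => a%:E * (EFin \o f) x)%E.
  by apply: integrableZl.
by [].
Qed.

Section rate.
Variables (l : R) (l0 : 0 < l).

(** Up to the factor l this is the density of the exponential law. *)
Lemma ex_integrable : mu.-integrable `[0, +oo[%classic (EFin \o ex l).
Proof.
have : mu.-integrable `[0, +oo[ (EFin \o exponential_pdf l).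
  by apply: (@integrableS _ _ _ mu setT) => //; exact: integrable_exponential_pdf.
move=> h.
have : mu.-integrable `[0, +oo[ (fun x => (l^-1)%:E * (EFin \o exponential_pdf l) x)%E.
  by apply: integrableZl.
apply: eq_integrable => // t; rewrite inE /= in_itv/= andbT => t0.
rewrite exponential_pdfE// exE// -EFinM mulKf ?gt_eqF//.
by rewrite mulNr.
Qed.

Lemma ex_integral : (\int[mu]_(t in `[0%R, +oo[) ex l t)%R = l^-1.
Proof.
have := integral_exponential_pdf l0.
have -> : (\int[mu]_x (exponential_pdf l x)%:E =
    \int[mu]_(x in `[0%R, +oo[) (l * expR (- l * x))%:E)%E.
  rewrite [RHS]integral_mkcond; apply: eq_integral => x _.
  by rewrite /exponential_pdf !patchE; case: ifP.
move=> h.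
have : (\int[mu]_(t in `[0%R, +oo[) (l * ex l t))%R = 1.
  rewrite /Rintegral -[RHS]/(fine 1%E) -h; congr fine.
  apply: eq_integral => t; rewrite inE /= in_itv/= andbT => t0.
  by rewrite exE// mulNr.
rewrite RintegralZl//; last exact: ex_integrable.
by move=> e; apply: (@mulfI _ l); rewrite ?gt_eqF// e mulfV ?gt_eqF.
Qed.

Lemma exg_integrable g c : measurable_fun setT g -> (forall t, `|g t| <= c) ->
  mu.-integrable `[0, +oo[%classic (EFin \o (fun t => ex l t * g t)).
Proof.
move=> mg gc.
have : mu.-integrable `[0, +oo[ (fun x => c%:E * (EFin \o ex l) x)%E.
  by apply: integrableZl => //; exact: ex_integrable.
apply: le_integrable => //.
  apply/measurable_EFinP; apply: measurable_funTS.
  by apply: measurable_funM => //; have [] := ex_bmf (ltW l0).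
move=> t _; rewrite -EFinM /= lee_fin !normrM mulrC.
rewrite (ger0_norm (ex_ge0 _ _)) ler_wpM2r ?ex_ge0//.
by rewrite (le_trans (gc t))// ler_norm.
Qed.

Lemma Finf_le g c : measurable_fun setT g -> (forall t, `|g t| <= c) -> `|Finf l g| <= c / l.
Proof.
move=> mg gc; have ig := exg_integrable mg gc.
rewrite FinfE (le_trans (le_normr_Rintegral _ ig))//.
apply: (@le_trans _ _ (\int[mu]_(t in `[0%R, +oo[) (c * ex l t))%R).
  apply: le_Rintegral => //.
  - exact: (integrable_norm ig).
  - by apply: integrable_scale => //; exact: ex_integrable.
  - move=> t _; rewrite normrM (ger0_norm (ex_ge0 _ _)) mulrC.
    by rewrite ler_wpM2r// ex_ge0.
by rewrite RintegralZl ?ex_integral//; exact: ex_integrable.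
Qed.

Lemma FinfD a g1 g2 c : measurable_fun setT g1 -> measurable_fun setT g2 ->
  (forall t, `|g1 t| <= c) -> (forall t, `|g2 t| <= c) ->
  Finf l (fun t => a * g1 t + g2 t) = a * Finf l g1 + Finf l g2.
Proof.
move=> m1 m2 c1 c2; have i1 := exg_integrable m1 c1; have i2 := exg_integrable m2 c2.
rewrite !FinfE -RintegralZl// -RintegralD//; last exact: integrable_scale.
by apply: eq_Rintegral => t _; rewrite mulrDr mulrCA.
Qed.

Lemma cvg_Finf (g_ : nat -> R -> R) g c : (forall n, measurable_fun setT (g_ n)) ->
  (forall n t, `|g_ n t| <= c) ->
  (forall t, 0 <= t -> g_ n t @[n --> \oo] --> g t) ->
  Finf l (g_ n) @[n --> \oo] --> Finf l g.
Proof.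
move=> mg gc gg; rewrite FinfE; under eq_fun do rewrite FinfE.
pose D : set R := `[0, +oo[%classic.
have m_ n : measurable_fun D (EFin \o (fun t => ex l t * g_ n t)).
  by apply: (measurable_int mu); exact: exg_integrable.
have cc t : D t -> (ex l t * g_ n t)%:E @[n --> \oo] --> (ex l t * g t)%:E.
  rewrite /D /= in_itv/= andbT => t0; apply: cvg_EFin; first exact: nearW.
  by apply: cvgM; [exact: cvg_cst|exact: gg].
have [] := @dominated_convergence _ (measurableTypeR R) _ mu D (measurable_itv _)
   (fun n => EFin \o (fun t => ex l t * g_ n t)) (EFin \o (fun t => ex l t * g t))
   (fun t => c%:E * (ex l t)%:E)%E m_.
- exact: (emeasurable_fun_cvg _ _ m_ cc).
- by apply: aeW => t; exact: cc.
- have h : mu.-integrable D (EFin \o ex l) by rewrite /D; exact: ex_integrable.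
  by move: (@integrable_scale D (ex l) c (measurable_itv _) h).
- apply: aeW => t n _ /=; rewrite -EFinM lee_fin normrM mulrC.
  by rewrite (ger0_norm (ex_ge0 _ _)) ler_wpM2r// ex_ge0.
by move=> fi _ ci; apply: fine_cvg; rewrite fineK//; exact: integrable_fin_num.
Qed.

Lemma cvg_Iint_Finf g c (u : nat -> R) : measurable_fun setT g -> (forall t, `|g t| <= c) ->
  (forall n, n%:R <= u n) -> Iint l g (u n) @[n --> \oo] --> Finf l g.
Proof.
move=> mg gc nu.
have e n : Iint l g (u n) = Finf l (g \_ `[0, u n]).
  rewrite IintE FinfE [RHS](_ : _ = (\int[mu]_(t in `[0%R, +oo[) (((fun t => ex l t * g t) \_ `[0%R, u n]) t))%R).
    rewrite -Rintegral_mkcondr; congr (Rintegral _ _ _).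
    apply/seteqP; split => t /=; rewrite !in_itv/= ?andbT; last by move=> [].
    by move=> /andP[-> ->].
  apply: eq_Rintegral => t _; rewrite !patchE; case: ifP => //.
  by rewrite mulr0.
under eq_fun do rewrite e.
apply: (@cvg_Finf _ _ c).
- move=> n; apply/(measurable_restrictT g) => //.
  exact: measurable_funTS.
- move=> n t; rewrite patchE; case: ifP => // _.
  by rewrite normr0 (le_trans _ (gc t)).
- move=> t t0; apply: cvg_near_cst; near=> n.
  rewrite patchE ifT// inE /= in_itv /= t0/= (le_trans _ (nu n))//.
  near: n; exact: nbhs_infty_ger.
Unshelve. all: by end_near. Qed.

Lemma Iint_shift g s t : continuous g -> 0 <= s -> 0 <= t ->
  Iint l g (s + t) = Iint l g s + expR (- (l * s)) * Iint l (fun r => g (s + r)) t.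
Proof.
move=> cg s0 t0.
have cint (h : R -> R) a b : continuous h -> mu.-integrable `[a, b]%classic (EFin \o h).
  by move=> ch; apply: continuous_compact_integrable; [exact: segment_compact|exact: continuous_subspaceT].
have cexp : continuous (fun t => expR (- (l * t))).
  move=> r; apply: (@continuous_comp _ _ _ (fun t => - (l * t)) expR); last exact: continuous_expR.
  by apply: cvgN; apply: cvgM; [exact: cvg_cst|exact: cvg_id].
have cG : continuous (fun t => expR (- (l * t)) * g t).
  by move=> r; apply: cvgM; [exact: cexp|exact: cg].
suff e : Iint l g (s + t) - Iint l g s = expR (- (l * s)) * Iint l (fun r => g (s + r)) t.
  by rewrite -e [RHS]addrC subrK.
rewrite /Iint Rintegral_itvB; last 3 first.
- exact: cint.
- by rewrite bnd_simp.
- by rewrite bnd_simp lerDl.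
rewrite Rintegral_itv_obnd_cbnd; last first.
  apply: (integrableS _ _ _ (cint _ s (s + t) cG)) => //.
  exact: subset_itv_oc_cc.
rewrite -RintegralZl//; last first.
  apply: cint => r; apply: cvgM; first exact: cexp.
  apply: continuous_comp; last exact: cg.
  by apply: cvgD; [exact: cvg_cst|exact: cvg_id].
have := @integration_by_substitution_increasing R (fun r => s + r)
  (fun t => expR (- (l * t)) * g t) 0 t t0.
have dF r : derivable (fun r : R => s + r) r 1 by [].
have dE : derive1 (fun r : R => s + r) = cst 1.
  apply/funext => r; rewrite derive1E deriveD// derive_cst derive_id.
  by rewrite add0r.
rewrite dE addr0 /Rintegral => ->.
- congr fine; apply: eq_integral => r _; congr (_%:E) => /=.
  by rewrite mulr1 [RHS]mulrA -expRD -opprD -mulrDr.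
- by move=> x y _ _; rewrite ltrD2l.
- by move=> r _; exact: cvg_cst.
- exact: is_cvg_cst.
- exact: is_cvg_cst.
- split => //.
  + apply: cvg_at_right_filter; apply: cvgD; [exact: cvg_cst|exact: cvg_id].
  + apply: cvg_at_left_filter; apply: cvgD; [exact: cvg_cst|exact: cvg_id].
- exact: continuous_subspaceT.
Qed.

Lemma shift_continuous g s : continuous g -> continuous (fun r => g (s + r)).
Proof.
move=> cg r; apply: continuous_comp; last exact: cg.
by apply: cvgD; [exact: cvg_cst|exact: cvg_id].
Qed.

Lemma Finf_split g c s : continuous g -> (forall t, `|g t| <= c) -> 0 <= s ->
  Finf l g = Iint l g s + expR (- (l * s)) * Finf l (fun r => g (s + r)).
Proof.
move=> cg gc s0; have mg := continuous_measurable_fun cg.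
have msg := continuous_measurable_fun (shift_continuous (s := s) cg).
have h1 : Iint l g (s + n%:R) @[n --> \oo] --> Finf l g.
  by apply: (cvg_Iint_Finf mg gc) => n; rewrite lerDr.
have h2 : Iint l g (s + n%:R) @[n --> \oo] -->
    Iint l g s + expR (- (l * s)) * Finf l (fun r => g (s + r)).
  under eq_fun do rewrite Iint_shift//.
  apply: cvgD; first exact: cvg_cst.
  apply: cvgM; first exact: cvg_cst.
  by apply: (cvg_Iint_Finf msg (c := c)) => // n.
exact: (cvg_unique _ h1 h2).
Qed.

Lemma Iint_le g c s : continuous g -> (forall t, `|g t| <= c) -> `|Iint l g s| <= 2 * (c / l).
Proof.
move=> cg gc; have cl0 : 0 <= c / l.
  by rewrite divr_ge0 ?(ltW l0)// (le_trans (normr_ge0 _) (gc 0)).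
have [s0|/ltW s0] := leP 0 s; last by rewrite Iint_le0// normr0 mulr_ge0.
(* Writing the integral as full integral minus discounted tail costs the factor 2 but reuses the
   bound on [Finf]. *)
have -> : Iint l g s = Finf l g - expR (- (l * s)) * Finf l (fun r => g (s + r)).
  by rewrite (Finf_split cg gc s0) addrK.
rewrite mulr_natl mulr2n (le_trans (ler_normB _ _))// lerD//.
  by apply: Finf_le => //; exact: continuous_measurable_fun.
rewrite normrM ger0_norm ?expR_ge0// -[leRHS]mul1r ler_pM ?expR_ge0//.
  by rewrite expR_le1 oppr_le0 mulr_ge0// ltW.
by apply: Finf_le => //; apply: continuous_measurable_fun; exact: shift_continuous.
Qed.

Lemma Iint_bound g c s : continuous g -> (forall t, `|g t| <= c) -> 0 <= s -> `|Iint l g s| <= c * s.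
Proof.
move=> cg gc s0; have bg : bmf (fun t => ex l t * g t).
  by apply: bmfM; [exact/ex_bmf/ltW|exact: continuous_bounded_bmf gc].
have bi h : bmf h -> mu.-integrable `[0, s] (EFin \o h).
  by move=> bh; apply: bmf_integrable => //; exact: itv_fin.
rewrite IintE; have ig := bi _ bg.
rewrite (le_trans (le_normr_Rintegral _ ig))//.
apply: (@le_trans _ _ (\int[mu]_(t in `[0%R, s]) c)%R).
  apply: le_Rintegral => //.
  - exact: (integrable_norm ig).
  - by apply: bi; exact: bmf_cst.
  - move=> t _; rewrite normrM (ger0_norm (ex_ge0 _ _)) -[leRHS]mul1r.
    by rewrite ler_pM ?ex_ge0// ex_le1// ltW.
have e : mu `[0, s] = s%:E.
  rewrite lebesgue_measure_itv/= lte_fin; case: ltP => [_|s0']; first by rewrite oppr0 adde0.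
  by congr EFin; apply/eqP; rewrite eq_le s0 s0'.
by rewrite Rintegral_cst// [X in fine X]e.
Qed.

Lemma Iint_lip g c s t : continuous g -> (forall t, `|g t| <= c) ->
  `|Iint l g t - Iint l g s| <= c * `|t - s|.
Proof.
move=> cg gc.
have c0 : 0 <= c by exact: le_trans (normr_ge0 _) (gc 0).
wlog st : s t / s <= t => [h|].
  by have [/h//|/ltW/h] := leP s t; rewrite distrC (distrC s).
rewrite (@ger0_norm _ (t - s)) ?subr_ge0//.
have [s0|/ltW s0] := leP 0 s.
  have -> : Iint l g t = Iint l g (s + (t - s)) by rewrite addrC subrK.
  rewrite Iint_shift ?subr_ge0// addrC addKr normrM ger0_norm ?expR_ge0//.
  rewrite -[leRHS]mul1r ler_pM ?expR_ge0//.
    by rewrite expR_le1 oppr_le0 mulr_ge0// ltW.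
  by apply: Iint_bound => //; [exact: shift_continuous|rewrite subr_ge0].
rewrite (Iint_le0 l g s0) subr0.
have [t0|/ltW t0] := leP 0 t.
  by rewrite (le_trans (Iint_bound cg gc t0))// ler_wpM2l// lerDl oppr_ge0.
by rewrite Iint_le0// normr0 mulr_ge0// subr_ge0.
Qed.

Lemma Iint_continuous g c : continuous g -> (forall t, `|g t| <= c) -> continuous (Iint l g).
Proof.
move=> cg gc s; have c0 : 0 <= c by exact: le_trans (normr_ge0 _) (gc 0).
apply/cvgrPdist_le => e e0.
have ec : 0 < e / (c + 1) by rewrite divr_gt0// ltr_wpDl.
have : s @[s --> s] --> s by exact: cvg_id.
move=> /cvgrPdist_le/(_ _ ec); apply: filterS => t /= h.
rewrite (le_trans (Iint_lip _ _ cg gc))//.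
apply: (@le_trans _ _ ((c + 1) * `|s - t|)); first by rewrite ler_wpM2r// lerDl.
by rewrite mulrC -ler_pdivlMr ?ltr_wpDl.
Qed.

End rate.
End discounting.

Section laplace.
Context (R : realType).
Notation mu := (@lebesgue_measure R).

Lemma exD (a b t : R) : ex (a + b) t = ex a t * ex b t.
Proof. by rewrite /ex -expRD mulrDl opprD. Qed.

Lemma Finf_exM (a b : R) (u : R -> R) : Finf (a + b) u = Finf a (fun t => ex b t * u t).
Proof. by rewrite !FinfE; apply: eq_Rintegral => t _; rewrite exD mulrA. Qed.

Lemma cvg_seq_of (A : set R) (x : R) : closure A x ->
  exists a : nat -> R, (forall n, A (a n)) /\ a n @[n --> \oo] --> x.
Proof.
move=> cA; have h n : exists y, A y /\ `|y - x| < n.+1%:R^-1.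
  have [|y [Ay yx]] := cA (ball x n.+1%:R^-1).
    by apply: nbhsx_ballx; rewrite invr_gt0.
  by exists y; split => //; rewrite distrC.
have [a ha] := choice h; exists a; split => [n|]; first by case: (ha n).
apply/cvgrPdist_le => e e0; have := near_infty_natSinv_lt (PosNum e0).
apply: filterS => n /= ne; rewrite distrC; apply: le_trans (ltW ne).
by apply: ltW; case: (ha n).
Qed.

Variable Lambda : set R.
Hypotheses (L0 : Lambda `<=` `]0, +oo[) (Ld : `]0, +oo[ `<=` closure Lambda).

(** Rates a_n > k/2 in Lambda approach k. Keeping exp(-k t / 2) as a fixed integrable weight leaves
    exp(-(a_n - k/2) t) <= 1, so dominated convergence applies. *)
Lemma Finf_dense (u : R -> R) c : measurable_fun setT u -> (forall t, `|u t| <= c) ->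
  (forall l, Lambda l -> Finf l u = 0) -> forall k, 0 < k -> Finf k u = 0.
Proof.
move=> mu_ uc h k k0.
have [a [La ak]] : exists a : nat -> R, (forall n, (Lambda `&` [set x | k / 2 < x]) (a n)) /\
    a n @[n --> \oo] --> k.
  apply: cvg_seq_of => B /= kB.
  have cl : closure Lambda k by apply: Ld; rewrite /= in_itv/= k0.
  have [|y [Ly [yk By]]] := cl ([set x | k / 2 < x] `&` B).
  - by apply: filterI => //; apply: lt_nbhsr; rewrite ltr_pdivrMr// ltr_pMr// ltr1n.
  - by exists y.
have k20 : 0 < k / 2 by rewrite divr_gt0.
have -> : Finf k u = Finf (k / 2) (fun t => ex (k / 2) t * u t).
  by rewrite -Finf_exM -splitr.
have : Finf (k / 2) (fun t => ex (a n - k / 2) t * u t) @[n --> \oo] -->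
    Finf (k / 2) (fun t => ex (k / 2) t * u t).
  apply: (cvg_Finf k20 (c := c)).
  - move=> n; apply: measurable_funM => //.
    by have [|] := @ex_bmf R (a n - k / 2) _; rewrite // subr_ge0 ltW; [|case: (La n)].
  - move=> n t; rewrite normrM -[leRHS]mul1r ler_pM// ger0_norm ?ex_ge0//.
    by rewrite ex_le1// subr_ge0 ltW//; case: (La n).
  - move=> t t0; apply: cvgM; last exact: cvg_cst.
    rewrite /ex; apply: (continuous_cvg _ (@continuous_expR R _)).
    apply: cvgN; apply: cvgM; last exact: cvg_cst.
    rewrite [X in _ --> X](_ : _ = k - k / 2); last by rewrite {2}(splitr k) addrK.
    by apply: cvgB => //; exact: cvg_cst.
have -> : (fun n => Finf (k / 2) (fun t => ex (a n - k / 2) t * u t)) = fun=> 0.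
  apply/funext => n; rewrite -Finf_exM addrC subrK h//.
  by case: (La n).
by move=> /(cvg_unique _ (cvg_cst _)) <-.
Qed.

(** The functions exp(-k t), k >= 1, are closed under products, so by [mclass_cylinder] the integral
    of exp(-t) u(t) over each set exp(-t) < a vanishes. Hence so does it over each [0, b], and u
    vanishes by continuity. *)
Lemma Laplace_unique (u : R -> R) c : continuous u -> (forall t, `|u t| <= c) ->
  (forall l, Lambda l -> Finf l u = 0) -> forall t, 0 <= t -> u t = 0.
Proof.
move=> cu uc h; have mu_ := continuous_measurable_fun cu.
have hk := Finf_dense mu_ uc h.
have c0 : 0 <= c by exact: le_trans (normr_ge0 _) (uc 0).
pose H : set (R -> R) := [set g | bmf g /\ Finf 1 (fun t => g t * u t) = 0].
have gu (g : R -> R) C : bmf g -> (forall t, `|g t| <= C) ->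
    measurable_fun setT (fun t => g t * u t) /\ forall t, `|g t * u t| <= C * c.
  move=> [mg _] gC; split; first exact: measurable_funM.
  by move=> t; rewrite normrM ler_pM.
have HH : bounded_class H.
  split.
  - split; first exact: bmf_cst.
    by under eq_fun do rewrite mul1r; exact: hk.
  - move=> a f g [bf Hf] [bg Hg]; split; first exact/bmfD/bg/bmfZ.
    have [mf [Cf fC]] := bf; have [mg [Cg gC]] := bg.
    have [m1 b1] := gu f Cf bf fC; have [m2 b2] := gu g Cg bg gC.
    have := FinfD ltr01 a m1 m2 (c := Num.max (Cf * c) (Cg * c)).
    rewrite Hf Hg mulr0 addr0 => <-.
    + by congr Finf; apply/funext => t; rewrite mulrDl mulrA.
    + by move=> t; rewrite le_max b1.
    + by move=> t; rewrite le_max b2 orbT.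
  - move=> f_ f M Hf fM ff; split.
      by apply: (bmf_lim _ fM ff) => n; have [[]] := Hf n.
    have : Finf 1 (fun t => f_ n t * u t) @[n --> \oo] --> Finf 1 (fun t => f t * u t).
      apply: (cvg_Finf ltr01 (c := M * c)).
      + by move=> n; have [bf _] := Hf n; have [] := gu _ _ bf (fM n).
      + by move=> n; have [bf _] := Hf n; have [_] := gu _ _ bf (fM n).
      + by move=> t _; apply: cvgM; [exact: ff|exact: cvg_cst].
    have -> : (fun n => Finf 1 (fun t => f_ n t * u t)) = fun=> 0.
      by apply/funext => n; have [_ ->] := Hf n.
    by move=> /(cvg_unique _ (cvg_cst _)) <-.
pose M : set (R -> R) := [set f | exists2 k : nat, (0 < k)%N & f = ex k%:R].
have HM a : H (fun t => ((ex 1 t < a)%R%:R : R)).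
  have := @mclass_cylinder _ R R H M HH.
  move=> /(_ _ _ _ [:: (ex 1, a)]) cyl.
  apply: (bclass_ext (cyl _ _ _ _)).
  - move=> f g [k k0 ->] [k' k'0 ->]; exists (k + k')%N; first by rewrite addn_gt0 k0.
    by apply/funext => t; rewrite natrD exD.
  - move=> f [k k0 ->]; exists 1; split => // x x1 t _ /=.
    by rewrite ger0_norm ?ex_ge0// (le_trans (ex_le1 _ _))// ltW.
  - move=> f [k k0 ->]; split; first by apply: ex_bmf; rewrite ler0n.
    by rewrite -Finf_exM; apply: hk; rewrite ltr_wpDr.
  - by move=> p; rewrite inE => /eqP ->; exists 1%N.
  - by move=> t; rewrite big_seq1.
have I0 b : 0 <= b -> Iint 1 u b = 0.
  move=> b0.
  have [bg hg] := HM (ex 1 b).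
  have [mf [C fC]] := bg; have [m2 b2] := gu _ C bg fC.
  have := FinfD ltr01 (-1) m2 mu_ (c := Num.max (C * c) c).
  rewrite hg hk// mulr0 addr0 => <-; last 2 first.
    by move=> t; rewrite le_max b2.
    by move=> t; rewrite le_max uc orbT.
  rewrite IintE FinfE [LHS](_ : _ = (\int[mu]_(t in `[0%R, +oo[) (((fun t => ex 1 t * u t) \_ `[0%R, b]) t))%R); last first.
    rewrite -Rintegral_mkcondr; congr (Rintegral _ _ _).
    apply/seteqP; split => t /=; rewrite !in_itv/= ?andbT; last by move=> [].
    by move=> /andP[-> ->].
  apply: eq_Rintegral => t; rewrite inE /= in_itv/= andbT => t0; rewrite patchE.
  have -> : (ex 1 t < ex 1 b) = (b < t).
    by rewrite !exE// ltr_expR !mul1r ltrN2.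
  case: ifPn; rewrite ?inE ?notin_setE /= in_itv/= t0/= => /idP; rewrite leNgt.
    by case: ltP => // _ _; rewrite mul0r mulr0 add0r.
  by case: ltP => // _ _; rewrite mulN1r mul1r addNr mulr0.
(* One-sided, for use with u and -u: if v(t) > 0, then v > v(t) / 2 on a short interval after t,
   over which the discounted integral would be positive. *)
have key (v : R -> R) : continuous v -> (forall t, `|v t| <= c) ->
    (forall b, 0 <= b -> Iint 1 v b = 0) -> forall t, 0 <= t -> v t <= 0.
  move=> cv vc Iv t t0; rewrite leNgt; apply/negP => vt.
  have vt2 : 0 < v t / 2 by rewrite divr_gt0.
  have := cv t => /cvgrPdist_lt/(_ _ vt2)/nbhs_ballP[dl dl0 hdl].
  pose h0 := dl / 2; have hh : 0 < h0 by rewrite divr_gt0.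
  have := Iint_shift 1 cv t0 (ltW hh).
  rewrite !Iv ?addr_ge0 ?(ltW hh)// add0r => /esym/eqP.
  rewrite mulf_eq0 gt_eqF ?expR_gt0//= => /eqP.
  rewrite IintE => e0.
  have bi g : bmf g -> mu.-integrable `[0, h0] (EFin \o g).
    by move=> bg; apply: bmf_integrable => //; exact: itv_fin.
  have : (\int[mu]_(r in `[0%R, h0]) (ex 1 h0 * (v t / 2)) <=
          \int[mu]_(r in `[0%R, h0]) (ex 1 r * v (t + r)))%R.
    apply: le_Rintegral => //.
    - by apply: bi; exact: bmf_cst.
    - apply: bi; apply: bmfM; first exact: ex_bmf.
      apply: continuous_bounded_bmf; first exact: (shift_continuous cv).
      by move=> r; exact: vc.
    - move=> r; rewrite /= in_itv/= => /andP[r0 rh].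
      apply: ler_pM; rewrite ?ex_ge0//; first exact: ltW.
        by rewrite !exE// ?ler_expR ?lerN2 ?mul1r// ltW.
      have /hdl /= : ball t dl (t + r).
        by rewrite /ball /= opprD addrA subrr sub0r normrN ger0_norm// (le_lt_trans rh)// /h0 ltr_pdivrMr// ltr_pMr// ltr1n.
      by rewrite ltr_norml => /andP[_]; lra.
  rewrite e0 Rintegral_cst// leNgt => /negP; apply.
  have e : mu `[0, h0] = h0%:E.
    by rewrite lebesgue_measure_itv/= lte_fin hh oppr0 adde0.
  by rewrite [X in fine X]e /= !mulr_gt0// expR_gt0.
move=> t t0; apply/eqP; rewrite eq_le key//=.
rewrite -oppr_le0; apply: (key (fun t => - u t)) => //.
- by move=> s; apply: cvgN; exact: cu.
- by move=> s; rewrite normrN.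
- move=> b b0; have := I0 b b0; rewrite !IintE => h0.
  transitivity (-1 * (\int[mu]_(t in `[0%R, b]) (ex 1 t * u t))%R); last by rewrite h0 mulr0.
  rewrite -RintegralZl//; first by apply: eq_Rintegral => r _; rewrite mulN1r mulrN.
  apply: bmf_integrable => //; first exact: itv_fin.
  by apply: bmfM; [exact: ex_bmf|exact: continuous_bounded_bmf uc].
Qed.

End laplace.

Section separating.
Context (R : realType) (X : ptopologicalType) (Phi : set (X -> R)).
Hypothesis hPhi : separating_family Phi.

Let G : set (set X) := [set A | exists l : seq ((X -> R) * R),
  (forall p, p \in map fst l -> Phi p) /\ A = [set x | all (fun p => p.1 x < p.2) l]].

Let GI : setI_closed G.
Proof.
move=> _ _ [l [hl ->]] [m [hm ->]]; exists (l ++ m); split.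
  by move=> p; rewrite map_cat mem_cat => /orP[/hl|/hm].
by apply/seteqP; split => x /=; rewrite all_cat => /andP.
Qed.

Lemma separating_base (x : X) (A : set X) : nbhs x A ->
  exists (k : nat) (g : 'I_k.+1 -> X -> R) (dl : R), [/\ 0 < dl, forall l, Phi (g l) &
    forall y, (forall l, `|g l y - g l x| < dl) -> A y].
Proof.
case: hPhi => _ _ _ ss /ss[k [g [Pg h]]].
have [dl dl0 hdl] : exists2 dl : R, 0 < dl & (dl%:E <= ereal_inf
   [set (\big[Num.max/0%R]_(l < k.+1) `|g l y - g l x|)%:E | y in ~` A])%E.
  case: (ereal_inf _) h => [r|_|//].
    by rewrite lte_fin => r0; exists r.
  by exists 1 => //; rewrite leey.
exists k, g, dl; split => // y yl; apply: contrapT => yA.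
have := le_trans hdl (ereal_inf_lbound (ex_intro2 _ _ y yA erefl)).
rewrite lee_fin leNgt => /negP; apply.
by apply/bigmax_ltP; split => // l _; exact: yl.
Qed.

(** Strong separation together with countability makes Phi generate the Borel sets of X; closure
    under products then brings the indicators of finite systems of inequalities into H. *)
Lemma Phi_class (H : set (borel X -> R)) : bounded_class H -> Phi `<=` H ->
  forall f, bmf f -> H f.
Proof.
move=> HH PH; have [cPhi cbPhi mPhi _] := hPhi.
apply: (bclass_bmf HH (G := G)) => //.
- rewrite eqEsubset; split; last first.
    apply: smallest_sub; first exact: sigma_algebra_measurable.
    move=> _ [l [hl ->]]; apply: open_borel.
    elim: l hl => [|[f a] l IH] hl.
      by rewrite (_ : [set x | _] = setT); [exact: openT|apply/seteqP; split].
    rewrite (_ : [set x | _] = f @^-1` [set r | r < a] `&` [set x | all (fun p => p.1 x < p.2) l]).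
      apply: openI; last by apply: IH => p pl; apply: hl; rewrite inE pl orbT.
      have [cf _] : continuous f /\ bounded_fun f by apply/cbPhi/hl; rewrite inE eqxx.
      by move/continuousP : cf; apply; exact: open_lt.
    by apply/seteqP; split => x /=; [move=> /andP[]|move=> [-> ->]].
  apply: smallest_sub; first exact: smallest_sigma_algebra.
  pose W := g_sigma_algebraType G.
  have WE : @measurable _ W = <<s G >> by [].
  have mphi f : Phi f -> measurable_fun setT (f : W -> R).
    move=> Pf; apply: (measurability _ (RGenInftyO.measurableE R)).
    move=> _ [_ [a ->] <-]; rewrite setTI; apply: sub_sigma_algebra.
    exists [:: (f, a)]; split; first by move=> p; rewrite inE => /eqP ->.
    by apply/seteqP; split => x /=; rewrite in_itv/= andbT.
  have /pfcard_geP[P0|[e]] := cPhi.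
    move=> A _; have [k [g [dl [_ Pg _]]]] := @separating_base point setT filterT.
    by have := Pg ord0; rewrite P0.
  (* Finite systems of rational bounds on members of Phi: by strong separation these countably many
     sets form a base of the topology. *)
  pose S (c : seq (nat * rat * rat)) : set W :=
    [set x | all (fun p => ratr p.1.2 < e p.1.1 x < ratr p.2) c].
  have mS c : measurable (S c).
    elim: c => [|p c IH].
      by rewrite (_ : S [::] = setT)//; apply/seteqP; split.
    rewrite (_ : S _ = e p.1.1 @^-1` `]ratr p.1.2, ratr p.2[%classic `&` S c).
      apply: measurableI => //.
      have := mphi _ (@funS _ _ _ _ e p.1.1 I) measurableT _ (measurable_itv `]ratr p.1.2, ratr p.2[).
      by rewrite setTI.
    by apply/seteqP; split => x /=; rewrite in_itv/=; [move=> /andP[]|move=> [h1 h2]; apply/andP].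
  move=> A oA; rewrite -WE.
  pose B (o : option (seq (nat * rat * rat))) : set W :=
    if o is Some c then (if `[< S c `<=` A >] then S c else set0) else set0.
  have mB o : measurable (B o).
    by case: o => [l|]//=; case: ifP.
  rewrite (_ : A = \bigcup_n B (unpickle n)); first exact: bigcup_measurable.
  apply/seteqP; split => x; last first.
    by move=> [n _]; case: (unpickle n) => [l|]//=; case: asboolP => // lA /lA.
  move=> Ax; have [k [g [dl [dl0 Pg hA]]]] := separating_base (open_nbhs_nbhs (conj oA Ax)).
  have hq (l : 'I_k.+1) : exists p : nat * rat * rat, [/\ e p.1.1 = g l,
      g l x - dl < ratr p.1.2 < g l x & g l x < ratr p.2 < g l x + dl].
    have [i _ ei] := @surj _ _ _ _ e (g l) (Pg l).
    have [q1 q1P] : exists q : rat, ratr q \in `]g l x - dl, g l x[.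
      by apply: rat_in_itvoo; rewrite gtrBl.
    have [q2 q2P] : exists q : rat, ratr q \in `]g l x, g l x + dl[.
      by apply: rat_in_itvoo; rewrite ltrDl.
    by exists (i, q1, q2).
  have [p hp] := choice hq.
  pose c := [seq p l | l <- enum 'I_k.+1].
  exists (pickle c) => //; rewrite pickleK /=.
  have Sx : S c x.
    apply/allP => _ /mapP[l _ ->]; have [-> /andP[_ ->] /andP[-> _]] := hp l.
    by [].
  case: asboolP => // SA; exfalso; apply: SA => y /allP Sy; apply: hA => l.
  have [ei /andP[a1 _] /andP[_ a2]] := hp l.
  have := Sy (p l) (map_f _ (mem_enum _ _)); rewrite ei => /andP[b1 b2].
  by rewrite ltr_norml; apply/andP; split; [rewrite ltrBrDl; lra|rewrite ltrBlDl; lra].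
- move=> _ [l [hl ->]].
  have := @mclass_cylinder _ (borel X) R H Phi HH mPhi.
  move=> /(_ _ PH l hl) h; apply: (bclass_ext (h _)) => [f /cbPhi[]//|x].
  rewrite indicE; elim: l {hl h} => [|q l IH]; first by rewrite big_nil mem_set.
  rewrite big_cons IH /=; have [qx|qx] := boolP (q.1 x < q.2).
    rewrite mul1r; congr (_%:R); congr nat_of_bool.
    by apply/idP/idP; rewrite !inE /= qx.
  by rewrite mul0r memNset//= (negbTE qx).
Qed.

End separating.

(** * Means of bounded measurable functions *)

Section functionals.
Context d (T : measurableType d) (R : realType).

Definition bounded_linear (L : (T -> R) -> R) :=
  (forall a f g, bmf f -> bmf g -> L (fun x => a * f x + g x) = a * L f + L g) /\
  (forall (f_ : nat -> T -> R) f M, (forall n, bmf (f_ n)) ->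
    (forall n x, `|f_ n x| <= M) -> (forall x, f_ n x @[n --> \oo] --> f x) ->
    L (f_ n) @[n --> \oo] --> L f).

(** The common form of the monotone class arguments below: it serves for laws, mixtures, and
    expectations weighted by a bounded function. *)
Lemma eq_functional_class (L1 L2 : (T -> R) -> R) :
  bounded_linear L1 -> bounded_linear L2 -> L1 (fun=> 1) = L2 (fun=> 1) ->
  bounded_class [set f | bmf f /\ L1 f = L2 f].
Proof.
move=> [l1 c1] [l2 c2] e; split.
- by split; first exact: bmf_cst.
- move=> a f g [bf ef] [bg eg]; split; first by apply: bmfD => //; exact: bmfZ.
  by rewrite l1// l2// ef eg.
- move=> f_ f M hf fM ff; have bf n : bmf (f_ n) by case: (hf n).
  split; first by apply: (bmf_lim _ fM ff) => n; case: (bf n).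
  have := c1 _ _ _ bf fM ff; have := c2 _ _ _ bf fM ff.
  have -> : (fun n => L1 (f_ n)) = (fun n => L2 (f_ n)).
    by apply/funext => n; case: (hf n).
  by move=> h1 h2; exact: (cvg_unique _ h2 h1).
Qed.

Lemma eq_functionals (L1 L2 : (T -> R) -> R) :
  bounded_linear L1 -> bounded_linear L2 ->
  (forall A, measurable A -> L1 (\1_A) = L2 (\1_A)) ->
  forall f, bmf f -> L1 f = L2 f.
Proof.
move=> b1 b2 e f bf.
have e1 : L1 (fun=> 1) = L2 (fun=> 1).
  by have := e setT measurableT; rewrite indicT.
have HH := eq_functional_class b1 b2 e1.
have mE : @measurable _ T = <<s @measurable _ T >>.
  by rewrite sigma_algebra_id//; exact: sigma_algebra_measurable.
have mI : setI_closed (@measurable _ T) by move=> A B; exact: measurableI.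
have mA A : measurable A -> [set f | bmf f /\ L1 f = L2 f] (\1_A).
  by move=> mA; split; [exact: bmf_indic|exact: e].
by have [] := bclass_bmf HH mE mI mA bf.
Qed.

End functionals.

Lemma bounded_linear_comp d1 d2 (T1 : measurableType d1) (T2 : measurableType d2)
    (R : realType) (L : (T1 -> R) -> R) (g : T1 -> T2) :
  measurable_fun setT g -> bounded_linear L ->
  bounded_linear (fun f : T2 -> R => L (fun x => f (g x))).
Proof.
move=> mg [l c]; split.
- by move=> a f h bf bh; rewrite (l a (fun x => f (g x)) (fun x => h (g x)))//; exact: bmf_comp.
- move=> f_ f M bf fM ff; apply: (c (fun n x => f_ n (g x)) _ M) => //.
  by move=> n; exact: bmf_comp.
Qed.

Section means.
Context {R : realType} {X : ptopologicalType} (hX : polish R X).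
Local Notation Omega := (cpath R X).
Local Notation law := (law R X).
Local Notation bOmega := (borel Omega).
Implicit Types (P Q : law).

Lemma law_fin P (D : set bOmega) : measurable D ->
  ((P : probability bOmega R) D < +oo)%E.
Proof. by move=> mD; rewrite (le_lt_trans (probability_le1 _ mD))// ltry. Qed.

Let setT_fin P : ((P : probability bOmega R) setT < +oo)%E.
Proof. exact: law_fin. Qed.

Lemma meanD P (f g : bOmega -> R) : bmf f -> bmf g ->
  mean P (fun w => f w + g w) = mean P f + mean P g.
Proof. by move=> bf bg; apply: bintD => //; exact: setT_fin. Qed.

Lemma meanB P (f g : bOmega -> R) : bmf f -> bmf g ->
  mean P (fun w => f w - g w) = mean P f - mean P g.
Proof. by move=> bf bg; apply: bintB => //; exact: setT_fin. Qed.

Lemma meanZ P c (f : bOmega -> R) : bmf f ->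
  mean P (fun w => c * f w) = c * mean P f.
Proof. by move=> bf; apply: bintZ => //; exact: setT_fin. Qed.

Lemma mean_sum P (I : Type) (s : seq I) (F : I -> bOmega -> R) : (forall i, bmf (F i)) ->
  mean P (fun w => \sum_(i <- s) F i w) = \sum_(i <- s) mean P (F i).
Proof. by move=> bF; apply: bint_sum => //; exact: setT_fin. Qed.

Lemma le_mean P (f g : bOmega -> R) : bmf f -> bmf g -> (forall w, f w <= g w) ->
  mean P f <= mean P g.
Proof. by move=> bf bg fg; apply: le_bint => //; exact: setT_fin. Qed.

Lemma mean_cst P c : mean P (fun=> c) = c.
Proof.
rewrite /mean Rintegral_cst// [X in fine X](_ : _ = 1%E) ?mulr1//.
exact: probability_setT.
Qed.

Lemma mean_indic P A : @measurable _ bOmega A -> (mean P (\1_A))%:E = P A.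
Proof.
move=> mA; rewrite /mean bint_indic// setIT fineK// ge0_fin_numE//.
exact: law_fin.
Qed.

Lemma cvg_mean P (f_ : nat -> bOmega -> R) f M : (forall n, bmf (f_ n)) ->
  (forall n w, `|f_ n w| <= M) -> (forall w, f_ n w @[n --> \oo] --> f w) ->
  mean P (f_ n) @[n --> \oo] --> mean P f.
Proof.
move=> bf fM ff; apply: (bint_cvg _ _ _ fM) => //; first exact: setT_fin.
by move=> n; case: (bf n).
Qed.

Lemma mean_norm_le P (f : bOmega -> R) M : measurable_fun setT f -> (forall w, `|f w| <= M) -> `|mean P f| <= M.
Proof.
move=> mf fM; have bf : bmf f by split => //; exists M.
rewrite ler_norml -[in X in X && _](mean_cst P (- M)) -[in X in _ && X](mean_cst P M).
by apply/andP; split; apply: le_mean => //; (try exact: bmf_cst) => w;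
  have := fM w; rewrite ler_norml => /andP[].
Qed.

Lemma bounded_linear_mean P : bounded_linear (mean P : (bOmega -> R) -> R).
Proof.
split; first by move=> a f g bf bg; rewrite meanD ?meanZ//; exact: bmfZ.
by move=> f_ f M; exact: cvg_mean.
Qed.

Lemma bounded_linear_weight P (h : bOmega -> R) : bmf h ->
  bounded_linear (fun f : bOmega -> R => mean P (fun w => h w * f w)).
Proof.
move=> bh; have [mh [C hC]] := bh; split.
- move=> a f g bf bg; rewrite -meanZ -?meanD; [|exact/bmfZ/bmfM|exact: bmfM|exact: bmfM].
  by congr mean; apply/funext => w; rewrite mulrDr mulrCA.
- move=> f_ f M bf fM ff; apply: (cvg_mean (M := C * M)).
  + by move=> n; exact: bmfM.
  + by move=> n w; rewrite normrM ler_pM.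
  + by move=> w; apply: cvgM; [exact: cvg_cst|exact: ff].
Qed.

Lemma bounded_linear_kernel P (k : bOmega -> law) (h : bOmega -> R) : bmf h ->
  (forall f : bOmega -> R, bmf f -> bmf (fun w => mean (k w) f)) ->
  bounded_linear (fun f : bOmega -> R => mean P (fun w => h w * mean (k w) f)).
Proof.
move=> bh bk; have [mh [C hC]] := bh; split.
- move=> a f g bf bg; rewrite -meanZ -?meanD;
    [|exact/bmfZ/bmfM/bk|exact/bmfM/bk|exact/bmfM/bk].
  congr mean; apply/funext => w.
  by rewrite (bounded_linear_mean (k w)).1// mulrDr mulrCA.
- move=> f_ f M bf fM ff; apply: (cvg_mean (M := C * M)).
  + by move=> n; apply: bmfM => //; exact: bk.
  + move=> n w; rewrite normrM ler_pM//; apply: mean_norm_le => //.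
    by case: (bf n).
  + by move=> w; apply: cvgM; [exact: cvg_cst|exact: (cvg_mean _ fM)].
Qed.

Lemma bmf_Cb f : Cb R X f -> bmf (f : bOmega -> R).
Proof. by move=> [cf bf]; exact: continuous_bmf. Qed.

Lemma same_mean P Q : same_measure P Q -> forall f : bOmega -> R, bmf f -> mean P f = mean Q f.
Proof.
move=> PQ; apply: eq_functionals; [exact: bounded_linear_mean..|].
by move=> A mA; apply: EFin_inj; rewrite !mean_indic// PQ.
Qed.

Lemma law_ext P Q : (forall f, Cb R X f -> mean P f = mean Q f) -> same_measure P Q.
Proof.
move=> PQ A mA; have [D [DC DH]] := Omega_determining hX.
rewrite -!mean_indic//; congr EFin.
have e1 : mean P (fun=> 1) = mean Q (fun=> 1) by rewrite !mean_cst.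
have HH := eq_functional_class (bounded_linear_mean P) (bounded_linear_mean Q) e1.
have HD k : [set f : bOmega -> R | bmf f /\ mean P f = mean Q f] (D k).
  by split; [exact: bmf_Cb|exact: PQ].
by have [] := DH _ HH HD _ (bmf_indic R mA).
Qed.

Lemma mean_push P Q (g : bOmega -> bOmega) : measurable_fun setT g ->
  same_measure Q (fun A => P (g @^-1` A)) ->
  forall f : bOmega -> R, bmf f -> mean Q f = mean P (fun w => f (g w)).
Proof.
move=> mg PQ; apply: eq_functionals; first exact: bounded_linear_mean.
  exact: (bounded_linear_comp mg (bounded_linear_mean P)).
move=> A mA; apply: EFin_inj; rewrite mean_indic// PQ// -mean_indic//.
by rewrite -[X in measurable X]setTI; exact: mg.
Qed.

(** The functions with measurable means form a bounded class, so the countable determining family in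
    C_b is enough. *)
Lemma kernel_bmf d (W : measurableType d) (k : W -> law) :
  (forall f, Cb R X f -> measurable_fun setT (fun x => mean (k x) f)) ->
  forall f : bOmega -> R, bmf f -> bmf (fun x => mean (k x) f).
Proof.
move=> hk f bf.
suff mk : measurable_fun setT (fun x => mean (k x) f).
  split => //; have [mf [M fM]] := bf; exists M => x; exact: mean_norm_le.
have [D [DC DH]] := Omega_determining hX.
suff HH : bounded_class [set f : bOmega -> R | bmf f /\ measurable_fun setT (fun x => mean (k x) f)].
  have HD n : [set f : bOmega -> R | bmf f /\ measurable_fun setT (fun x => mean (k x) f)] (D n).
    by split; [exact: bmf_Cb|exact: hk].
  by have [] := DH _ HH HD f bf.
split.
  + split; first exact: bmf_cst.
    by under eq_fun do rewrite mean_cst; exact: measurable_cst.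
  + move=> a g h [bg mg] [bh mh]; split; first by apply: bmfD => //; exact: bmfZ.
    under eq_fun do rewrite (bounded_linear_mean _).1//.
    by apply: measurable_funD => //; exact: measurable_funM.
  + move=> f_ g M hf fM ff; have bf_ n : bmf (f_ n) by case: (hf n).
    split; first by apply: (bmf_lim _ fM ff) => n; case: (bf_ n).
    apply: (@measurable_fun_cvg _ _ _ _ (fun n x => mean (k x) (f_ n))).
      by move=> n; case: (hf n).
    by move=> x _; exact: (cvg_mean _ fM).
Qed.

End means.

(** * Mixtures of laws along a kernel *)

Section mixture.
Context {R : realType} {X : ptopologicalType}.
Local Notation Omega := (cpath R X).
Local Notation law := (law R X).
Local Notation bOmega := (borel Omega).
Variables (P : probability bOmega R) (k : bOmega -> probability bOmega R).
Variable mk : forall A, measurable A -> measurable_fun setT (fun w => k w A).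

(** The measurability proof is made an argument so that the measure structure, which depends on it,
    is attached to the term. *)
Definition mixture of (forall A, measurable A -> measurable_fun setT (fun w => k w A)) :=
  fun A : set bOmega => (\int[P]_w k w A)%E.

Local Notation mix := (mixture mk).

Let mix0 : mix set0 = 0%E.
Proof. by rewrite /mixture; under eq_integral do rewrite measure0; rewrite integral0. Qed.

Let mix_ge0 A : (0 <= mix A)%E.
Proof. exact: integral_ge0. Qed.

Let mix_sigma : semi_sigma_additive mix.
Proof.
move=> F mF tF mUF; rewrite [X in _ --> X](_ : _ = \sum_(n <oo) mix (F n))%E.
  by apply: is_cvg_ereal_nneg_natsum => n _; exact: mix_ge0.
rewrite /mixture -integral_nneseries//; last by move=> n; exact: mk.
apply: eq_integral => w _.
by apply/esym/cvg_lim => //; exact: measure_semi_sigma_additive.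
Qed.

HB.instance Definition _ := isMeasure.Build _ _ _ mix mix0 mix_ge0 mix_sigma.

Let mix_setT : mix setT = 1%E.
Proof.
transitivity (\int[P]_(w in setT) 1%E)%E.
  by apply: eq_integral => w _; exact: probability_setT.
by rewrite integral_cst// mul1e; exact: probability_setT.
Qed.

HB.instance Definition _ := Measure_isProbability.Build _ _ _ mix mix_setT.

Definition mixture_law : law := (mix : probability bOmega R).

Lemma mixture_lawE A : mixture_law A = (\int[P]_w k w A)%E.
Proof. by []. Qed.

End mixture.

Section mixture_mean.
Context {R : realType} {X : ptopologicalType} (hX : polish R X).
Local Notation Omega := (cpath R X).
Local Notation law := (law R X).
Local Notation bOmega := (borel Omega).

Lemma fine_kernel (k : bOmega -> law) A : @measurable _ bOmega A ->
  (fun w => k w A) = (fun w => (mean (k w) (\1_A))%:E).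
Proof. by move=> mA; apply/funext => w; rewrite mean_indic. Qed.

Lemma mixture_exists (P : law) (k : bOmega -> law) :
  (forall f : bOmega -> R, bmf f -> bmf (fun w => mean (k w) f)) ->
  exists M : law,
    same_measure M (fun A => \int[P : probability bOmega R]_w k w A)%E /\
    forall f : bOmega -> R, bmf f -> mean M f = mean P (fun w => mean (k w) f).
Proof.
move=> bk.
have mk A : @measurable _ bOmega A -> measurable_fun setT (fun w => k w A).
  move=> mA; rewrite fine_kernel//; apply/measurable_EFinP.
  by have [] := bk _ (bmf_indic R mA).
exists (mixture_law P (k := k) mk); split => // f bf.
pose P' : law := P.
have L2 := bounded_linear_kernel P (bmf_cst _ 1) bk.
rewrite (@eq_functionals _ _ _ _ _ (bounded_linear_mean (mixture_law P (k := k) mk)) L2 _ f bf).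
  by congr mean; apply/funext => w; rewrite mul1r.
move=> A mA; apply: EFin_inj; rewrite mean_indic// mixture_lawE.
under [X in mean _ X]eq_fun do rewrite mul1r.
have bA := bk _ (bmf_indic R mA).
rewrite /mean /Rintegral fineK.
  by apply: eq_integral => w _; rewrite -[RHS]/((mean (k w) (\1_A))%:E) mean_indic.
apply: integrable_fin_num => //.
by apply: bmf_integrable => //; exact: law_fin.
Qed.

End mixture_mean.

(** The closed sets are taken in the whole space and no separation is assumed: laws that agree on
    Borel sets may be distinct but topologically indistinguishable, so a compact set of laws need
    not be closed. *)
Lemma compact_nested (T : topologicalType) (K : set T) (E : nat -> set T) :
  compact K -> (forall n, closed (E n)) -> (forall n, E n.+1 `<=` E n) ->
  (forall n, K `&` E n !=set0) -> exists x, K x /\ forall n, E n x.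
Proof.
move=> cK cE dE nE.
have dE' m n : (m <= n)%N -> E n `<=` E m.
  elim: n => [|n IH]; first by rewrite leqn0 => /eqP ->.
  by rewrite leq_eqVlt => /predU1P[-> //|/IH h]; exact: subset_trans (dE n) h.
pose FF : set_system T := [set B | exists n, K `&` E n `<=` B].
have FP : ProperFilter FF.
  apply: Build_ProperFilter_ex.
    by move=> B [n nB]; have [x /nB] := nE n; exists x.
  split.
  - by exists 0%N.
  - move=> A B [n nA] [m mB]; exists (maxn n m) => x [Kx Ex]; split.
      by apply: nA; split => //; apply: dE' Ex; exact: leq_maxl.
    by apply: mB; split => //; apply: dE' Ex; exact: leq_maxr.
  - by move=> A B AB [n nA]; exists n; exact: subset_trans AB.
have [|x [Kx cx]] := cK FF FP; first by exists 0%N; move=> ? [].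
exists x; split => // n; apply: cE => B xB.
have /(_ (E n) B _ xB) := cx; apply.
by exists n => ? [].
Qed.

(** * Successive maximisation *)

Section good_maps.
Context {R : realType} {X : ptopologicalType} (hX : polish R X).
Local Notation Omega := (cpath R X).
Local Notation law := (law R X).
Local Notation bOmega := (borel Omega).
Implicit Types (P Q : law) (f F : Omega -> R).

Lemma CbD f F : Cb R X f -> Cb R X F -> Cb R X (fun w => f w + F w).
Proof.
move=> [cf bf] [cF bF]; split.
  by move=> w; apply: (@cvgD R R^o _ (nbhs w) _ f F); [exact: cf|exact: cF].
have [c c0 hc] := bounded_fun_bound bf; have [e e0 he] := bounded_fun_bound bF.
exists (c + e); split; first exact: num_real.
move=> M Mc w _; apply: ltW; apply: le_lt_trans Mc.
by rewrite (le_trans (ler_normD _ _))// lerD.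
Qed.

Lemma Cb_cst (c : R) : Cb R X (fun=> c).
Proof.
split; first exact: cst_continuous.
exists `|c|; split; first exact: num_real.
by move=> M Mc w _; exact: ltW.
Qed.

Lemma CbM f F : Cb R X f -> Cb R X F -> Cb R X (fun w => f w * F w).
Proof.
move=> [cf bf] [cF bF]; split.
  by move=> w; apply: (@continuousM R Omega f F); [exact: cf|exact: cF].
have [c c0 hc] := bounded_fun_bound bf; have [e e0 he] := bounded_fun_bound bF.
exists (c * e); split; first exact: num_real.
move=> M Mc w _; apply: ltW; apply: le_lt_trans Mc.
by rewrite normrM ler_pM.
Qed.

Lemma CbZ (c : R) f : Cb R X f -> Cb R X (fun w => c * f w).
Proof. by move=> Cf; apply: CbM => //; exact: Cb_cst. Qed.

Lemma CbN f : Cb R X f -> Cb R X (fun w => - f w).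
Proof. by move=> /(CbZ (-1)); under [X in Cb _ _ X -> _]eq_fun do rewrite mulN1r. Qed.

Lemma Cb_sum (I : Type) (s : seq I) (G : I -> Omega -> R) : (forall i, Cb R X (G i)) ->
  Cb R X (fun w => \sum_(i <- s) G i w).
Proof.
move=> CG; elim: s => [|i s IH].
  by under eq_fun do rewrite big_nil; exact: Cb_cst.
by under eq_fun do rewrite big_cons; exact: CbD.
Qed.

Lemma mean_continuous f : Cb R X f -> continuous (fun P : law => mean P f).
Proof.
move=> Cf; pose g : Cb R X := SigSub (mem_set Cf).
have -> : (fun P : law => mean P f) = (fun h : {ptws (Cb R X : Type) -> R} => h g) \o @mean_Cb R X.
  by apply/funext => P.
move=> P; apply: continuous_comp; first exact: initial_continuous.
exact: (@proj_continuous _ (fun=> R) g).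
Qed.

Lemma closed_mean_ge f (c : R) : Cb R X f -> closed [set P : law | c <= mean P f].
Proof.
move=> Cf; have /continuous_closedP := mean_continuous Cf.
by move=> /(_ _ (@closed_ge R c)).
Qed.

Lemma closed_saturated (F : set law) P Q : closed F -> F P -> same_measure P Q -> F Q.
Proof.
move=> cF FP PQ; apply: cF => B [_ [[U oU <-] UQ UB]].
exists P; split => //; apply: UB; move: UQ; rewrite /preimage /=.
congr U; apply/funext => g; apply: same_mean.
  by move=> A mA; rewrite PQ.
by apply: bmf_Cb; exact: set_valP.
Qed.

(** The properties of C that pass to each stage of the maximisation and to the limit. Saturation
    allows a law to be replaced by one with the same Borel values. *)
Record good (D : X -> set law) : Prop := Good {
  good_ne : forall x, D x !=set0 ;
  good_compact : forall x, compact (D x) ;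
  good_saturated : forall x P Q, D x P -> same_measure P Q -> D x Q ;
  good_measurable : forall F : set law, closed F ->
    @measurable _ (borel X) [set x | D x `&` F !=set0] }.

Section upper.
Variable D : X -> set law.
Hypothesis gD : good D.

Let has_sup_upper x f : Cb R X f -> has_sup [set mean P f | P in D x].
Proof.
move=> Cf; have [c c0 hc] := bounded_fun_bound Cf.2.
split; first by have [P DP] := good_ne gD x; exists (mean P f), P.
exists c => _ [P _ <-]; rewrite (le_trans (ler_norm _))//.
by apply: mean_norm_le => //; have [] := bmf_Cb Cf.
Qed.

Lemma upper_ge x f P : Cb R X f -> D x P -> mean P f <= upper D x f.
Proof. by move=> Cf DP; apply: (ub_le_sup (has_sup_upper x Cf).2); exists P. Qed.

Lemma upper_attained x f : Cb R X f -> exists2 P, D x P & mean P f = upper D x f.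
Proof.
move=> Cf; have := @compact_nested law (D x)
  (fun n => [set P | upper D x f - n.+1%:R^-1 <= mean P f]) (@good_compact D gD x).
case.
- by move=> n; exact: closed_mean_ge.
- move=> n P /=; apply: le_trans; rewrite lerD2l lerN2 lef_pV2 ?posrE//.
  by rewrite ler_nat.
- move=> n; have [P DP hP] : exists2 P, D x P & upper D x f - n.+1%:R^-1 < mean P f.
    have n0 : 0 < n.+1%:R^-1 :> R by rewrite invr_gt0.
    have [_ [P DP <-] h] := sup_adherent n0 (has_sup_upper x Cf).
    by exists P.
  by exists P; split => //=; exact: ltW.
move=> P [DP hP]; exists P => //; apply/eqP; rewrite eq_le upper_ge//=.
apply/ler_addgt0Pl => e e0.
have [n _ /(_ n (leqnn n)) ne] := near_infty_natSinv_lt (PosNum e0).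
by have := hP n; rewrite /= lerBlDr => h; rewrite (le_trans h)// addrC lerD2r ltW.
Qed.

Lemma upper_bound x f c : Cb R X f -> (forall w, `|f w| <= c) -> `|upper D x f| <= c.
Proof.
move=> Cf fc; have [P DP <-] := upper_attained x Cf.
by apply: mean_norm_le => //; have [] := bmf_Cb Cf.
Qed.

(** As the supremum is attained, it is at least a exactly when D(x) meets the closed set of laws
    with P f >= a. *)
Lemma upper_bmf f : Cb R X f -> bmf ((fun x => upper D x f) : borel X -> R).
Proof.
move=> Cf; split; last first.
  by have [c c0 hc] := bounded_fun_bound Cf.2; exists c => x; exact: upper_bound.
apply: (measurability _ (RGenCInfty.measurableE R)).
move=> _ [_ [a ->] <-]; rewrite setTI.
rewrite (_ : _ @^-1` _ = [set x | D x `&` [set P | a <= mean P f] !=set0]).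
  by apply: good_measurable => //; exact: closed_mean_ge.
apply/seteqP; split => x /=; rewrite in_itv/= andbT.
  by move=> ha; have [P DP e] := upper_attained x Cf; exists P; rewrite /= e.
by move=> [P [DP /= h]]; rewrite (le_trans h)// upper_ge.
Qed.

Definition argmax f x := [set P | D x P /\ upper D x f <= mean P f].

Lemma argmaxE f x P : Cb R X f -> argmax f x P -> mean P f = upper D x f.
Proof. by move=> Cf [DP h]; apply/eqP; rewrite eq_le h upper_ge. Qed.

Lemma good_argmax f : Cb R X f -> good (argmax f).
Proof.
move=> Cf; have E x : argmax f x = D x `&` [set P | upper D x f <= mean P f] by [].
split.
- by move=> x; have [P DP e] := upper_attained x Cf; exists P; split => //; rewrite e.
- by move=> x; rewrite E; apply: compact_closedI; [exact: good_compact|exact: closed_mean_ge].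
- move=> x P Q [DP h] PQ; split; first exact: good_saturated DP PQ.
  by rewrite -(same_mean PQ)//; exact: bmf_Cb.
- move=> F cF.
  (* The level [upper D x f] varies with x, so it is approached from below by rationals, each giving
     a closed set independent of x; compactness of D(x) recovers a maximiser in F. *)
  rewrite (_ : [set x | _] = \bigcap_(q in [set: rat])
     ([set x | upper D x f <= ratr q] `|` [set x | D x `&` (F `&` [set P | ratr q <= mean P f]) !=set0])).
    apply: countable_bigcap_measurable => q; apply: measurableU.
      have [mu _] := upper_bmf Cf.
      have := mu measurableT `]-oo, (ratr q : R)]%classic (measurable_itv _).
      by rewrite setTI; congr measurable; apply/seteqP; split => x /=; rewrite in_itv.
    apply: good_measurable => //; apply: closedI => //; exact: closed_mean_ge.
  apply/seteqP; split => x /=.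
    move=> [P [[DP h] FP]] q _; have [hq|hq] := leP (upper D x f) (ratr q); [by left|right].
    by exists P; split => //; split => //=; exact: le_trans (ltW hq) h.
  move=> hq.
  have h n : exists2 q : rat, upper D x f - n.+1%:R^-1 < ratr q & ratr q < upper D x f.
    have : upper D x f - n.+1%:R^-1 < upper D x f by rewrite gtrBl.
    by move=> /rat_in_itvoo[q]; rewrite in_itv/= => /andP[? ?]; exists q.
  have := @compact_nested law (D x)
    (fun n => F `&` [set P | upper D x f - n.+1%:R^-1 <= mean P f]) (@good_compact D gD x).
  case.
  + by move=> n; apply: closedI => //; exact: closed_mean_ge.
  + move=> n P /= [FP]; split => //; apply: le_trans b; rewrite lerD2l lerN2 lef_pV2 ?posrE//.
    by rewrite ler_nat.
  + move=> n; have [q q1 q2] := h n.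
    have [h1|[P [DP [FP /= Pq]]]] := hq q I; first by move: h1; rewrite /= leNgt q2.
    by exists P; split => //; split => //=; rewrite (le_trans (ltW q1)).
  move=> P [DP hP]; exists P; split; last by case: (hP 0%N).
  split => //; apply/ler_addgt0Pl => e e0.
  have [n _ /(_ n (leqnn n)) ne] := near_infty_natSinv_lt (PosNum e0).
  by have [_] := hP n; rewrite /= lerBlDr => h'; rewrite (le_trans h')// addrC lerD2r ltW.
Qed.

(* By compactness, the linear penalty n F forces near-optimal laws to
   maximise F in the limit. *)
Lemma cvg_upper_argmax f F x : Cb R X f -> Cb R X F ->
  upper D x (fun w => f w + n%:R * F w) - n%:R * upper D x F @[n --> \oo] -->
  upper (argmax F) x f.
Proof.
move=> Cf CF.
have CfF n : Cb R X (fun w => f w + n%:R * F w) by apply: CbD => //; exact: CbZ.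
have mE P n : mean P (fun w => f w + n%:R * F w) = mean P f + n%:R * mean P F.
  by rewrite meanD ?meanZ//; [exact: bmf_Cb|exact: bmf_Cb|exact/bmf_Cb/CbZ].
have gA := good_argmax CF.
have supA : has_sup [set mean P f | P in argmax F x].
  have [c c0 hc] := bounded_fun_bound Cf.2.
  split; first by have [P DP] := good_ne gA x; exists (mean P f), P.
  exists c => _ [P _ <-]; rewrite (le_trans (ler_norm _))//.
  by apply: mean_norm_le => //; have [] := bmf_Cb Cf.
have lo n : upper (argmax F) x f <= upper D x (fun w => f w + n%:R * F w) - n%:R * upper D x F.
  apply: ge_sup; first by case: supA.
  move=> _ [P AP <-]; rewrite lerBrDr -(argmaxE CF AP) -mE.
  by apply: upper_ge => //; case: AP.
pose a := upper (argmax F) x f.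
apply/cvgrPdist_le => e e0.
(* The expression is the supremum of P f + n (P F - V) with P F <= V, hence nonincreasing in n: one
   good index suffices. *)
suff [N hN] : exists N, upper D x (fun w => f w + N%:R * F w) - N%:R * upper D x F <= a + e.
  exists N => // n /= Nn; rewrite distrC ger0_norm ?subr_ge0// lerBlDl -/a.
  apply: le_trans hN; have [P DP e1] := upper_attained x (CfF n).
  rewrite -e1; apply: (@le_trans _ _ (mean P (fun w => f w + N%:R * F w) - N%:R * upper D x F)).
    have := upper_ge CF DP; rewrite !mE -subr_ge0 => h.
    have : 0 <= (n%:R - N%:R) * (upper D x F - mean P F).
      by rewrite mulr_ge0// subr_ge0 ler_nat.
    by rewrite mulrBl !mulrBr; lra.
  by rewrite lerD2r; exact: upper_ge.
(* Otherwise compactness yields one law P of D(x) with P f + m (P F - V) >= a + e for all m. This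
   forces P F = V, so P lies in the argmax and P f <= a, a contradiction. *)
apply: contrapT => /forallNP hN.
pose V := upper D x F.
have mE' P n : mean P (fun w => f w + n%:R * (F w - V)) = mean P f + n%:R * (mean P F - V).
  rewrite meanD ?meanZ ?meanB ?mean_cst//.
  - exact: bmf_Cb.
  - exact: bmf_cst.
  - by apply: bmfB; [exact: bmf_Cb|exact: bmf_cst].
  - exact: bmf_Cb.
  - by apply: bmfZ; apply: bmfB; [exact: bmf_Cb|exact: bmf_cst].
have [] := @compact_nested law (D x)
   (fun n => \bigcap_(m in [set m | (m <= n)%N]) [set P | a + e <= mean P (fun w => f w + m%:R * (F w - V))])
   (@good_compact D gD x).
- move=> n; apply: closed_bigI => m _; apply: closed_mean_ge; apply: CbD => //; apply: CbZ.
  by apply: CbD => //; exact: Cb_cst.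
- by move=> n P h m mn; apply: h => /=; exact: leq_trans mn _.
- move=> n; have [P DP eP] := upper_attained x (CfF n).
  exists P; split => // m /= mn; rewrite mE'.
  have := hN n; rewrite -eP mE -/V => /negP; rewrite -ltNge => h.
  have := upper_ge CF DP; rewrite -/V -subr_ge0 => h0.
  have : 0 <= (n%:R - m%:R) * (V - mean P F).
    by rewrite mulr_ge0// subr_ge0 ler_nat.
  by rewrite mulrBl !mulrBr; lra.
move=> P [DP hP].
have hP' n : a + e <= mean P f + n%:R * (mean P F - V).
  by rewrite -mE'; apply: (hP n) => /=.
have PV : argmax F x P.
  split => //; rewrite leNgt; apply/negP; rewrite -/V => lt.
  have d0 : 0 < V - mean P F by rewrite subr_gt0.
  have [n _ /(_ n (leqnn n)) hn] := nbhs_infty_gtr ((mean P f - a - e) / (V - mean P F)).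
  have := hP' n; move: hn; rewrite ltr_pdivrMr// !mulrBr; lra.
have := ub_le_sup supA.2 (ex_intro2 _ _ P PV erefl).
have := hP' 0%N; rewrite mul0r addr0 -/(upper (argmax F) x f) -/a; lra.
Qed.

(** Uniform in n: the domination used when the previous limit is integrated in x. *)
Lemma upper_argmax_bound f F x n c : Cb R X f -> Cb R X F -> (forall w, `|f w| <= c) ->
  `|upper D x (fun w => f w + n%:R * F w) - n%:R * upper D x F| <= c.
Proof.
move=> Cf CF fc.
have CfF : Cb R X (fun w => f w + n%:R * F w) by apply: CbD => //; exact: CbZ.
have mE P : mean P (fun w => f w + n%:R * F w) = mean P f + n%:R * mean P F.
  by rewrite meanD ?meanZ//; [exact: bmf_Cb|exact: bmf_Cb|exact/bmf_Cb/CbZ].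
have mb P : `|mean P f| <= c by apply: mean_norm_le => //; have [] := bmf_Cb Cf.
have [P DP eP] := upper_attained x CfF; have [Q DQ eQ] := upper_attained x CF.
have := upper_ge CfF DQ; have := upper_ge CF DP.
have := mb P; have := mb Q; rewrite !ler_norml => /andP[q1 q2] /andP[p1 p2] h1 h2.
rewrite -eP !mE eQ in h2; rewrite -eP mE.
have : 0 <= n%:R * (upper D x F - mean P F) by rewrite mulr_ge0// subr_ge0.
rewrite mulrBr => h3; apply/andP; split; lra.
Qed.

End upper.

Fixpoint chain (D : X -> set law) (fs : nat -> Omega -> R) (n : nat) : X -> set law :=
  if n is m.+1 then argmax (chain D fs m) (fs m) else D.

Definition chain_limit D fs x := \bigcap_n chain D fs n x.

Lemma good_chain D fs n : good D -> (forall k, Cb R X (fs k)) -> good (chain D fs n).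
Proof. by move=> gD Cf; elim: n => //= n IH; exact: good_argmax. Qed.

Lemma chain_sub D fs m n x : (m <= n)%N -> chain D fs n x `<=` chain D fs m x.
Proof.
elim: n => [|n IH]; first by rewrite leqn0 => /eqP ->.
by rewrite leq_eqVlt => /predU1P[-> //|/IH h]; apply: subset_trans h => P [].
Qed.

(** Each stage is D(x) intersected with a closed set. Only this relative closedness is available, so
    compactness arguments run on closures and return to the stages through this lemma. *)
Lemma chain_closed D fs n x : good D -> (forall k, Cb R X (fs k)) ->
  D x `&` closure (chain D fs n x) `<=` chain D fs n x.
Proof.
move=> gD Cf; suff [E cE EE] : exists2 E, closed E & chain D fs n x = D x `&` E.
  rewrite {2}EE => P [DP hP]; split => //; apply: cE; apply: closureS hP.
  by rewrite EE; exact: subIsetr.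
elim: n => [|n [E cE EE]]; first by exists setT; [exact: closedT|rewrite setIT].
exists (E `&` [set P | upper (chain D fs n) x (fs n) <= mean P (fs n)]).
  by apply: closedI => //; exact: closed_mean_ge.
by rewrite setIA -EE.
Qed.

Lemma chain_limit_meet D fs x (F : set law) : good D -> (forall k, Cb R X (fs k)) -> closed F ->
  (forall n, chain D fs n x `&` F !=set0) -> chain_limit D fs x `&` F !=set0.
Proof.
move=> gD Cf cF nF.
have [] := @compact_nested law (D x) (fun n => closure (chain D fs n x) `&` F)
  (@good_compact D gD x).
- by move=> n; apply: closedI => //; exact: closed_closure.
- by move=> n; apply: setSI; apply: closureS; exact: chain_sub.
- move=> n; have [P [cP FP]] := nF n; exists P; split.
    exact: (chain_sub (m := 0) _ cP).
  by split => //; exact: subset_closure.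
move=> P [DP hP]; exists P; split; last by case: (hP 0%N).
by move=> n _; apply: chain_closed => //; split => //; case: (hP n).
Qed.

Lemma good_chain_limit D fs : good D -> (forall k, Cb R X (fs k)) -> good (chain_limit D fs).
Proof.
move=> gD Cf; have gc n := good_chain n gD Cf; split.
- move=> x; have [|P [cP _]] := @chain_limit_meet D fs x setT gD Cf closedT.
    by move=> n; rewrite setIT; exact: good_ne.
  by exists P.
- move=> x; rewrite (_ : chain_limit D fs x = D x `&` \bigcap_n closure (chain D fs n x)).
    apply: compact_closedI; first exact: good_compact.
    by apply: closed_bigI => n _; exact: closed_closure.
  apply/seteqP; split => P.
    by move=> h; split; [exact: (h 0%N)|move=> n _; apply: subset_closure; exact: h].
  by move=> [DP h] n _; apply: chain_closed => //; split => //; exact: h.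
- by move=> x P Q hP PQ n _; apply: (good_saturated (gc n)) PQ; exact: hP.
- move=> F cF; rewrite (_ : [set x | _] = \bigcap_(n in [set: nat]) [set x | chain D fs n x `&` F !=set0]).
    by apply: countable_bigcap_measurable => n; exact: good_measurable.
  apply/seteqP; split => x /=.
    by move=> [P [hP FP]] n _; exists P; split => //; exact: hP.
  by move=> h; apply: chain_limit_meet => // n; exact: h.
Qed.

Lemma measurable_of_unique D (S : X -> law) : good D -> (forall x, D x (S x)) ->
  (forall x P Q, D x P -> D x Q -> same_measure P Q) ->
  forall F : set law, closed F -> @measurable _ (borel X) [set x | F (S x)].
Proof.
move=> gD DS uD F cF; rewrite (_ : [set x | _] = [set x | D x `&` F !=set0]).
  exact: good_measurable.
apply/seteqP; split => x /=; first by move=> h; exists (S x).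
by move=> [P [DP FP]]; apply: (closed_saturated cF FP); exact: uD (DS x).
Qed.

Lemma selection_bmf D (S : X -> law) : good D -> (forall x, D x (S x)) ->
  (forall x P Q, D x P -> D x Q -> same_measure P Q) ->
  forall f : bOmega -> R, bmf f -> bmf ((fun x => mean (S x) f) : borel X -> R).
Proof.
move=> gD DS uD; apply: (kernel_bmf hX) => f Cf.
apply: (measurability _ (RGenCInfty.measurableE R)).
move=> _ [_ [a ->] <-]; rewrite setTI.
have := measurable_of_unique gD DS uD (closed_mean_ge (c := a) Cf).
by congr measurable; apply/seteqP; split => x /=; rewrite in_itv/= andbT.
Qed.

(** Maximising a determining sequence of C_b successively leaves a single law up to [same_measure],
    and a good map with single values is measurable. *)
Lemma measurable_selection_exists D : good D -> exists2 S : X -> law,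
  (forall x, D x (S x)) &
  (forall f : bOmega -> R, bmf f -> bmf ((fun x => mean (S x) f) : borel X -> R)).
Proof.
move=> gD; have [d [Cd dH]] := Omega_determining hX.
have gc := good_chain_limit gD Cd.
have [S hS] := choice (good_ne gc).
exists S; first by move=> x; exact: (hS x 0%N).
apply: (selection_bmf gc hS) => x P Q hP hQ; apply: (law_ext hX) => f Cf.
have e1 : mean P (fun=> 1) = mean Q (fun=> 1) by rewrite !mean_cst.
have HH := eq_functional_class (bounded_linear_mean P) (bounded_linear_mean Q) e1.
have HD k : [set f : bOmega -> R | bmf f /\ mean P f = mean Q f] (d k).
  split; first exact: bmf_Cb.
  have gk := good_chain k gD Cd.
  by rewrite (argmaxE gk (Cd k) (hP k.+1 I)) (argmaxE gk (Cd k) (hQ k.+1 I)).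
by have [] := dH _ HH HD _ (bmf_Cb Cf).
Qed.

(* The optimal law is the mixture over w of a measurable choice of maximisers
   of f in D(w(tau)). *)
Lemma K_optimal D (P : law) (tau : Omega -> time R) (f : Omega -> R) :
  good D -> stopping_time tau -> Cb R X f ->
  exists M : law, Kset P tau D M /\ mean M f = mean P (fun w => upper D (eval_tau tau w) f).
Proof.
move=> gD st Cf; have [S hS bS] := measurable_selection_exists (good_argmax gD Cf).
have me := eval_tau_measurable hX st.
have bk : forall g : bOmega -> R, bmf g -> bmf (fun w : bOmega => mean (S (eval_tau tau w)) g).
  by move=> g bg; exact: (bmf_comp (bS g bg) me).
have [M [_ hM]] := mixture_exists P bk.
exists M; split; last first.
  rewrite hM; last exact: bmf_Cb.
  by congr mean; apply/funext => w; apply: argmaxE => //; exact: hS.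
move=> g Cg /=; rewrite hM; last exact: bmf_Cb.
apply: le_mean; first by apply: bk; exact: bmf_Cb.
- exact: (bmf_comp (upper_bmf gD Cg) me).
- by move=> w; apply: upper_ge => //; have [] := hS (eval_tau tau w).
Qed.

End good_maps.

Lemma Finf_ext (R : realType) (l : R) (g1 g2 : R -> R) :
  (forall t, 0 <= t -> g1 t = g2 t) -> Finf l g1 = Finf l g2.
Proof.
move=> e; apply: eq_Rintegral => t; rewrite inE /= in_itv/= andbT => t0.
by rewrite e.
Qed.

Lemma Iint_ext (R : realType) (l s : R) (g1 g2 : R -> R) :
  (forall t, 0 <= t <= s -> g1 t = g2 t) -> Iint l g1 s = Iint l g2 s.
Proof.
by move=> e; apply: eq_Rintegral => t; rewrite inE /= in_itv/= => ts; rewrite e.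
Qed.

(** * Discounted functionals of a path *)

Section path_functionals.
Context {R : realType} {X : ptopologicalType} (hX : polish R X).
Local Notation Omega := (cpath R X).
Local Notation bOmega := (borel Omega).
Variables (l : R) (phi : X -> R).
Hypotheses (l0 : 0 < l) (cphi : continuous phi) (bphi : bounded_fun phi).

(* F_n and its integral up to time s are Fpath and Zpath for (lambda_n, phi_n);
   zeta_n^tau(P) is the mean of the latter at s = tau(w). *)
Definition Fpath (w : Omega) : R := Finf l (fun t => phi (at_time w t)).
Definition Zpath (s : R) (w : Omega) : R := Iint l (fun t => phi (at_time w t)) s.

Let cphiw (w : Omega) : continuous (fun t => phi (at_time w t)).
Proof. exact: along_path_continuous. Qed.

Lemma Fpath_split s w : 0 <= s ->
  Fpath w = Zpath s w + expR (- (l * s)) * Fpath (Defs.shift (mk_time s) w).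
Proof.
have [c c0 hc] := bounded_fun_bound bphi.
move=> s0; rewrite /Fpath (Finf_split l0 (@cphiw w) (c := c) _ s0)//; congr (_ + _ * _).
by apply: Finf_ext => t t0; rewrite at_time_shift// mk_timeK.
Qed.

Lemma Zpath_split s t w : 0 <= s -> 0 <= t ->
  Zpath (s + t) w = Zpath s w + expR (- (l * s)) * Zpath t (Defs.shift (mk_time s) w).
Proof.
move=> s0 t0; rewrite /Zpath (Iint_shift l (@cphiw w) s0 t0); congr (_ + _ * _).
by apply: Iint_ext => r /andP[r0 _]; rewrite at_time_shift// mk_timeK.
Qed.

Lemma Zpath_continuous s : continuous (Zpath s : Omega -> R).
Proof.
move=> w0; apply/(@cvgrPdist_le _ _ _ (nbhs w0)) => e e0.
have [s0|/ltW s0] := leP 0 s; last first.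
  by apply: nearW => w; rewrite /Zpath !Iint_le0// subrr normr0 ltW.
have es : 0 < e / (s + 1) by rewrite divr_gt0// ltr_wpDl.
have := near_segment w0 0 s cphi es; apply: filterS => w hw.
have [c c0 hc] := bounded_fun_bound bphi.
have b1 (w' : Omega) : bmf (fun t => ex l t * phi (at_time w' t)).
  by apply: bmfM; [exact/ex_bmf/ltW|apply: (continuous_bounded_bmf (c := c)) => // t; exact: hc].
have bd : bmf (fun t => ex l t * phi (at_time w0 t) - ex l t * phi (at_time w t)) by exact: bmfB.
have bi h : bmf h -> (@lebesgue_measure R).-integrable `[0, s] (EFin \o h).
  by move=> bh; apply: bmf_integrable => //; exact: itv_fin.
rewrite /Zpath !IintE -RintegralB//; [|exact/bi/b1|exact/bi/b1].
rewrite (le_trans (le_normr_Rintegral _ (bi _ bd)))//.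
apply: (@le_trans _ _ (\int[lebesgue_measure]_(t in `[0%R, s]) (e / (s + 1)))%R).
  apply: le_Rintegral => //.
  - exact: (integrable_norm (bi _ bd)).
  - by apply: bi; exact: bmf_cst.
  - move=> t; rewrite /= in_itv/= => ts; rewrite -mulrBr normrM ger0_norm ?ex_ge0//.
    rewrite -[leRHS]mul1r ler_pM ?ex_ge0//; first by rewrite ex_le1// ltW.
    by rewrite distrC ltW// hw.
have ms : @lebesgue_measure R `[0, s] = s%:E.
  rewrite lebesgue_measure_itv/= lte_fin; case: ltP => [_|s0']; first by rewrite oppr0 adde0.
  by congr EFin; apply/eqP; rewrite eq_le s0 s0'.
rewrite Rintegral_cst// [X in fine X]ms /= mulrAC ler_pdivrMr ?ltr_wpDl//.
by rewrite ler_wpM2l ?(ltW e0)// lerDl.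
Qed.

Lemma Fpath_bound c w : (forall x, `|phi x| <= c) -> `|Fpath w| <= c / l.
Proof.
by move=> hc; apply: Finf_le => //; exact: continuous_measurable_fun.
Qed.

Lemma Zpath_bound c s w : (forall x, `|phi x| <= c) -> `|Zpath s w| <= 2 * (c / l).
Proof. by move=> hc; apply: Iint_le. Qed.

Lemma Fpath_continuous : continuous (Fpath : Omega -> R).
Proof.
move=> w0; apply/(@cvgrPdist_le _ _ _ (nbhs w0)) => e e0.
have [c c0 hc] := bounded_fun_bound bphi.
(* A time beyond which the discounted tail is at most e / 4, found from exp(x) >= 1 + x with x = l s
   = (c / l)(4 / e). *)
have [s s0 hs] : exists2 s : R, 0 <= s & expR (- (l * s)) * (c / l) <= e / 4.
  exists ((c / l) * (e / 4)^-1 / l).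
    by rewrite !mulr_ge0 ?invr_ge0 ?(ltW l0)// ?divr_ge0 ?(ltW e0).
  rewrite mulrC [l * _]mulrC divfK ?gt_eqF// expRN.
  have e4 : 0 < e / 4 by rewrite divr_gt0.
  rewrite ler_pdivrMr ?expR_gt0// -ler_pdivrMl// mulrC.
  by rewrite (le_trans _ (expR_ge1Dx _))// lerDr.
have e2 : 0 < e / 2 by rewrite divr_gt0.
have := @Zpath_continuous s w0 => /(@cvgrPdist_le _ _ _ (nbhs w0))/(_ _ e2).
apply: filterS => w /= hw; rewrite (Fpath_split w0 s0) (Fpath_split w s0).
have b (w' : Omega) : `|expR (- (l * s)) * Fpath w'| <= e / 4.
  rewrite normrM ger0_norm ?expR_ge0// (le_trans _ hs)// ler_wpM2l ?expR_ge0//.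
  exact: Fpath_bound.
have := b (Defs.shift (mk_time s) w0); have := b (Defs.shift (mk_time s) w).
move: hw; rewrite !ler_norml => /andP[h1 h2] /andP[h3 h4] /andP[h5 h6].
apply/andP; split; lra.
Qed.

Lemma Fpath_Cb : Cb R X Fpath.
Proof.
split; first exact: Fpath_continuous.
have [c c0 hc] := bounded_fun_bound bphi.
exists (c / l); split; first exact: num_real.
by move=> M Mc w _; apply: ltW; apply: le_lt_trans Mc; exact: Fpath_bound.
Qed.

Lemma Zpath_stop_bmf (rho : bOmega -> R) : measurable_fun setT rho ->
  bmf ((fun w => Zpath (rho w) w) : bOmega -> R).
Proof.
have [c c0 hc] := bounded_fun_bound bphi.
move=> mrho; split; last by exists (2 * (c / l)) => w; exact: Zpath_bound.
apply: (@diag_measurable _ _ _ (fun r (w : bOmega) => Zpath r w)) => //.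
  by move=> r; apply: continuous_measurable_borel; exact: Zpath_continuous.
by move=> w; apply: (Iint_continuous l0 (c := c)).
Qed.

End path_functionals.

(** * Krylov conditions and maximisation *)

Section krylov.
Context {R : realType} {X : ptopologicalType} (hX : polish R X).
Variables (Phi : set (X -> R)) (hPhi : separating_family Phi).
Variables (Lambda : set R) (hLambda : dense_rates Lambda).
Variables (lambda : nat -> R) (phi : nat -> X -> R).
Variable henum : range (fun n => (lambda n, phi n)) = Lambda `*` Phi.
Variables (C : X -> set (law R X)) (hC : strong_krylov lambda phi C).
Local Notation Omega := (cpath R X).
Local Notation law := (law R X).
Local Notation bOmega := (borel Omega).
Implicit Types (P Q M : law) (D : X -> set law) (n m : nat).

Lemma enum_in n : Lambda (lambda n) /\ Phi (phi n).
Proof.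
have : range (fun n => (lambda n, phi n)) (lambda n, phi n) by exists n.
by rewrite henum => -[].
Qed.

Lemma lambda_gt0 n : 0 < lambda n.
Proof.
have [_ h _] := hLambda; have [/h] := enum_in n.
by rewrite /= in_itv/= andbT.
Qed.

Lemma phi_continuous n : continuous (phi n).
Proof. by have [_ h _ _] := hPhi; have [_ /h[]] := enum_in n. Qed.

Lemma phi_bounded n : bounded_fun (phi n).
Proof. by have [_ h _ _] := hPhi; have [_ /h[]] := enum_in n. Qed.

Hint Resolve lambda_gt0 phi_continuous phi_bounded : core.

Definition Fn n : Omega -> R := Fpath (lambda n) (phi n).
Definition Zn n : R -> Omega -> R := Zpath (lambda n) (phi n).

Lemma Fn_Cb n : Cb R X (Fn n). Proof. exact: Fpath_Cb. Qed.
Lemma Fn_bmf n : bmf (Fn n : bOmega -> R). Proof. exact/bmf_Cb/Fn_Cb. Qed.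
Hint Resolve Fn_Cb Fn_bmf : core.

Lemma good_C : good C.
Proof.
split.
- by move=> x; have [] := krylov_C1 hC x.
- by move=> x; have [] := krylov_C1 hC x.
- move=> x P Q CP PQ; have [_ _ cvx] := krylov_C1 hC x.
  apply: (cvx P P Q 1) => //; first by rewrite ler01 lexx.
  by move=> A mA; rewrite -PQ// subrr mul1e mul0e adde0.
- exact: krylov_C2 hC.
Qed.

Section stop.
Variables (tau : Omega -> time R) (st : stopping_time tau) (pt : positive_time tau).
Local Notation T w := (time_val (tau w)).

(** Membership of theta_tau P in K(P, tau, D), expressed by means under P so that no law
    representing the push-forward has to be chosen. *)
Definition KPin D P := forall f, Cb R X f ->
  mean P (fun w => f (theta tau w)) <= mean P (fun w => upper D (eval_tau tau w) f).

Let mth := theta_measurable hX st.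
Let mev := eval_tau_measurable hX st.

Lemma KP1 x P : C x P -> KPin C P.
Proof.
move=> CP f Cf; have [Q KQ QP] := krylov_KP1 hC st pt CP.
rewrite -(mean_push mth QP); last exact: bmf_Cb.
exact: KQ.
Qed.

Lemma KP2 x P M : C x P -> Kset P tau C M -> exists Q, [/\ C x Q,
  (forall f : bOmega -> R, bmf f -> mean M f = mean Q (fun w => f (theta tau w))) &
  forall n, mean P (fun w => Zn n (T w) w) <= mean Q (fun w => Zn n (T w) w)].
Proof.
move=> CP KM; have := krylov_KP2 hC st pt CP => e.
have [Q [CQ _ hz] MQ] : [set M : law | exists2 Q, Gamma lambda phi P x tau C Q &
                              same_measure M (push_theta tau Q)] M by rewrite e.
by exists Q; split => // f bf; exact: (mean_push mth MQ).
Qed.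

Lemma upper_eval_bmf D f : good D -> Cb R X f ->
  bmf ((fun w => upper D (eval_tau tau w) f) : bOmega -> R).
Proof. by move=> gD Cf; exact: (bmf_comp (upper_bmf gD Cf) mev). Qed.

Lemma theta_bmf (f : bOmega -> R) : bmf f -> bmf ((fun w => f (theta tau w)) : bOmega -> R).
Proof. by move=> bf; exact: bmf_comp bf mth. Qed.

Lemma KPin_argmax D P F : good D -> Cb R X F -> KPin D P ->
  mean P (fun w => F (theta tau w)) = mean P (fun w => upper D (eval_tau tau w) F) ->
  KPin (argmax D F) P.
Proof.
move=> gD CF KP e f Cf.
have CfF n : Cb R X (fun w => f w + n%:R * F w) by apply: CbD => //; exact: CbZ.
have [c c0 hc] := bounded_fun_bound Cf.2.
have h n : mean P (fun w => f (theta tau w)) <=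
    mean P (fun w => upper D (eval_tau tau w) (fun w => f w + n%:R * F w) - n%:R * upper D (eval_tau tau w) F).
  rewrite meanB ?meanZ -?e; [|exact: upper_eval_bmf|exact: upper_eval_bmf|exact/bmfZ/upper_eval_bmf].
  rewrite lerBrDr; apply: le_trans (KP _ (CfF n)).
  rewrite meanD ?meanZ//; [exact/theta_bmf/bmf_Cb|exact/theta_bmf/bmf_Cb|exact/bmfZ/theta_bmf/bmf_Cb].
have cv : mean P (fun w => upper D (eval_tau tau w) (fun w => f w + n%:R * F w) -
    n%:R * upper D (eval_tau tau w) F) @[n --> \oo] -->
    mean P (fun w => upper (argmax D F) (eval_tau tau w) f).
  apply: (cvg_mean (M := c)).
  - by move=> n; apply: bmfB; [exact: upper_eval_bmf|exact/bmfZ/upper_eval_bmf].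
  - by move=> n w; exact: upper_argmax_bound.
  - by move=> w; exact: cvg_upper_argmax.
by rewrite -(cvg_lim _ cv)//; apply: limr_ge; [apply/cvg_ex; eexists; exact: cv|exact: nearW].
Qed.

End stop.

Lemma upper_sub D D' x f : good D -> good D' -> Cb R X f -> D' x `<=` D x ->
  upper D' x f <= upper D x f.
Proof.
move=> gD gD' Cf DD; have [P DP <-] := upper_attained gD' x Cf.
by apply: upper_ge => //; exact: DD.
Qed.

(** All laws of the argmax give F the same mean, so supremum and infimum of that mean coincide
    there; this makes two-sided bounds out of membership in K. *)
Lemma upper_argmaxN D F x : good D -> Cb R X F ->
  upper (argmax D F) x (fun w => - F w) = - upper D x F.
Proof.
move=> gD CF; have gA := good_argmax gD CF; have CN := CbN CF.
have [P AP <-] := upper_attained gA x CN.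
rewrite -(argmaxE gD CF AP); have bF := bmf_Cb CF.
have := meanZ P (-1) bF.
by under eq_fun do rewrite mulN1r; rewrite mulN1r.
Qed.

Lemma meanN P (f : bOmega -> R) : bmf f -> mean P (fun w => - f w) = - mean P f.
Proof.
move=> bF; have := meanZ P (-1) bF.
by under eq_fun do rewrite mulN1r; rewrite mulN1r.
Qed.

Definition det (t : R) : Omega -> time R := fun=> mk_time t.

Lemma det_stopping t : stopping_time (det t). Proof. exact: stopping_cst. Qed.

Lemma det_positive t : 0 < t -> positive_time (det t).
Proof. by move=> t0 w; rewrite /det mk_timeK// ltW. Qed.

Lemma theta_det t w : theta (det t) w = Defs.shift (mk_time t) w. Proof. by []. Qed.

Lemma mean_Fn_split n t Q : 0 <= t ->
  mean Q (Fn n) = mean Q (Zn n t) + expR (- (lambda n * t)) * mean Q (fun w => Fn n (theta (det t) w)).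
Proof.
move=> t0.
have b1 : bmf (Zn n t : bOmega -> R).
  exact: (Zpath_stop_bmf (lambda_gt0 n) (@phi_continuous n) (phi_bounded n) (measurable_cst t)).
have b2 : bmf ((fun w => Fn n (theta (det t) w)) : bOmega -> R).
  exact: (theta_bmf (det_stopping t) (Fn_bmf n)).
rewrite -meanZ// -meanD//; last exact: bmfZ.
congr mean; apply/funext => w; rewrite theta_det.
exact: (Fpath_split (lambda_gt0 n) (@phi_continuous n) (phi_bounded n)).
Qed.

Let Dn n := chain C Fn n.

Lemma good_Dn n : good (Dn n). Proof. by apply: good_chain => //; exact: good_C. Qed.

(* (KP1) and (KP2) at deterministic times pass from D_n to D_(n+1): as the
   discount is constant, the law given by (KP2) for an optimal continuation
   still maximises F_n. *)
Lemma det_chain n t : 0 < t -> forall x P, Dn n x P -> KPin (det t) (Dn n) P /\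
  forall M, Kset P (det t) (Dn n) M -> exists Q, [/\ Dn n x Q,
    (forall f : bOmega -> R, bmf f -> mean M f = mean Q (fun w => f (theta (det t) w))) &
    forall m, mean P (Zn m t) <= mean Q (Zn m t)].
Proof.
move=> t0; have st := det_stopping t; have pt := det_positive t0.
have tE w : time_val (det t w) = t by rewrite /det mk_timeK// ltW.
elim: n => [|n IH] x P.
  move=> CP; split; first exact: (KP1 st pt CP).
  move=> M KM; have [Q [CQ h1 h2]] := KP2 st pt CP KM.
  exists Q; split; [exact: CQ|exact: h1|move=> m].
  have e : (fun w : Omega => Zn m (time_val (det t w)) w) = Zn m t.
    by apply/funext => w; rewrite tE.
  by have := h2 m; rewrite e.
move=> AP; have DP : Dn n x P by case: AP.
have [KP KQ] := IH x P DP; have gD := good_Dn n.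
have eP := argmaxE gD (Fn_Cb n) AP.
have e0 : 0 < expR (- (lambda n * t)) by exact: expR_gt0.
have sp Q := mean_Fn_split n Q (ltW t0).
(* If the inequality were strict, the law Q given by (KP2) for an optimal continuation would have a
   larger mean of F_n than P: its integral up to t is no smaller and its future is better. *)
have eq1 : mean P (fun w => Fn n (theta (det t) w)) =
    mean P (fun w => upper (Dn n) (eval_tau (det t) w) (Fn n)).
  apply/eqP; rewrite eq_le; apply/andP; split; first exact: (KP _ (Fn_Cb n)).
  have [M [KM <-]] := K_optimal hX P gD st (Fn_Cb n).
  have [Q [DQ QM QZ]] := KQ M KM.
  have := upper_ge gD (Fn_Cb n) DQ; rewrite -eP (sp Q) (sp P) -(QM _ (Fn_bmf n)).
  move: (QZ n); move: (mean P (Zn n t)) (mean Q (Zn n t)) (mean M (Fn n)) => z1 z2 a.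
  move: (mean P _) => b z12 h.
  rewrite -(ler_pM2l e0); lra.
have KA : KPin (det t) (Dn n.+1) P := KPin_argmax st gD (Fn_Cb n) KP eq1.
split; first exact: KA.
move=> M KM.
have gA : good (Dn n.+1) by exact: good_Dn.
have KMn : Kset P (det t) (Dn n) M.
  move=> f Cf; apply: (le_trans (KM f Cf)); apply: le_mean.
  - exact: (upper_eval_bmf st gA Cf).
  - exact: (upper_eval_bmf st gD Cf).
  - by move=> w; apply: upper_sub => // Q [].
have [Q [DQ QM QZ]] := KQ M KMn; exists Q; split; [|exact: QM|exact: QZ].
split; first exact: DQ.
rewrite -eP (sp Q) (sp P); apply: lerD; first exact: QZ.
(* Testing the membership of M in K for D_(n+1) on -F_n bounds the mean of F_n under M from below by
   the optimal value. *)
rewrite ler_pM2l// eq1 -(QM _ (Fn_bmf n)) -lerN2.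
have bu : bmf ((fun w => upper (Dn n) (eval_tau (det t) w) (Fn n)) : bOmega -> R).
  exact: (upper_eval_bmf st gD (Fn_Cb n)).
rewrite -(meanN M (Fn_bmf n)) -(meanN P bu).
apply: (le_trans (KM _ (CbN (Fn_Cb n)))); apply: le_mean.
- exact: (upper_eval_bmf st gA (CbN (Fn_Cb n))).
- exact: bmfN bu.
- by move=> w; rewrite (upper_argmaxN _ gD (Fn_Cb n)).
Qed.

End krylov.

(** * Determination by the functionals F_n *)

Section nice_functionals.
Context {R : realType} {X : ptopologicalType} (hX : polish R X).
Local Notation Omega := (cpath R X).
Local Notation law := (law R X).
Local Notation bOmega := (borel Omega).
Implicit Types (L : (bOmega -> R) -> R) (G : R -> bOmega -> R) (P : law).

Definition jointly_ok G (c : R) := [/\ forall t, measurable_fun setT (G t),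
  forall w, continuous (G^~ w) & forall t w, `|G t w| <= c].

(* The functionals f |-> E[h f o theta] and f |-> E[h S_{w(tau)} f] to which the
   uniqueness of Laplace transforms is applied. *)
Record nice L : Prop := Nice {
  nice_linear : bounded_linear L ;
  nice_bounded : exists2 K : R, 0 <= K &
    forall f c, bmf f -> (forall w, `|f w| <= c) -> `|L f| <= K * c ;
  nice_fub : forall l G c, 0 < l -> jointly_ok G c ->
    L (fun w => Finf l (G^~ w)) = Finf l (fun t => L (G t)) }.

Lemma jointly_ok_bmf G c t : jointly_ok G c -> bmf (G t).
Proof. by move=> [mG _ Gc]; split => //; exists c. Qed.

Lemma linear_continuous_param L G c : bounded_linear L -> jointly_ok G c ->
  continuous (fun t => L (G t)).
Proof.
move=> [_ cL] jG; have [mG cG Gc] := jG.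
move=> t; apply/(@cvg_nbhsP R R^o) => u ut.
apply: (cL (fun n => G (u n)) (G t) c) => //.
  by move=> n; exact: jointly_ok_bmf jG.
by move=> w; exact: (continuous_cvg _ (cG w t) ut).
Qed.

Lemma Finf_pdf (l : R) (g : R -> R) c : 0 < l -> measurable_fun setT g -> (forall t, `|g t| <= c) ->
  (\int[@lebesgue_measure R]_t (exponential_pdf l t * g t)%:E)%E = (l * Finf l g)%:E.
Proof.
move=> l0 mg gc.
have ig := exg_integrable l0 mg gc.
transitivity (\int[@lebesgue_measure R]_(t in `[0%R, +oo[) (l * (ex l t * g t))%:E)%E.
  rewrite [RHS]integral_mkcond; apply: eq_integral => t _.
  rewrite /exponential_pdf !patchE; case: ifPn; rewrite ?mul0r// inE /= in_itv/= andbT => t0.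
  by rewrite exE// mulrA mulNr.
rewrite FinfE -RintegralZl// /Rintegral fineK//.
by apply: integrable_fin_num => //; exact: integrable_scale.
Qed.

(** Fubini for P times Lebesgue measure, the integrand being weighted by the exponential density;
    this makes it integrable over the whole line and is divided out at the end. Joint measurability
    comes from continuity in t. *)
Lemma mean_Fubini P l G c : 0 < l -> jointly_ok G c ->
  mean P (fun w => Finf l (G^~ w)) = Finf l (fun t => mean P (G t)).
Proof.
move=> l0 jG; have [mG cG Gc] := jG.
have c0 : 0 <= c by exact: le_trans (normr_ge0 _) (Gc 0 point).
pose mu := @lebesgue_measure R.
pose pr := (P : probability bOmega R).
pose f (z : bOmega * measurableTypeR R) : \bar R := (exponential_pdf l z.2 * G z.2 z.1)%:E.
have mf : measurable_fun setT f.
  apply/measurable_EFinP; apply: measurable_funM.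
    by apply: measurableT_comp => //; exact: measurable_exponential_pdf.
  apply: (@diag_measurable _ _ _ (fun r (z : bOmega * measurableTypeR R) => G r z.1) (fun z => z.2)) => //.
    by move=> r; apply: (measurableT_comp (mG r)); exact: measurable_fst.
  exact: measurable_snd.
have mG2 w : measurable_fun setT (G^~ w) by exact: continuous_measurable_fun.
have fi : (pr \x mu)%E.-integrable setT f.
  apply/(integrable12ltyP pr mu mf).
  have fc : (\int[pr]_w c%:E < +oo)%E.
    by rewrite integral_cst// lte_mul_pinfty ?lee_fin// law_fin.
  apply: le_lt_trans fc; apply: ge0_le_integral => //.
  - by move=> w _; exact: integral_ge0.
  - by apply: (@measurable_fun_fubini_tonelli_F _ _ _ _ R mu (abse \o f)); [by apply: measurableT_comp; [exact: abse_measurable|exact: mf]|by move=> x; exact: abse_ge0].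
  - move=> w _; apply: (@le_trans _ _ (\int[mu]_t (c%:E * (exponential_pdf l t)%:E))%E).
      apply: ge0_le_integral => //.
      + by apply: (@measurableT_comp _ _ _ _ _ _ abse); [exact: abse_measurable|apply: (measurableT_comp mf); exact: measurable_pair1].
      + by apply/measurable_EFinP; apply: measurable_funM => //; exact: measurable_exponential_pdf.
      + move=> t _; have p0 := exponential_pdf_ge0 (ltW l0) t.
        by rewrite /f /= -EFinM lee_fin normrM (ger0_norm p0) [leRHS]mulrC ler_wpM2l.
    rewrite ge0_integralZl//; last 2 first.
    + by apply/measurable_EFinP; exact: measurable_exponential_pdf.
    + by move=> t _; rewrite lee_fin exponential_pdf_ge0// ltW.
    by rewrite integral_exponential_pdf// mule1.
have mc : measurable_fun setT (fun t => mean P (G t)).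
  by apply: continuous_measurable_fun; apply: (linear_continuous_param (bounded_linear_mean P) jG).
have bc t : `|mean P (G t)| <= c by exact: mean_norm_le.
have eL : (\int[pr]_w \int[mu]_t f (w, t))%E = (\int[pr]_w (l * Finf l (G^~ w))%:E)%E.
  by apply: eq_integral => w _; exact: (Finf_pdf l0 (mG2 w) (fun t => Gc t w)).
have eR : (\int[mu]_t \int[pr]_w f (w, t))%E = (\int[mu]_t (exponential_pdf l t * mean P (G t))%:E)%E.
  apply: eq_integral => t _; have ii : pr.-integrable setT (EFin \o G t).
    apply: bmf_integrable; [exact: measurableT|exact: law_fin|exact: (jointly_ok_bmf t jG)].
  transitivity (\int[pr]_w ((exponential_pdf l t)%:E * (EFin \o G t) w))%E.
    by apply: eq_integral => w _; rewrite -EFinM.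
  rewrite integralZl// EFinM; congr (_ * _)%E.
  by rewrite /mean /Rintegral fineK//; exact: integrable_fin_num.
have e : (\int[pr]_w (l * Finf l (G^~ w))%:E)%E = (l * Finf l (fun t => mean P (G t)))%:E.
  by rewrite -eL (Fubini fi) eR; exact: Finf_pdf.
have bF : bmf (fun w : bOmega => Finf l (G^~ w)).
  split; last by exists (c / l) => w; exact: Finf_le.
  have h0 : measurable_fun [set: bOmega] (fun w => (l * Finf l (G^~ w))%:E).
    have eF w : (\int[mu]_t f (w, t))%E = (l * Finf l (G^~ w))%:E.
      exact: (Finf_pdf l0 (mG2 w) (fun t => Gc t w)).
    have := measurable_fubini_F fi.
    by congr measurable_fun; apply/funext => w; exact: eF.
  have /measurable_EFinP h := h0.
  have := measurable_funM (measurable_cst l^-1) h.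
  by congr measurable_fun; apply/funext => w; rewrite /= mulKf ?gt_eqF.
apply: (@mulfI _ l); first by rewrite gt_eqF.
rewrite -meanZ//; apply: EFin_inj; rewrite -e.
rewrite /mean /Rintegral fineK//.
by apply: integrable_fin_num => //; apply: bmf_integrable => //; [exact: law_fin|exact: bmfZ].
Qed.

Lemma nice_mean P : nice (mean P : (bOmega -> R) -> R).
Proof.
split.
- exact: bounded_linear_mean.
- by exists 1 => // f c [mf _] fc; rewrite mul1r; exact: mean_norm_le.
- by move=> l G c; exact: mean_Fubini.
Qed.

Lemma FinfZ (l a c : R) (g : R -> R) : 0 < l -> measurable_fun setT g -> (forall t, `|g t| <= c) ->
  Finf l (fun t => a * g t) = a * Finf l g.
Proof.
move=> l0 mg gc; rewrite !FinfE -RintegralZl//; last exact: exg_integrable mg gc.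
by apply: eq_Rintegral => t _; rewrite mulrCA.
Qed.

Lemma nice_weight P (h : bOmega -> R) (g : bOmega -> bOmega) : bmf h -> measurable_fun setT g ->
  nice (fun f : bOmega -> R => mean P (fun w => h w * f (g w))).
Proof.
move=> bh mg; have [mh [C hC]] := bh.
have C0 : 0 <= C by exact: le_trans (normr_ge0 _) (hC point).
split.
- exact: (bounded_linear_comp mg (bounded_linear_weight P bh)).
- exists C => // f c bf fc; apply: mean_norm_le; first by have [] := bmfM bh (bmf_comp bf mg).
  by move=> w; rewrite normrM ler_pM.
- move=> l G c l0 jG; have [mG cG Gc] := jG.
  rewrite -(@mean_Fubini P l (fun t w => h w * G t (g w)) (C * c))//.
    congr mean; apply/funext => w; rewrite (FinfZ _ (c := c))//.
    exact: continuous_measurable_fun.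
  split.
  + by move=> t; apply: measurable_funM => //; exact: measurableT_comp.
  + by move=> w t; apply: cvgM; [exact: cvg_cst|exact: cG].
  + by move=> t w; rewrite normrM ler_pM.
Qed.

Lemma nice_kernel P (k : bOmega -> law) (h : bOmega -> R) : bmf h ->
  (forall f : bOmega -> R, bmf f -> bmf (fun w => mean (k w) f)) ->
  nice (fun f : bOmega -> R => mean P (fun w => h w * mean (k w) f)).
Proof.
move=> bh bk; have [mh [C hC]] := bh.
have C0 : 0 <= C by exact: le_trans (normr_ge0 _) (hC point).
split.
- exact: bounded_linear_kernel.
- exists C => // f c bf fc; apply: mean_norm_le; first by have [] := bmfM bh (bk _ bf).
  by move=> w; rewrite normrM ler_pM//; apply: mean_norm_le => //; case: bf.
- move=> l G c l0 jG; have [mG cG Gc] := jG.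
  have cm w : continuous (fun t => mean (k w) (G t)).
    exact: (linear_continuous_param (bounded_linear_mean (k w)) jG).
  have mm t w : `|mean (k w) (G t)| <= c by exact: mean_norm_le.
  rewrite -(@mean_Fubini P l (fun t w => h w * mean (k w) (G t)) (C * c))//.
    congr mean; apply/funext => w; rewrite (mean_Fubini _ l0 jG) (FinfZ _ (c := c))//.
    exact: continuous_measurable_fun.
  split.
  + by move=> t; apply: measurable_funM => //; have [] := bk _ (jointly_ok_bmf t jG).
  + by move=> w t; apply: cvgM; [exact: cvg_cst|exact: cm].
  + by move=> t w; rewrite normrM ler_pM.
Qed.

Lemma eq_functionals_Cb L1 L2 : bounded_linear L1 -> bounded_linear L2 ->
  (forall f, Cb R X f -> L1 f = L2 f) -> forall f, bmf f -> L1 f = L2 f.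
Proof.
move=> b1 b2 e f bf; have [D [DC DH]] := Omega_determining hX.
have HH := eq_functional_class b1 b2 (e _ (Cb_cst 1)).
have HD k : [set f : bOmega -> R | bmf f /\ L1 f = L2 f] (D k).
  by split; [exact: bmf_Cb|exact: e].
by have [] := DH _ HH HD _ bf.
Qed.

Variables (Phi : set (X -> R)) (hPhi : separating_family Phi).
Variables (Lambda : set R) (hLambda : dense_rates Lambda).

(** By exchange of integrals, L applied to [Fpath l phi] is the Laplace transform at l of the
    continuous bounded function t |-> L (phi (w(t))). Uniqueness gives equality at each t for phi in
    Phi, and Phi determines all psi. *)
Lemma nice_one_dim L1 L2 : nice L1 -> nice L2 -> L1 (fun=> 1) = L2 (fun=> 1) ->
  (forall l phi, Lambda l -> Phi phi -> L1 (Fpath l phi) = L2 (Fpath l phi)) ->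
  forall t (psi : borel X -> R), bmf psi ->
  L1 (fun w => psi (at_time w t)) = L2 (fun w => psi (at_time w t)).
Proof.
move=> n1 n2 e1 eF.
have [_ L0 Ld] := hLambda; have [_ hb _ _] := hPhi.
have pos t phi : 0 <= t -> Phi phi ->
    L1 (fun w => phi (at_time w t)) = L2 (fun w => phi (at_time w t)).
  move=> t0 Pphi; have [cphi bphi] := hb _ Pphi.
  have [c c0 hc] := bounded_fun_bound bphi.
  pose G r (w : bOmega) := phi (at_time w r).
  have jG : jointly_ok G c.
    split; first by move=> r; have [] := continuous_at_time_bmf r cphi bphi.
      by move=> w; exact: along_path_continuous.
    by move=> r w; exact: hc.
  have [[l1 _] [K1 K10 hK1] f1] := n1; have [[l2 _] [K2 K20 hK2] f2] := n2.
  have c1 := linear_continuous_param (nice_linear n1) jG.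
  have c2 := linear_continuous_param (nice_linear n2) jG.
  have b1 r : `|L1 (G r)| <= (K1 + K2) * c.
    apply: le_trans (hK1 _ _ (jointly_ok_bmf r jG) _) _; first by move=> w; exact: hc.
    by rewrite ler_wpM2r// lerDl.
  have b2 r : `|L2 (G r)| <= (K1 + K2) * c.
    apply: le_trans (hK2 _ _ (jointly_ok_bmf r jG) _) _; first by move=> w; exact: hc.
    by rewrite ler_wpM2r// lerDr.
  apply/eqP; rewrite -subr_eq0 addrC -mulN1r; apply/eqP.
  apply: (Laplace_unique (u := fun r => -1 * L2 (G r) + L1 (G r)) (c := (K1 + K2) * c + (K1 + K2) * c) Ld _ _ _ t0) => //.
  - move=> r; apply: cvgD; last exact: c1.
    by apply: cvgM; [exact: cvg_cst|exact: c2].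
  - by move=> r; rewrite mulN1r (le_trans (ler_normD _ _))// normrN lerD.
  - move=> l Ll; have l0 : 0 < l by have := L0 _ Ll; rewrite /= in_itv/= andbT.
    rewrite (FinfD l0 (-1) (continuous_measurable_fun c2) (continuous_measurable_fun c1) b2 b1).
    rewrite -(f1 _ _ _ l0 jG) -(f2 _ _ _ l0 jG).
    have e : L1 (fun w => Finf l (G^~ w)) = L2 (fun w => Finf l (G^~ w)) := eF l phi Ll Pphi.
    by rewrite e mulN1r addNr.
move=> t psi bpsi.
wlog t0 : t / 0 <= t.
  move=> h; have [t0|/ltW t0] := leP 0 t; first exact: h.
  have e (w : bOmega) : at_time w t = at_time w 0 by exact: at_time_le0.
  have -> : (fun w : bOmega => psi (at_time w t)) = fun w => psi (at_time w 0).
    by apply/funext => w; rewrite e.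
  exact: h.
have m1 := bounded_linear_comp (@at_time_measurable R X t) (nice_linear n1).
have m2 := bounded_linear_comp (@at_time_measurable R X t) (nice_linear n2).
have HH := eq_functional_class m1 m2 e1.
have [|//] := Phi_class hPhi HH _ bpsi.
move=> phi Pphi; have [cphi bphi] := hb _ Pphi.
by split; [exact: continuous_bmf|exact: pos].
Qed.

End nice_functionals.

Section multiplicative_class_bmf.
Context d (T : measurableType d) (R : realType).
Variables (H M : set (T -> R)).
Hypothesis HH : bounded_class H.
Hypothesis MM : forall f g, M f -> M g -> M (fun x => f x * g x).
Hypothesis Mb : forall f, M f -> bmf f.
Hypothesis MH : M `<=` H.
Hypothesis Mgen : forall S : set (set T), sigma_algebra setT S ->
  (forall f a, M f -> S [set x | f x < a]) -> measurable `<=` S.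

Lemma mclass_bmf f : bmf f -> H f.
Proof.
pose G : set (set T) := [set A | exists l : seq ((T -> R) * R),
  (forall p, p \in map fst l -> M p) /\ A = [set x | all (fun p => p.1 x < p.2) l]].
apply: (bclass_bmf HH (G := G)).
- rewrite eqEsubset; split.
    apply: Mgen; first exact: smallest_sigma_algebra.
    move=> g a Mg; apply: sub_sigma_algebra; exists [:: (g, a)]; split.
      by move=> p; rewrite inE => /eqP ->.
    by apply/seteqP; split => x /=; rewrite andbT.
  apply: smallest_sub; first exact: sigma_algebra_measurable.
  move=> _ [l [hl ->]]; elim: l hl => [|[g a] l IH] hl.
    by rewrite (_ : [set x | _] = setT); [exact: measurableT|apply/seteqP; split].
  rewrite (_ : [set x | _] = g @^-1` `]-oo, a[%classic `&` [set x | all (fun p => p.1 x < p.2) l]).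
    apply: measurableI; last by apply: IH => p pl; apply: hl; rewrite inE pl orbT.
    have [mg _] : bmf g by apply/Mb/hl; rewrite inE eqxx.
    by have := mg measurableT _ (measurable_itv `]-oo, a[); rewrite setTI.
  by apply/seteqP; split => x /=; rewrite in_itv/=; [move=> /andP[]|move=> [-> ->]].
- move=> A B [l [hl ->]] [l' [hl' ->]]; exists (l ++ l'); split.
    by move=> p; rewrite map_cat mem_cat => /orP[/hl|/hl'].
  apply/seteqP; split => x /=; rewrite all_cat; first by move=> [-> ->].
  by move=> /andP[].
- move=> A [l [hl ->]].
  have Mb' g : M g -> bounded_fun g.
    move=> /Mb[_ [c hc]]; exists c; split; first exact: num_real.
    by move=> y yc x _; apply: le_trans (hc x) (ltW yc).
  apply: (bclass_ext (mclass_cylinder HH MM Mb' MH hl)) => x.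
  rewrite indicE (_ : (x \in _) = all (fun p => p.1 x < p.2) l); last first.
    by apply/idP/idP; rewrite inE.
  elim: (l) => [|p s IH]; first by rewrite big_nil.
  by rewrite big_cons IH /=; case: (_ < _); rewrite ?mul1r ?mul0r.
Qed.

End multiplicative_class_bmf.

(** * Functionals of finitely many positions *)

Section finite_dimensional.
Context {R : realType} {X : ptopologicalType} (hX : polish R X).
Local Notation Omega := (cpath R X).
Local Notation law := (law R X).
Local Notation bOmega := (borel Omega).
Implicit Types (w : Omega) (b d : R) (g : X -> R).

(* Products of functions of the positions at finitely many times; [b] bounds the
   last time.  The nested form suits the Markov property. *)
Inductive fdd : R -> (Omega -> R) -> Prop :=
| fdd1 b : fdd b (fun=> 1)
| fddS b d g f : 0 <= d -> d <= b -> continuous g -> bounded_fun g -> fdd (b - d) f ->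
    fdd b (fun w => g (at_time w d) * f (Defs.shift (mk_time d) w)).

Lemma shift_shift d e w : 0 <= d -> 0 <= e ->
  Defs.shift (mk_time e) (Defs.shift (mk_time d) w) = Defs.shift (mk_time (d + e)) w.
Proof.
move=> d0 e0; apply: path_ext => r r0.
by rewrite !at_time_shift ?mk_timeK ?addr_ge0// addrA.
Qed.

Lemma shift_time0 w : Defs.shift (mk_time 0) w = w.
Proof. by apply: path_ext => r r0; rewrite at_time_shift// mk_timeK// add0r. Qed.

(** The two lists of times are merged: the factor with the earlier first time is pulled out, and the
    other functional is re-expressed from that time on. *)
Lemma fddM b f1 f2 : fdd b f1 -> fdd b f2 -> fdd b (fun w => f1 w * f2 w).
Proof.
move=> h1; elim: h1 f2 => {b f1} [b f2 h2|b d1 g1 f1 d10 d1b cg1 bg1 h1 IH1 f2 h2].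
  by under eq_fun do rewrite mul1r.
elim: h2 d1 g1 f1 d10 d1b cg1 bg1 h1 IH1 => {b f2} [b d1 g1 f1 ? ? ? ? ? ?|].
  by under eq_fun do rewrite mulr1; exact: fddS.
move=> b d2 g2 f2 d20 d2b cg2 bg2 h2 IH2 d1 g1 f1 d10 d1b cg1 bg1 h1 IH1.
have [d12|/ltW d21] := leP d1 d2.
  have e0 : 0 <= d2 - d1 by rewrite subr_ge0.
  pose f3 w := g2 (at_time w (d2 - d1)) * f2 (Defs.shift (mk_time (d2 - d1)) w).
  have h3 : fdd (b - d1) f3.
    apply: fddS => //; first by rewrite lerD2r.
    by rewrite opprB addrA subrK.
  rewrite (_ : (fun w => _) = fun w => g1 (at_time w d1) *
      (f1 (Defs.shift (mk_time d1) w) * f3 (Defs.shift (mk_time d1) w))); last first.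
    apply/funext => w; rewrite /f3 at_time_shift// shift_shift// mk_timeK//.
    by rewrite [d1 + _]addrC subrK !mulrA.
  by apply: (@fddS b d1 g1 (fun w => f1 w * f3 w)) => //; exact: IH1.
have e0 : 0 <= d1 - d2 by rewrite subr_ge0.
pose f3 w := g1 (at_time w (d1 - d2)) * f1 (Defs.shift (mk_time (d1 - d2)) w).
rewrite (_ : (fun w => _) = fun w => g2 (at_time w d2) *
    (f3 (Defs.shift (mk_time d2) w) * f2 (Defs.shift (mk_time d2) w))); last first.
  apply/funext => w; rewrite /f3 at_time_shift// shift_shift// mk_timeK//.
  by rewrite [d2 + _]addrC subrK mulrCA !mulrA.
apply: (@fddS b d2 g2 (fun w => f3 w * f2 w)) => //; apply: IH2 => //.
- by rewrite lerD2r.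
- by rewrite opprB addrA subrK.
- by rewrite opprB addrA subrK.
Qed.

Lemma shift_measurable d : measurable_fun setT (Defs.shift (mk_time d) : bOmega -> bOmega).
Proof. exact: (theta_measurable hX (stopping_cst (mk_time d))). Qed.

Lemma set1_measurable (x : X) : @measurable _ (borel X) [set x].
Proof.
have [d [[d0 dxx dC dt] dm _]] := polish_metric hX.
rewrite -[X in measurable X]setCK; apply: measurableC; apply: open_borel.
rewrite openE => y /= yx; apply/dm; exists (d y x).
  by rewrite lt_def d0 andbT; apply/eqP => /dxx.
by move=> z /= h zx; move: h; rewrite zx ltxx.
Qed.

Lemma at_time_Cb r g : continuous g -> bounded_fun g -> Cb R X (fun w => g (at_time w r)).
Proof.
move=> cg bg; split.
  by move=> w; apply: (@continuous_comp Omega X R (at_time^~ r) g); [exact: evaluation_continuous|exact: cg].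
have [c c0 hc] := bounded_fun_bound bg; exists c; split; first exact: num_real.
by move=> y yc w _; apply: le_trans (hc _) (ltW yc).
Qed.

Lemma fdd_shift_Cb b f : fdd b f -> forall d, 0 <= d -> Cb R X (fun w => f (Defs.shift (mk_time d) w)).
Proof.
elim=> {b f} [b d d0|b d g f d0 db cg bg h IH e e0]; first exact: Cb_cst.
rewrite (_ : (fun w => _) = fun w => g (at_time w (e + d)) * f (Defs.shift (mk_time (e + d)) w)).
  by apply: CbM; [exact: at_time_Cb|apply: IH; exact: addr_ge0].
by apply/funext => w; rewrite at_time_shift// shift_shift// mk_timeK.
Qed.

Lemma fdd_Cb b f : fdd b f -> Cb R X f.
Proof.
by move=> /fdd_shift_Cb/(_ 0 (lexx _)); under eq_fun do rewrite shift_time0.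
Qed.

Lemma fdd_at b r g : 0 <= r -> r <= b -> continuous g -> bounded_fun g -> fdd b (fun w => g (at_time w r)).
Proof.
move=> r0 rb cg bg; rewrite (_ : (fun w => _) = fun w => g (at_time w r) * (fun=> 1) (Defs.shift (mk_time r) w)).
  by apply: (@fddS b r g (fun=> 1)) => //; exact: fdd1.
by apply/funext => w; rewrite mulr1.
Qed.

Lemma fdd_le b b' f : b <= b' -> fdd b f -> fdd b' f.
Proof.
move=> bb h; elim: h b' bb => {b f} [b|b d g f d0 db cg bg h IH] b' bb; first exact: fdd1.
by apply: fddS => //; [exact: le_trans bb|apply: IH; rewrite lerD2r].
Qed.

Lemma fdd_determining (H : set (bOmega -> R)) : bounded_class H ->
  (forall b f, fdd b f -> H f) -> forall f, bmf f -> H f.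
Proof.
move=> HH hH; pose M : set (bOmega -> R) := [set f | exists b, fdd b f].
apply: (@mclass_bmf _ _ _ H M HH).
- move=> f1 f2 [b1 h1] [b2 h2]; exists (Num.max b1 b2).
  by apply: fddM; [apply: fdd_le h1|apply: fdd_le h2]; rewrite le_max lexx ?orbT.
- by move=> f [b /fdd_Cb/bmf_Cb].
- by move=> f [b /hH].
- move=> S sS hS; apply: (Omega_coordinates hX sS) => r r0 U /(open_cozero hX)[g [cg g01 gU]].
  (* Generation is phrased with strict sublevel sets, so U = {g > 0} is written as {-g < 0}. *)
  have cN : continuous (fun x => - g x) by move=> x; apply: cvgN; exact: cg.
  have bN : bounded_fun (fun x => - g x).
    exists 1; split; first exact: num_real.
    by move=> y y1 x _ /=; have /andP[h1 h2] := g01 x; rewrite normrN ger0_norm //; lra.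
  have := hS _ 0 (ex_intro _ r (fdd_at (ltW r0) (lexx r) cN bN)).
  by congr S; apply/seteqP; split => w /=; rewrite oppr_lt0 => /gU.
Qed.

Lemma fdd_filtration_bmf (t : time R) f : fdd (time_val t) f -> bmf (f : Fsp t -> R).
Proof.
pose K d (u : Omega) := forall r, r <= d -> measurable_fun setT ((fun w => at_time w r) : Fsp t -> borel X).
suff : forall b f, fdd b f -> forall d, 0 <= d -> d + b <= time_val t ->
    bmf ((fun w => f (Defs.shift (mk_time d) w)) : Fsp t -> R).
  by move=> h /h/(_ 0 (lexx _)); rewrite add0r lexx => /(_ isT); under eq_fun do rewrite shift_time0.
move=> {f} b f; elim=> {b f} [b d _ _|b d g f d0 db cg bg h IH e e0 ebt]; first exact: bmf_cst.
rewrite (_ : (fun w => _) = fun w => g (at_time w (e + d)) * f (Defs.shift (mk_time (e + d)) w)); last first.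
  by apply/funext => w; rewrite at_time_shift// shift_shift// mk_timeK.
apply: bmfM; last first.
  by apply: IH; [exact: addr_ge0|rewrite addrA [e + d + b]addrAC addrK].
apply: (bmf_comp (continuous_bmf cg bg)); apply: filtration_at.
by apply: le_trans ebt; rewrite lerD2l.
Qed.

Lemma fdd_filtration_determining (t : time R) (H : set (Fsp t -> R)) : bounded_class H ->
  (forall f, fdd (time_val t) f -> H f) -> forall f, bmf f -> H f.
Proof.
move=> HH hH; apply: (@mclass_bmf _ _ _ H (fdd (time_val t) : set (Fsp t -> R)) HH).
- by move=> f1 f2; exact: fddM.
- by move=> f; exact: fdd_filtration_bmf.
- by move=> f /hH.
- move=> S sS hS; rewrite FspE; apply: smallest_sub => // _ [r rt [B mB <-]].
  rewrite setTI; move: B mB; apply: smallest_sub.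
    split.
    + by rewrite /= preimage_set0; case: sS.
    + move=> A SA; rewrite /= (_ : _ @^-1` _ = setT `\` eval_at r @^-1` A).
        by case: sS => _ + _; exact.
      by apply/seteqP; split.
    + move=> F SF; rewrite /= preimage_bigcup; case: sS => _ _; apply; exact: SF.
  move=> U /(open_cozero hX)[g [cg g01 gU]] /=.
  have cN : continuous (fun x => - g x) by move=> x; apply: cvgN; exact: cg.
  have bN : bounded_fun (fun x => - g x).
    exists 1; split; first exact: num_real.
    by move=> y y1 x _ /=; have /andP[h1 h2] := g01 x; rewrite normrN ger0_norm //; lra.
  have := hS _ 0 (fdd_at (time_val_ge0 r) rt cN bN).
  by congr S; apply/seteqP; split => w /=; rewrite oppr_lt0 eval_atE => /gU.
Qed.

End finite_dimensional.

(** * The Markov property at deterministic times *)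

Section almost_sure.
Context {R : realType} {X : ptopologicalType}.
Local Notation Omega := (cpath R X).
Local Notation law := (law R X).
Local Notation bOmega := (borel Omega).

Lemma le_mean_as (P : law) (A : set bOmega) (f g : bOmega -> R) : measurable A -> P A = 1%E ->
  bmf f -> bmf g -> (forall w, A w -> f w <= g w) -> mean P f <= mean P g.
Proof.
move=> mA PA bf bg fg; have [[_ [a fa]] [_ [b gb]]] := (bf, bg).
have mC : measurable (~` A) by exact: measurableC.
have bI : bmf (\1_(~` A) : bOmega -> R) by exact: bmf_indic.
have I0 : mean P (\1_(~` A)) = 0.
  apply: EFin_inj; rewrite mean_indic//.
  have := @probability_setC _ _ _ (P : probability bOmega R) _ mA => ->.
  by rewrite [X in (1 - X)%E]PA subee.
(* A penalty of mean zero, large enough to make the inequality hold at every path. *)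
have -> : mean P g = mean P (fun w => g w + (a + b) * \1_(~` A) w).
  by rewrite meanD// ?meanZ// ?I0 ?mulr0 ?addr0//; exact: bmfZ.
apply: le_mean => //; first by apply: bmfD => //; exact: bmfZ.
move=> w; rewrite indicE in_setC; have [/set_mem/fg h|_] := boolP (w \in A) => /=.
  by rewrite mulr0 addr0.
rewrite mulr1; have := fa w; have := gb w; rewrite !ler_norml => /andP[? ?] /andP[? ?]; lra.
Qed.

Lemma mean_as (P : law) (A : set bOmega) (f g : bOmega -> R) : measurable A -> P A = 1%E ->
  bmf f -> bmf g -> (forall w, A w -> f w = g w) -> mean P f = mean P g.
Proof.
move=> mA PA bf bg fg; apply/eqP; rewrite eq_le; apply/andP; split;
  by apply: (le_mean_as mA PA) => // w Aw; rewrite fg.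
Qed.

End almost_sure.

Section chain_upper.
Context {R : realType} {X : ptopologicalType} (hX : polish R X).
Local Notation Omega := (cpath R X).
Local Notation law := (law R X).
Variables (D : X -> set law) (fs : nat -> Omega -> R).
Hypotheses (gD : good D) (Cfs : forall k, Cb R X (fs k)).

(** If all stages stayed e above the limit, each would meet the closed set of laws with large mean
    of f, and so would their intersection. *)
Lemma cvg_upper_chain x f : Cb R X f ->
  upper (chain D fs n) x f @[n --> \oo] --> upper (chain_limit D fs) x f.
Proof.
move=> Cf; have gc n := good_chain n gD Cfs; have gl := good_chain_limit gD Cfs.
have lo n : upper (chain_limit D fs) x f <= upper (chain D fs n) x f.
  by apply: upper_sub => // P; exact.
apply/cvgrPdist_lt => e e0.
have [n hn] : exists n, upper (chain D fs n) x f < upper (chain_limit D fs) x f + e.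
  apply: contrapT => /forallNP h.
  have cF : closed [set P : law | upper (chain_limit D fs) x f + e <= mean P f].
    exact: closed_mean_ge.
  have [|P [DP hP]] := @chain_limit_meet _ _ D fs x _ gD Cfs cF.
    move=> n; have [P DP eP] := upper_attained (gc n) x Cf; exists P; split => //=.
    by rewrite eP leNgt; exact/negP.
  have := upper_ge gl Cf DP; rewrite /= in hP; lra.
near=> m; have nm : (n <= m)%N by near: m; exact: nbhs_infty_ge.
have := upper_sub (gc n) (gc m) Cf (chain_sub (fs := fs) (D := D) (x := x) nm); have := lo m.
move=> h1 h2; rewrite ler0_norm ?subr_le0//; lra.
Unshelve. all: by end_near.
Qed.

End chain_upper.

Section markov.
Context {R : realType} {X : ptopologicalType} (hX : polish R X).
Variables (Phi : set (X -> R)) (hPhi : separating_family Phi).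
Variables (Lambda : set R) (hLambda : dense_rates Lambda).
Variables (lambda : nat -> R) (phi : nat -> X -> R).
Variable henum : range (fun n => (lambda n, phi n)) = Lambda `*` Phi.
Variables (C : X -> set (law R X)) (hC : strong_krylov lambda phi C).
Local Notation Omega := (cpath R X).
Local Notation law := (law R X).
Local Notation bOmega := (borel Omega).
Local Notation Fn := (Fn lambda phi).
Local Notation Doo := (chain_limit C Fn).
Implicit Types (P Q M : law) (D : X -> set law) (n m : nat).

Let CFn := Fn_Cb hPhi hLambda henum.
Let gC := good_C hC.
Let gn n := good_chain n gC CFn.
Let goo := good_chain_limit gC CFn.

Lemma start_at_measurable (x : X) : @measurable _ bOmega (start_at x).
Proof.
have mx := set1_measurable hX x.
have := @at_time_measurable R X 0 measurableT _ mx; rewrite setTI.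
by congr measurable; apply/seteqP; split.
Qed.

Lemma mean_start x P (g : borel X -> R) (f : bOmega -> R) : C x P -> bmf g -> bmf f ->
  mean P (fun w => g (at_time w 0) * f w) = g x * mean P f.
Proof.
move=> CP bg bf; rewrite -meanZ//.
apply: (mean_as (start_at_measurable x) (krylov_C3 hC CP)).
- by apply: bmfM => //; apply: (bmf_comp bg); exact: at_time_measurable.
- exact: bmfZ.
- by move=> w /= wx; rewrite /at_time wx.
Qed.

Lemma KPin_limit x P t : 0 < t -> Doo x P -> KPin (det t) Doo P.
Proof.
move=> t0 DP f Cf; have st := @det_stopping R X t.
have [c c0 hc] := bounded_fun_bound Cf.2.
have cv : mean P (fun w => upper (chain C Fn n) (eval_tau (det t) w) f) @[n --> \oo] -->
    mean P (fun w => upper Doo (eval_tau (det t) w) f).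
  apply: (cvg_mean (M := c)).
  - by move=> n; exact: (upper_eval_bmf hX st (gn n) Cf).
  - by move=> n w; exact: (upper_bound (gn n)).
  - by move=> w; exact: cvg_upper_chain.
rewrite -(cvg_lim _ cv)//; apply: limr_ge; first by apply/cvg_ex; eexists; exact: cv.
apply: nearW => n; have [h _] := det_chain hX hPhi hLambda henum hC t0 (DP n I).
exact: h.
Qed.

Lemma Fn_enum l p : Lambda l -> Phi p -> exists n, Fpath l p = Fn n.
Proof.
move=> Ll Pp; have : (Lambda `*` Phi) (l, p) by split.
by rewrite -henum => -[n _ [<- <-]]; exists n.
Qed.

(** Induction on the number of times. Let h be the functional seen from its first time d. By (C3)
    and the induction hypothesis all laws of [Doo y] give h the same mean, so (KP1) for h and for -h
    turns into an equality and only the marginal at time d remains. That marginal is determined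
    because the laws of [Doo x] share the means of all F_n. *)
Lemma Doo_fdd b f : fdd b f -> forall x P Q, Doo x P -> Doo x Q -> mean P f = mean Q f.
Proof.
elim=> {b f} [b|b d g f d0 db cg bg hf IH] x P Q DP DQ; first by rewrite !mean_cst.
have Cf := fdd_Cb hf; have bf := bmf_Cb Cf; have bgb := continuous_bmf cg bg.
have DC y M : Doo y M -> C y M by move=> /(_ 0%N I).
(* (KP1) concerns positive times; at d = 0 the factor g is a constant by (C3). *)
have [{}d0|dn0] := ltP 0 d; last first.
  have {d0 dn0}-> : d = 0 by apply/eqP; rewrite eq_le d0 dn0.
  have -> : (fun w => g (at_time w 0) * f (Defs.shift (mk_time 0) w)) = fun w => g (at_time w 0) * f w.
    by apply/funext => w; rewrite shift_time0.
  by rewrite (mean_start (DC _ _ DP) bgb bf) (mean_start (DC _ _ DQ) bgb bf) (IH x P Q).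
pose h w := g (at_time w 0) * f w.
have Ch : Cb R X h by apply: CbM => //; exact: at_time_Cb.
have mh y M : Doo y M -> mean M h = g y * mean M f by move=> /DC DM; exact: (mean_start DM bgb bf).
have uN y : upper Doo y (fun w => - h w) = - upper Doo y h.
  have [M1 D1 <-] := upper_attained goo y (CbN Ch); have [M2 D2 <-] := upper_attained goo y Ch.
  by rewrite meanN ?(mh y M1)// ?(mh y M2)// ?(IH y M1 M2)//; exact: bmf_Cb.
pose psi (y : borel X) := upper Doo y h.
have bpsi : bmf psi by exact: upper_bmf.
have st := @det_stopping R X d.
have bth : bmf ((fun w => h (theta (det d) w)) : bOmega -> R) by exact: (theta_bmf hX st (bmf_Cb Ch)).
have bps : bmf ((fun w => psi (at_time w d)) : bOmega -> R).
  by apply: (bmf_comp bpsi); exact: at_time_measurable.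
have eh : (fun w => g (at_time w d) * f (Defs.shift (mk_time d) w)) = fun w => h (theta (det d) w).
  by apply/funext => w; rewrite /h theta_det at_time_shift// mk_timeK ?addr0// ltW.
have eq1 M : Doo x M -> mean M (fun w => h (theta (det d) w)) = mean M (fun w => psi (at_time w d)).
  move=> DM; have KM := KPin_limit d0 DM.
  apply/eqP; rewrite eq_le; apply/andP; split; first exact: (KM _ Ch).
  rewrite -lerN2 -(meanN M bth) -(meanN M bps).
  apply: le_trans (KM _ (CbN Ch)) _.
  have -> : (fun w => upper Doo (eval_tau (det d) w) (fun w => - h w)) = fun w => - psi (at_time w d).
    by apply/funext => w; rewrite uN.
  exact: lexx.
rewrite eh (eq1 P)// (eq1 Q)//.
apply: (nice_one_dim hPhi hLambda (nice_mean P) (nice_mean Q)) => //.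
  by rewrite !mean_cst.
move=> l p Ll Pp; have [n ->] := Fn_enum Ll Pp.
by rewrite (argmaxE (gn n) (CFn n) (DP n.+1 I)) (argmaxE (gn n) (CFn n) (DQ n.+1 I)).
Qed.

Lemma Doo_unique x P Q : Doo x P -> Doo x Q -> same_measure P Q.
Proof.
move=> DP DQ; apply: (law_ext hX) => f /bmf_Cb bf.
have e1 : mean P (fun=> 1) = mean Q (fun=> 1) by rewrite !mean_cst.
have HH := eq_functional_class (bounded_linear_mean P) (bounded_linear_mean Q) e1.
have [|//] := fdd_determining hX HH _ bf.
by move=> b g hg; split; [exact/bmf_Cb/(fdd_Cb hg)|exact: Doo_fdd hg _ _ _ DP DQ].
Qed.

Section selection.
Variable S : X -> law.
Hypothesis SD : forall x, Doo x (S x).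

Let SC x : C x (S x). Proof. exact: (SD x (i := 0%N) I). Qed.

Lemma S_bmf (f : bOmega -> R) : bmf f -> bmf ((fun x => mean (S x) f) : borel X -> R).
Proof. by move=> bf; apply: (selection_bmf hX goo) => // x P Q; exact: Doo_unique. Qed.

Lemma S_at_bmf t (f : bOmega -> R) : bmf f -> bmf ((fun w => mean (S (at_time w t)) f) : bOmega -> R).
Proof. by move=> bf; apply: (bmf_comp (S_bmf bf)); exact: at_time_measurable. Qed.

Lemma upperS x f : Cb R X f -> upper Doo x f = mean (S x) f.
Proof.
move=> Cf; have [P DP <-] := upper_attained goo x Cf.
exact: (same_mean (Doo_unique DP (SD x)) (bmf_Cb Cf)).
Qed.

Lemma shift_bmf t (f : bOmega -> R) : bmf f -> bmf ((fun w => f (Defs.shift (mk_time t) w)) : bOmega -> R).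
Proof. by move=> bf; apply: (bmf_comp bf); exact: shift_measurable. Qed.

(** For single-valued [Doo] the supremum in (KP1) is the mean under S, so testing f and -f gives
    equality. *)
Lemma simple_markov x t (f : bOmega -> R) : 0 <= t -> bmf f ->
  mean (S x) (fun w => f (Defs.shift (mk_time t) w)) = mean (S x) (fun w => mean (S (at_time w t)) f).
Proof.
rewrite le_eqVlt => /predU1P[<- bf|t0 bf].
  have e : (fun w => f (Defs.shift (mk_time 0) w)) = f by apply/funext => w; rewrite shift_time0.
  rewrite e; have := mean_start (SC x) (S_bmf bf) (bmf_cst bOmega 1).
  rewrite mean_cst mulr1 => <-.
  by congr mean; apply/funext => w; rewrite mulr1.
move: f bf; apply: (eq_functionals_Cb hX).
- exact: (bounded_linear_comp (shift_measurable hX t) (bounded_linear_mean (S x))).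
- have := bounded_linear_kernel (S x) (bmf_cst bOmega 1) (S_at_bmf t).
  by congr bounded_linear; apply/funext => f; congr mean; apply/funext => w; rewrite mul1r.
- move=> f Cf; have KS := KPin_limit t0 (SD x); have bf := bmf_Cb Cf.
  have eu h : Cb R X h -> (fun w => upper Doo (eval_tau (det t) w) h) = fun w => mean (S (at_time w t)) h.
    by move=> Ch; apply/funext => w; rewrite upperS.
  apply/eqP; rewrite eq_le; apply/andP; split.
    by have := KS _ Cf; rewrite (eu _ Cf).
  rewrite -lerN2 -(meanN _ (shift_bmf t bf)) -(meanN _ (S_at_bmf t bf)).
  have := KS _ (CbN Cf); rewrite (eu _ (CbN Cf)) => h; apply: le_trans h _.
  have -> : (fun w => mean (S (at_time w t)) (fun w => - f w)) = fun w => - mean (S (at_time w t)) f.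
    by apply/funext => w; rewrite meanN.
  exact: lexx.
Qed.

(** The simple property at the first time d rewrites both sides as means under S from w(d), where
    the induction hypothesis with t - d identifies them. *)
Lemma markov_fdd b G : fdd b G -> forall t x (f : bOmega -> R), b <= t -> 0 <= t -> bmf f ->
  mean (S x) (fun w => G w * f (Defs.shift (mk_time t) w)) =
  mean (S x) (fun w => G w * mean (S (at_time w t)) f).
Proof.
elim=> {b G} [b|b d g G d0 db cg bg hG IH] t x f bt t0 bf.
  have := simple_markov x t0 bf => h.
  have -> : (fun w => 1 * f (Defs.shift (mk_time t) w)) = fun w => f (Defs.shift (mk_time t) w).
    by apply/funext => w; rewrite mul1r.
  by rewrite h; congr mean; apply/funext => w; rewrite mul1r.
have bG := bmf_Cb (fdd_Cb hG); have bgb := continuous_bmf cg bg.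
have e0 : 0 <= t - d by rewrite subr_ge0 (le_trans db).
pose A1 w := G w * f (Defs.shift (mk_time (t - d)) w).
pose A2 w := G w * mean (S (at_time w (t - d))) f.
have b1 : bmf (A1 : bOmega -> R) by apply: bmfM => //; exact: shift_bmf.
have b2 : bmf (A2 : bOmega -> R) by apply: bmfM => //; exact: S_at_bmf.
have b0 A : bmf (A : bOmega -> R) -> bmf ((fun w => g (at_time w 0) * A w) : bOmega -> R).
  by move=> bA; apply: bmfM => //; apply: (bmf_comp bgb); exact: at_time_measurable.
have key (A B : bOmega -> R) : bmf A -> (forall w, B w = g (at_time w d) * A (Defs.shift (mk_time d) w)) ->
    mean (S x) B = mean (S x) (fun w => g (at_time w d) * mean (S (at_time w d)) A).
  move=> bA hB; have -> : B = fun w => (fun w => g (at_time w 0) * A w) (Defs.shift (mk_time d) w).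
    by apply/funext => w; rewrite hB at_time_shift// mk_timeK// addr0.
  rewrite (simple_markov x d0 (b0 _ bA)); congr mean; apply/funext => w.
  exact: (mean_start (SC _) bgb bA).
transitivity (mean (S x) (fun w => g (at_time w d) * mean (S (at_time w d)) A1)).
  by apply: (key A1) => // w; rewrite /A1 shift_shift// [d + _]addrC subrK mulrA.
transitivity (mean (S x) (fun w => g (at_time w d) * mean (S (at_time w d)) A2)); last first.
  by apply/esym/(key A2) => // w; rewrite /A2 at_time_shift// mk_timeK// [d + _]addrC subrK mulrA.
congr mean; apply/funext => w; congr (_ * _); apply: IH => //.
by rewrite lerD2r.
Qed.

Lemma conditional_markov t x (G f : bOmega -> R) : 0 <= t -> bmf (G : Fsp (mk_time t) -> R) -> bmf f ->
  mean (S x) (fun w => G w * f (Defs.shift (mk_time t) w)) =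
  mean (S x) (fun w => G w * mean (S (at_time w t)) f).
Proof.
move=> t0 bG bf.
have mid : measurable_fun setT (id : bOmega -> Fsp (mk_time t)).
  by move=> _ B mB; rewrite setTI; apply: (@filtration_borel _ _ (mk_time t)); move: mB; rewrite FspE.
pose L (u : bOmega -> R) (G : bOmega -> R) := mean (S x) (fun w => u w * G w).
have lL u : bmf u -> bounded_linear (L u : (Fsp (mk_time t) -> R) -> R).
  by move=> bu; exact: (bounded_linear_comp mid (bounded_linear_weight (S x) bu)).
have b1 := shift_bmf t bf; have b2 := S_at_bmf t bf.
have e u : mean (S x) (fun w => G w * u w) = L u G.
  by congr mean; apply/funext => w; rewrite mulrC.
rewrite !e.
have e1 : L (fun w => f (Defs.shift (mk_time t) w)) (fun=> 1) = L (fun w => mean (S (at_time w t)) f) (fun=> 1).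
  have := markov_fdd (fdd1 0) x t0 t0 bf; rewrite /L.
  have m1 u : (fun w : bOmega => 1 * u w) = (fun w => u w * 1 :> R) by apply/funext => w; rewrite mulrC.
  by rewrite !m1.
have HH := eq_functional_class (lL _ b1) (lL _ b2) e1.
have [|//] := fdd_filtration_determining hX HH _ bG.
move=> h hh; split; first exact: fdd_filtration_bmf.
have := markov_fdd hh x (f := f) (t := t); rewrite mk_timeK// => /(_ (lexx _) t0 bf).
have m1 u : (fun w : bOmega => h w * u w) = (fun w => u w * h w :> R) by apply/funext => w; rewrite mulrC.
by rewrite !m1.
Qed.

End selection.
End markov.

(** * Concatenation of paths and disintegration *)

Section concatenation.
Context {R : realType} {X : ptopologicalType} (hX : polish R X).
Local Notation Omega := (cpath R X).
Local Notation bOmega := (borel Omega).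
Implicit Types (w : Omega) (s r : R).

Definition cat_fun s w w' (t : time R) : X :=
  if time_val t <= s then at_time w (time_val t) else at_time w' (time_val t - s).

Lemma cat_fun_continuous s w w' : at_time w' 0 = at_time w s -> continuous (cat_fun s w w').
Proof.
move=> ww'; have ca : continuous (fun t : time R => at_time w (time_val t)).
  move=> t; apply: (@continuous_comp _ _ _ time_val (at_time w)); first exact: time_val_continuous.
  exact: at_time_continuous.
have cb : continuous (fun t : time R => at_time w' (time_val t - s)).
  move=> t; apply: (@continuous_comp _ _ _ (fun t => time_val t - s) (at_time w')).
    by apply: (@cvgB R R^o _ (nbhs t) _ time_val (fun=> s)); [exact: time_val_continuous|exact: cvg_cst].
  exact: at_time_continuous.
move=> t A hA; suff : nbhs t [set u | A (cat_fun s w w' u)] by [].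
move: hA; rewrite {1}/cat_fun; have [ts|st|e] := ltgtP (time_val t) s => hA.
- have us : nbhs t [set u | time_val u < s] := @time_val_continuous R t _ (lt_nbhsl ts).
  apply: (filterS _ (filterI us (ca t A hA))) => u [/= u1 u2].
  by rewrite /cat_fun ltW.
- have us : nbhs t [set u | s < time_val u] := @time_val_continuous R t _ (lt_nbhsr st).
  apply: (filterS _ (filterI us (cb t A hA))) => u [/= u1 u2].
  by rewrite /cat_fun leNgt u1.
- rewrite e in hA.
  have h1 : nbhs t [set u | A (at_time w (time_val u))] by apply: (ca t A); rewrite e.
  have h2 : nbhs t [set u | A (at_time w' (time_val u - s))] by apply: (cb t A); rewrite e subrr ww'.
  apply: (filterS _ (filterI h1 h2)) => u [/= u1 u2].
  by rewrite /cat_fun; case: ifP.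
Qed.

(* The path w up to time s, followed by w'; it is w itself when the two do not
   match, a null event for w' under S_{w(s)}. *)
Definition splice s w w' : Omega :=
  if pselect (at_time w' 0 = at_time w s) is left e then mkcts (cat_fun_continuous e) else w.

Lemma at_time_cat s w w' r : at_time w' 0 = at_time w s -> 0 <= r ->
  at_time (splice s w w') r = if r <= s then at_time w r else at_time w' (r - s).
Proof.
move=> e r0; rewrite /splice; case: pselect => // e'.
rewrite (_ : at_time _ r = cat_fun s w w' (mk_time r)); last by [].
by rewrite /cat_fun mk_timeK.
Qed.

Lemma cat_incompatible s w w' : at_time w' 0 <> at_time w s -> splice s w w' = w.
Proof. by rewrite /splice; case: pselect. Qed.

Lemma cat_before s w w' r : 0 <= r -> r <= s -> at_time (splice s w w') r = at_time w r.
Proof.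
move=> r0 rs; have [e|/cat_incompatible -> //] := pselect (at_time w' 0 = at_time w s).
by rewrite at_time_cat// rs.
Qed.

Lemma cat_after s w w' r : at_time w' 0 = at_time w s -> 0 <= s -> 0 <= r ->
  at_time (splice s w w') (s + r) = at_time w' r.
Proof.
move=> e s0 r0; rewrite at_time_cat ?addr_ge0//.
case: ifPn => [|_]; last by rewrite addrC addKr.
rewrite gerDl => r0'; have -> : r = 0 by apply/eqP; rewrite eq_le r0' r0.
by rewrite addr0 e.
Qed.

Lemma shift_cat s w w' : at_time w' 0 = at_time w s -> 0 <= s ->
  Defs.shift (mk_time s) (splice s w w') = w'.
Proof.
by move=> e s0; apply: path_ext => r r0; rewrite at_time_shift// mk_timeK// cat_after.
Qed.

(** With the past w fixed, an event known at s + t becomes an event of the new path known at t; thus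
    the time left until tau will be a stopping time of the new path. *)
Lemma cat_filtration s w (t : time R) : 0 <= s ->
  measurable_fun setT (splice s w : Fsp t -> Fsp (mk_time (s + time_val t)) ).
Proof.
move=> s0; have st0 : 0 <= s + time_val t by rewrite addr_ge0 ?time_val_ge0.
apply: (@measurability _ _ (Fsp t) (Fsp (mk_time (s + time_val t))) setT _
  (filtration (mk_time (s + time_val t)))) => //.
move=> _ [A FA <-]; rewrite setTI; move: A FA.
suff : filtration (mk_time (s + time_val t)) `<=` [set A | @measurable _ (Fsp t) (splice s w @^-1` A)] by [].
apply: smallest_sub.
  split => [|A mA|F mF] /=.
  - by rewrite preimage_set0.
  - by rewrite setTD preimage_setC; exact: measurableC.
  - by rewrite preimage_bigcup; apply: bigcup_measurable => i _; exact: mF.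
move=> _ [r rt [B mB <-]]; rewrite setTI /=.
have {}rt : time_val r <= s + time_val t by move: rt; rewrite /= mk_timeK.
have mst : @measurable _ (Fsp t) [set w' | at_time w' 0 = at_time w s].
  rewrite FspE; exact: (filtration_coord (time_val_ge0 t) (set1_measurable hX (at_time w s))).
have [rs|sr] := leP (time_val r) s.
  rewrite (_ : _ @^-1` _ = [set w' | B (at_time w (time_val r))]).
    have [Bw|Bw] := pselect (B (at_time w (time_val r))).
      by rewrite (_ : [set _ | _] = setT); [exact: measurableT|apply/seteqP; split].
    by rewrite (_ : [set _ | _] = set0); [exact: measurable0|apply/seteqP; split].
  by apply/seteqP; split => w' /=; rewrite eval_atE cat_before// time_val_ge0.
rewrite (_ : _ @^-1` _ =
    ([set w' | at_time w' 0 = at_time w s] `&` [set w' | B (at_time w' (time_val r - s))]) `|`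
    (~` [set w' | at_time w' 0 = at_time w s] `&` [set w' | B (at_time w (time_val r))])).
  apply: measurableU; apply: measurableI => //.
  - by rewrite FspE; apply: filtration_coord => //; rewrite lerBlDl.
  - by apply: measurableC.
  - have [Bw|Bw] := pselect (B (at_time w (time_val r))).
      by rewrite (_ : [set _ | _] = setT); [exact: measurableT|apply/seteqP; split].
    by rewrite (_ : [set _ | _] = set0); [exact: measurable0|apply/seteqP; split].
have e w' : at_time w' 0 = at_time w s -> at_time (splice s w w') (time_val r) = at_time w' (time_val r - s).
  by move=> h; rewrite at_time_cat ?time_val_ge0// leNgt sr.
apply/seteqP; split => w' /=; rewrite eval_atE.
  have [h|h] := pselect (at_time w' 0 = at_time w s); first by rewrite e// => ?; left.
  by rewrite cat_incompatible// => ?; right.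
by move=> [[h hB]|[h hB]]; [rewrite e|rewrite cat_incompatible].
Qed.

Lemma cat_measurable s w : 0 <= s -> measurable_fun setT (splice s w : bOmega -> bOmega).
Proof.
move=> s0; apply: (measurable_to_Omega hX) => r r0 _ B mB; rewrite setTI.
apply: (@filtration_borel _ _ (mk_time r)); rewrite -FspE.
have mA : @measurable _ (Fsp (mk_time (s + time_val (mk_time r)))) [set w' | B (at_time w' r)].
  rewrite FspE; apply: filtration_coord => //.
  by rewrite (mk_timeK (ltW r0)) mk_timeK; lra.
by have := @cat_filtration s w (mk_time r) s0 measurableT _ mA; rewrite setTI.
Qed.

(** [galmarino] applied to the event that G takes the value G(w). *)
Lemma Fsp_cat s w w' d (Y : measurableType d) (G : Omega -> Y) : 0 <= s ->
  (forall y : Y, measurable [set y]) -> measurable_fun setT (G : Fsp (mk_time s) -> Y) ->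
  G (splice s w w') = G w.
Proof.
move=> s0 m1 mG; have := mG measurableT _ (m1 (G w)); rewrite setTI FspE => h.
have := galmarino (w := w) (w' := splice s w w') h; apply => //.
by move=> r /andP[r0]; rewrite mk_timeK// => rs; rewrite cat_before.
Qed.

End concatenation.

Section disintegration.
Context {R : realType} {X : ptopologicalType} (hX : polish R X).
Variables (lambda : nat -> R) (phi : nat -> X -> R).
Variables (C : X -> set (law R X)) (hC : strong_krylov lambda phi C).
Local Notation Omega := (cpath R X).
Local Notation law := (law R X).
Local Notation bOmega := (borel Omega).
Variables (S : X -> law) (SC : forall x, C x (S x)).
Hypothesis S_bmf : forall f : bOmega -> R, bmf f -> bmf ((fun x => mean (S x) f) : borel X -> R).
Hypothesis S_markov : forall t x (G f : bOmega -> R), 0 <= t ->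
  bmf (G : Fsp (mk_time t) -> R) -> bmf f ->
  mean (S x) (fun w => G w * f (Defs.shift (mk_time t) w)) =
  mean (S x) (fun w => G w * mean (S (at_time w t)) f).

Lemma Fsp_bmf (t : time R) (G : bOmega -> R) : bmf (G : Fsp t -> R) -> bmf G.
Proof.
move=> [mG bG]; split => // _ B mB; have := mG measurableT B mB; rewrite FspE setTI.
exact: filtration_borel.
Qed.

(* The conditional expectation of Psi given F_s. *)
Definition after s (Psi : bOmega -> R) w := mean (S (at_time w s)) (fun w' => Psi (splice s w w')).

Lemma after_split s (G f : bOmega -> R) w : 0 <= s -> bmf (G : Fsp (mk_time s) -> R) -> bmf f ->
  after s (fun w => G w * f (Defs.shift (mk_time s) w)) w = G w * mean (S (at_time w s)) f.
Proof.
move=> s0 bG bf; rewrite -meanZ//; set y := at_time w s.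
apply: (mean_as (start_at_measurable hX y) (krylov_C3 hC (SC y))).
- apply: (bmf_comp (bmfM (Fsp_bmf bG) (bmf_comp bf (shift_measurable hX s)))).
  exact: cat_measurable.
- exact: bmfZ.
- move=> w' yw'; rewrite shift_cat// (@Fsp_cat _ _ s w w' _ _ G)//.
  by case: bG.
Qed.

(** For a product of an F_s-measurable function and a function of the path after s, this is the
    Markov property. Such products are stable under multiplication and generate the Borel sets. *)
Lemma disintegration s (G Psi : bOmega -> R) : 0 <= s -> bmf (G : Fsp (mk_time s) -> R) -> bmf Psi ->
  bmf (after s Psi : bOmega -> R) /\
  forall x, mean (S x) (fun w => G w * Psi w) = mean (S x) (fun w => G w * after s Psi w).
Proof.
move=> s0 bG bPsi; have bG' := Fsp_bmf bG.
pose H : set (bOmega -> R) := [set Psi | bmf Psi /\ bmf (after s Psi : bOmega -> R) /\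
  forall x, mean (S x) (fun w => G w * Psi w) = mean (S x) (fun w => G w * after s Psi w)].
have bcat (f : bOmega -> R) w : bmf f -> bmf ((fun w' => f (splice s w w')) : bOmega -> R).
  by move=> bf; apply: (bmf_comp bf); exact: cat_measurable.
have HH : bounded_class H.
  split.
  - have e : after s (cst 1) = fun=> 1 by apply/funext => w; exact: mean_cst.
    by split; [exact: bmf_cst|rewrite e; split; [exact: bmf_cst|]].
  - move=> a f g [bf [baf ef]] [bg [bag eg]].
    have e : after s (fun x => a * f x + g x) = fun w => a * after s f w + after s g w.
      apply/funext => w; rewrite /after meanD ?meanZ//; first exact: bcat.
        exact/bmfZ/bcat.
      exact: bcat.
    split; first by apply: bmfD => //; exact: bmfZ.
    rewrite e; split; first by apply: bmfD => //; exact: bmfZ.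
    move=> x; have d (u v : bOmega -> R) : bmf u -> bmf v ->
        mean (S x) (fun w => G w * (a * u w + v w)) =
        a * mean (S x) (fun w => G w * u w) + mean (S x) (fun w => G w * v w).
      by have [l _] := bounded_linear_weight (S x) bG' => bu bv; exact: l.
    by rewrite !d// ef eg.
  - move=> f_ f M hf fM ff; have bf_ n : bmf (f_ n) by case: (hf n).
    have ba_ n : bmf (after s (f_ n) : bOmega -> R) by case: (hf n) => _ [].
    have aM n (w : bOmega) : `|after s (f_ n) w| <= M.
      by apply: mean_norm_le; [have [] := bcat _ w (bf_ n)|move=> w'; exact: fM].
    have acv (w : bOmega) : after s (f_ n) w @[n --> \oo] --> after s f w.
      by apply: (cvg_mean (M := M)) => [n|n w'|w']; [exact: bcat|exact: fM|exact: ff].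
    split; first by apply: (bmf_lim _ fM ff) => n; case: (bf_ n).
    split; first by apply: (bmf_lim _ aM acv) => n; case: (ba_ n).
    move=> x; have [_ cl] := bounded_linear_weight (S x) bG'.
    have h1 := cl _ _ _ bf_ fM ff; have h2 := cl _ _ _ ba_ aM acv.
    have e : (fun n => mean (S x) (fun w => G w * f_ n w)) =
        (fun n => mean (S x) (fun w => G w * after s (f_ n) w)).
      by apply/funext => n; case: (hf n) => _ [_ ->].
    by rewrite e in h1; exact: (cvg_unique _ h1 h2).
suff [_ //] : H Psi.
pose M : set (bOmega -> R) := [set Psi | exists2 u : bOmega -> R, bmf (u : Fsp (mk_time s) -> R) &
  exists2 f : bOmega -> R, bmf f & Psi = fun w => u w * f (Defs.shift (mk_time s) w)].
apply: (@mclass_bmf _ _ _ H M HH _ _ _ _ _ bPsi).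
- move=> _ _ [u bu [f bf ->]] [v bv [g bg ->]].
  exists (fun w => u w * v w); first exact: bmfM.
  exists (fun w => f w * g w); first exact: bmfM.
  by apply/funext => w; rewrite mulrACA.
- move=> _ [u bu [f bf ->]]; apply: bmfM; first exact: Fsp_bmf bu.
  by apply: (bmf_comp bf); exact: shift_measurable.
- move=> _ [u bu [f bf ->]]; have bfs := bmf_comp bf (shift_measurable hX s).
  have e : after s (fun w => u w * f (Defs.shift (mk_time s) w)) = fun w => u w * mean (S (at_time w s)) f.
    by apply/funext => w; exact: after_split.
  split; first by apply: bmfM => //; exact: Fsp_bmf bu.
  rewrite e; split.
    apply: bmfM; first exact: Fsp_bmf bu.
    by apply: (bmf_comp (S_bmf bf)); exact: at_time_measurable.
  move=> x; have := S_markov x s0 (bmfM bG bu) bf.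
  have r (h : bOmega -> R) : (fun w => G w * (u w * h w)) = fun w => G w * u w * h w.
    by apply/funext => w; rewrite mulrA.
  by rewrite !r.
- move=> A sA hA; apply: (Omega_coordinates hX sA) => r r0 U /(open_cozero hX)[g [cg g01 gU]].
  have cN : continuous (fun x => - g x) by move=> x; apply: cvgN; exact: cg.
  have bN : bounded_fun (fun x => - g x).
    exists 1; split; first exact: num_real.
    by move=> y y1 x _ /=; have /andP[h1 h2] := g01 x; rewrite normrN ger0_norm //; lra.
  suff : A [set w | - g (at_time w r) < 0].
    by congr A; apply/seteqP; split => w /=; rewrite oppr_lt0 => /gU.
  (* A coordinate up to time s is taken as the past factor, a later one as the future factor. *)
  apply: hA; have [rs|sr] := leP r s.
    exists (fun w => - g (at_time w r)).
      apply: (bmf_comp (continuous_bmf cN bN)); apply: filtration_at.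
      by rewrite mk_timeK.
    by exists (fun=> 1); [exact: bmf_cst|apply/funext => w; rewrite mulr1].
  exists (fun=> 1); first exact: bmf_cst.
  exists (fun w => - g (at_time w (r - s))); first exact: (continuous_at_time_bmf (r - s) cN bN).
  apply/funext => w; rewrite mul1r at_time_shift ?subr_ge0 ?(ltW sr)// mk_timeK//.
  by rewrite addrC subrK.
Qed.

End disintegration.

(** * Announcing a stopping time *)

Section small_sets.
Context {R : realType} {X : ptopologicalType}.
Local Notation Omega := (cpath R X).
Local Notation bOmega := (borel Omega).
Variable P : law R X.

(** Dominated convergence for indicators that are eventually 0 at every path; the sets need not
    decrease. *)
Lemma small_set (E : nat -> set bOmega) : (forall n, measurable (E n)) ->
  (forall w, exists N, forall n, (N <= n)%N -> ~ E n w) ->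
  forall dl : R, 0 < dl -> exists n, (P (E n) <= dl%:E)%E.
Proof.
move=> mE hE dl dl0.
have bE n : bmf (\1_(E n) : bOmega -> R) by exact: bmf_indic.
have cv : mean P (\1_(E n)) @[n --> \oo] --> mean P (fun=> 0).
  apply: (cvg_mean (M := 1)) => //.
    by move=> n w; rewrite indicE normr_nat lern1; case: (_ \in _).
  move=> w; apply: cvg_near_cst; have [N hN] := hE w; exists N => // n /= Nn.
  by rewrite indicE memNset//; exact: hN.
rewrite mean_cst in cv; have /cvgrPdist_le/(_ _ dl0)[N _ hN] := cv.
exists N; rewrite -mean_indic// lee_fin.
by have := hN N (leqnn N); rewrite sub0r normrN; apply: le_trans; exact: ler_norm.
Qed.

End small_sets.

Section predictable.
Context {R : realType} {X : ptopologicalType} (hX : polish R X).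
Local Notation Omega := (cpath R X).
Local Notation bOmega := (borel Omega).
Variable P : law R X.
Variables (tau : Omega -> time R) (st : stopping_time tau) (pt : positive_time tau).
Local Notation T w := (time_val (tau w)).
Implicit Types (z : R -> bOmega -> R) (t : R) (w : Omega) (G : set (R * Omega)).

(* Closed predictable sets are the zero sets of such processes. *)
Definition adapted01 z := [/\ forall t, measurable_fun setT (z t : Fsp (mk_time t) -> R),
  forall w, continuous (z^~ w) & forall t w, 0 <= z t w <= 1].

Lemma adapted_borel z t : adapted01 z -> measurable_fun setT (z t).
Proof.
move=> [mz _ _] _ B mB; have := mz t measurableT B mB; rewrite FspE setTI.
exact: filtration_borel.
Qed.

Lemma adapted_at_tau z : adapted01 z -> measurable_fun setT (fun w : bOmega => z (T w) w).
Proof.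
move=> az; have [_ cz _] := az; apply: (@diag_measurable _ _ _ z) => //.
  by move=> t; exact: adapted_borel.
exact: (stopping_measurable st).
Qed.

Lemma adapted_cst (c : R) : 0 <= c <= 1 -> adapted01 (fun _ _ => c).
Proof. by move=> c01; split => // w t; exact: cvg_cst. Qed.

Lemma adaptedM z1 z2 : adapted01 z1 -> adapted01 z2 -> adapted01 (fun t w => z1 t w * z2 t w).
Proof.
move=> [m1 c1 b1] [m2 c2 b2]; split.
- by move=> t; apply: measurable_funM.
- by move=> w t; apply: cvgM; [exact: c1|exact: c2].
- by move=> t w; have /andP[? ?] := b1 t w; have /andP[? ?] := b2 t w; apply/andP; split; nra.
Qed.

Lemma adapted_prod (z_ : nat -> R -> bOmega -> R) n : (forall i, adapted01 (z_ i)) ->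
  adapted01 (fun t w => \prod_(i < n) z_ i t w).
Proof.
move=> az; elim: n => [|n IH].
  by under eq_fun do under eq_fun do rewrite big_ord0; apply: adapted_cst; rewrite ler01 lexx.
by under eq_fun do under eq_fun do rewrite big_ord_recr; exact: adaptedM.
Qed.

(** The series with weights 2^-(i+1) converges uniformly, hence keeps continuity in t, stays in
    [0, 1], and has the intersection of the zero sets as its zero set. *)
Lemma adapted_series (z_ : nat -> R -> bOmega -> R) : (forall i, adapted01 (z_ i)) ->
  exists2 z, adapted01 z & forall t w, z t w = 0 <-> forall i, z_ i t w = 0.
Proof.
move=> az; pose s n t w := \sum_(i < n) 2^-1 ^+ i.+1 * z_ i t w.
have h0 n : 0 <= (2^-1 : R) ^+ n by rewrite exprn_ge0// invr_ge0.
have z01 i t w : 0 <= z_ i t w <= 1 by have [_ _] := az i.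
have step n t w : s n.+1 t w = s n t w + 2^-1 ^+ n.+1 * z_ n t w by rewrite /s big_ord_recr.
(* The partial sum plus 2^-n decreases in n, which yields the uniform bound 2^-n on the tail. *)
have up n t w : s n.+1 t w + 2^-1 ^+ n.+1 <= s n t w + 2^-1 ^+ n.
  rewrite step -addrA lerD2l; have /andP[_ z1] := z01 n t w.
  have := h0 n.+1; rewrite !exprS => h; nra.
have dn n t w : s n t w <= s n.+1 t w.
  by rewrite step lerDl mulr_ge0//; have /andP[] := z01 n t w.
have tail n k t w : s n t w <= s (n + k)%N t w /\ s (n + k)%N t w + 2^-1 ^+ (n + k) <= s n t w + 2^-1 ^+ n.
  elim: k => [|k [IH1 IH2]]; first by rewrite addn0.
  by rewrite addnS; split; [exact: le_trans IH1 (dn _ _ _)|exact: le_trans (up _ _ _) IH2].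
have s0 t w : s 0%N t w = 0 by rewrite /s big_ord0.
have scv t w : cvgn (fun n => s n t w).
  apply: nondecreasing_is_cvgn; first by apply/nondecreasing_seqP => n; exact: dn.
  exists 1 => _ [n _ <-]; have [_] := tail 0%N n t w; rewrite add0n s0 expr0 add0r.
  by have := h0 n; lra.
pose z t w := limn (fun n => s n t w).
have zt n t w : s n t w <= z t w /\ z t w <= s n t w + 2^-1 ^+ n.
  split; [apply: limr_ge|apply: limr_le] => //; near=> m;
  have nm : (n <= m)%N by near: m; exact: nbhs_infty_ge.
    by have [] := tail n (m - n)%N t w; rewrite subnKC.
  by have [_] := tail n (m - n)%N t w; rewrite subnKC//; have := h0 m; lra.
have z00 t w : 0 <= z t w by have [] := zt 0%N t w; rewrite s0.
have cs n w : continuous (fun t => s n t w).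
  elim: n => [|n IH].
    by rewrite (_ : (fun t => _) = fun=> 0); [exact: cst_continuous|apply/funext => t; rewrite s0].
  rewrite (_ : (fun t => _) = fun t => s n t w + 2^-1 ^+ n.+1 * z_ n t w); last by apply/funext => t; rewrite step.
  move=> t; apply: cvgD; first exact: IH.
  by apply: cvgM; [exact: cvg_cst|have [_ c _] := az n; exact: c].
exists z; first split.
- move=> t; have bs n : bmf (s n t : Fsp (mk_time t) -> R).
    apply: bmf_sum => i; apply: bmfZ; have [m _ b] := az i; split; first exact: m.
    by exists 1 => w; have /andP[? ?] := b t w; rewrite ger0_norm.
  suff [] : bmf (z t : Fsp (mk_time t) -> R) by [].
  apply: (@bmf_lim _ _ _ (fun n => s n t : Fsp (mk_time t) -> R) _ 1).
  + by move=> n; case: (bs n).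
  + move=> n w; have [a b] := tail 0%N n t w; rewrite add0n s0 expr0 add0r in a b.
    by rewrite ger0_norm//; have := h0 n; lra.
  + by move=> w; exact: scv.
- move=> w t; apply/cvgrPdist_le => e e0.
  have [n hn] : exists n, (2^-1 : R) ^+ n < e / 4.
    have : (2^-1 : R) ^+ n @[n --> \oo] --> 0 by apply: cvg_expr; rewrite ger0_norm//; lra.
    have e4 : 0 < e / 4 by lra.
    by move=> /cvgrPdist_lt/(_ _ e4)[N _ /(_ N (leqnn N))]; rewrite sub0r normrN ger0_norm//; exists N.
  have e4 : 0 < e / 4 by lra.
  have /cvgrPdist_le/(_ _ e4) := cs n w t; apply: filterS => u.
  have [a1 a2] := zt n t w; have [b1 b2] := zt n u w.
  rewrite !ler_norml => /andP[h1 h2]; apply/andP; split; lra.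
- move=> t w; rewrite z00 /=; have [_] := zt 0%N t w; rewrite s0 expr0; lra.
- move=> t w; split=> [zz i|h]; last first.
    rewrite /z (_ : (fun n => _) = fun=> 0) ?lim_cst//.
    by apply/funext => n; rewrite /s big1// => i _; rewrite h mulr0.
  have [a _] := zt i.+1 t w.
  have [b _] := tail 0%N i t w; rewrite add0n s0 in b; rewrite step zz in a.
  have /andP[c _] := z01 i t w; have := mulr_ge0 (h0 i.+1) c => d.
  have : 2^-1 ^+ i.+1 * z_ i t w = 0 by lra.
  move=> /eqP; rewrite mulf_eq0 expf_eq0/= invr_eq0 (@pnatr_eq0 R 2) => /eqP //.
Unshelve. all: by end_near.
Qed.

(** Approximation from inside by a closed predictable set, the error being measured along tau
    only. *)
Definition inner G := forall dl : R, 0 < dl -> exists z, [/\ adapted01 z,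
  forall t w, z t w = 0 -> G (t, w) &
  (P [set w : bOmega | G (T w, w) /\ z (T w) w <> 0%R] <= dl%:E)%E].

(* Regularity of the law of (tau, w), for closed predictable sets: the sets
   satisfying it form a sigma-algebra which contains the graph of tau. *)
Definition regular_set G := [/\ @measurable _ bOmega [set w | G (T w, w)], inner G & inner (~` G)].

Lemma measurable_nonzero G z : @measurable _ bOmega [set w | G (T w, w)] -> adapted01 z ->
  @measurable _ bOmega [set w | G (T w, w) /\ z (T w) w <> 0].
Proof.
move=> mG az; apply: measurableI => //.
have := adapted_at_tau az measurableT (measurableC (measurable_set1 0)).
by rewrite setTI.
Qed.

Lemma regularC G : regular_set G -> regular_set (~` G).
Proof.
move=> [mG iG iC]; split => //; last by rewrite setCK.
rewrite (_ : [set w | _] = ~` [set w | G (T w, w)])//; exact: measurableC.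
Qed.

(** The zero sets are intersected by [adapted_series], with error dl / 2^(i+1) for the i-th set. *)
Lemma inner_cap (F : nat -> set (R * Omega)) : (forall i, regular_set (F i)) ->
  inner (\bigcap_i F i).
Proof.
move=> rF dl dl0.
have hi i : exists z, [/\ adapted01 z, forall t w, z t w = 0 -> F i (t, w) &
    (P [set w : bOmega | F i (T w, w) /\ z (T w) w <> 0%R] <= (dl / (2 ^ i.+1)%:R)%:E)%E].
  by have [_ iF _] := rF i; apply: iF; rewrite divr_gt0// ltr0n expn_gt0.
have [z_ hz] := choice hi.
have [z az zz] := adapted_series (fun i => let: And3 a _ _ := hz i in a).
exists z; split => //.
  by move=> t w /zz h i _; have [_ zF _] := hz i; exact: zF.
have mb i : @measurable _ bOmega [set w | F i (T w, w) /\ z_ i (T w) w <> 0].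
  by apply: measurable_nonzero; [have [] := rF i|have [] := hz i].
have mF : @measurable _ bOmega [set w | (\bigcap_i F i) (T w, w)].
  rewrite (_ : [set w | _] = \bigcap_i [set w | F i (T w, w)]).
    by apply: bigcap_measurable => // i _; have [] := rF i.
  by apply/seteqP; split => w h i; exact: h.
have sub : [set w : bOmega | (\bigcap_i F i) (T w, w) /\ z (T w) w <> 0] `<=`
    \bigcup_i [set w | F i (T w, w) /\ z_ i (T w) w <> 0].
  move=> w [hF zn]; apply: contrapT => h; apply: zn; apply/zz => i.
  by apply: contrapT => zi; apply: h; exists i => //; split => //; exact: hF.
apply: (le_trans (measure_sigma_subadditive (P : probability bOmega R) mb (measurable_nonzero mF az) sub)).
apply: le_trans (epsilon_trick0 _ (ltW dl0)).
by apply: lee_nneseries => // i _; have [] := hz i.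
Qed.

(** Unions of zero sets are zero sets of products, hence finite: half of dl pays for truncating the
    union, half for the approximations. *)
Lemma inner_cup (F : nat -> set (R * Omega)) : (forall i, regular_set (F i)) ->
  inner (\bigcup_i F i).
Proof.
move=> rF dl dl0; have dl2 : 0 < dl / 2 by lra.
pose V i : set bOmega := [set w | F i (T w, w)].
have mV i : measurable (V i) by have [] := rF i.
have mU n : measurable (\bigcup_(i < n) V i) by exact: bigcup_measurable.
have mV' : measurable (\bigcup_i V i) by exact: bigcup_measurable.
have [|w|n hn] := @small_set _ _ P (fun n => \bigcup_i V i `\` \bigcup_(i < n) V i) _ _ _ dl2.
- by move=> n; exact: measurableD.
- have [[i _ Vi]|h] := pselect ((\bigcup_i V i) w); last by exists 0%N => n _ [].
  by exists i.+1 => n ni [_]; apply; exists i.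
have hi i : exists z, [/\ adapted01 z, forall t w, z t w = 0 -> F i (t, w) &
    (P [set w : bOmega | F i (T w, w) /\ z (T w) w <> 0%R] <= (dl / 2 / (2 ^ i.+1)%:R)%:E)%E].
  by have [_ iF _] := rF i; apply: iF; rewrite divr_gt0// ltr0n expn_gt0.
have [z_ hz] := choice hi.
have az i : adapted01 (z_ i) by have [] := hz i.
pose z t (w : bOmega) := \prod_(i < n) z_ i t w.
have aZ : adapted01 z by exact: adapted_prod.
exists z; split => //.
  move=> t w /eqP; rewrite /z prodf_seq_eq0 => /hasP[i _ /= /eqP zi].
  by exists (nat_of_ord i) => //; have [_ + _] := hz i; apply.
pose B i : set bOmega := [set w | F i (T w, w) /\ z_ i (T w) w <> 0].
have mB i : measurable (B i) by exact: (@measurable_nonzero (F i) (z_ i) (mV i) (az i)).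
have mW : @measurable _ bOmega [set w | (\bigcup_i F i) (T w, w)].
  by rewrite (_ : [set w | _] = \bigcup_i V i).
have sub : [set w : bOmega | (\bigcup_i F i) (T w, w) /\ z (T w) w <> 0] `<=`
    (\bigcup_i V i `\` \bigcup_(i < n) V i) `|` \bigcup_i B i.
  move=> w [hF zn]; have [[i /= ni Vi]|h] := pselect ((\bigcup_(i < n) V i) w); last by left.
  right; exists i => //; split => // zi.
  apply: zn; apply/eqP; rewrite /z prodf_seq_eq0; apply/hasP; exists (Ordinal ni); rewrite ?mem_index_enum//=.
  exact/eqP.
pose pr := (P : probability bOmega R).
have mBU : measurable (\bigcup_i B i) by apply: bigcup_measurable => i _; exact: mB.
have hB : (pr (\bigcup_i B i) <= (dl / 2)%:E)%E.
  apply: (le_trans (measure_sigma_subadditive pr mB mBU (@subset_refl _ _))).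
  apply: le_trans (epsilon_trick0 _ (ltW dl2)).
  by apply: lee_nneseries => // i _; have [] := hz i.
apply: (@le_trans _ _ (pr ((\bigcup_i V i `\` \bigcup_(i < n) V i) `|` \bigcup_i B i))).
  apply: le_measure; rewrite ?inE//; first exact: measurable_nonzero.
  by apply: measurableU => //; exact: measurableD.
apply: le_trans (measureU2 _ _ _) _ => //; first exact: measurableD.
by rewrite [dl]splitr EFinD; apply: leeD.
Qed.

Lemma regular_sigma : sigma_algebra setT regular_set.
Proof.
split.
- split.
  + by rewrite (_ : [set w | _] = set0)//; apply/seteqP; split.
  + move=> dl dl0; exists (fun _ _ => 1); split.
    * by apply: adapted_cst; rewrite ler01 lexx.
    * by move=> t w /eqP; rewrite oner_eq0.
    * by rewrite (_ : [set w | _] = set0) ?measure0 ?lee_fin ?ltW//; apply/seteqP; split => w [].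
  + move=> dl dl0; exists (fun _ _ => 0); split.
    * by apply: adapted_cst; rewrite ler01 lexx.
    * by move=> t w _ [].
    * by rewrite (_ : [set w | _] = set0) ?measure0 ?lee_fin ?ltW//; apply/seteqP; split => w [].
- by move=> A rA; rewrite setTD; exact: regularC.
- move=> F rF; split.
  + rewrite (_ : [set w | _] = \bigcup_i [set w | F i (T w, w)])//.
    by apply: bigcup_measurable => i _; have [] := rF i.
  + exact: inner_cup.
  + by rewrite setC_bigcup; apply: inner_cap => i; exact: regularC.
Qed.

Lemma regular_zero z : adapted01 z -> regular_set [set p | z p.1 p.2 = 0].
Proof.
move=> az; have mz : @measurable _ bOmega [set w | z (T w) w = 0].
  by have := adapted_at_tau az measurableT (measurable_set1 0); rewrite setTI.
split => //.
  move=> dl dl0; exists z; split => //.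
  by rewrite (_ : [set w | _] = set0) ?measure0 ?lee_fin ?ltW//; apply/seteqP; split => w [].
move=> dl dl0; have [m c b] := az.
(* Its zero set is the closed set n z >= 1; these exhaust the complement of the zero set of z. *)
pose y n t (w : bOmega) := Num.max 0 (1 - n%:R * z t w).
have ay n : adapted01 (y n).
  split.
  - by move=> t; apply: measurable_maxr => //; apply: measurable_funB => //; apply: measurable_funM.
  - move=> w t.
    suff : {for t, continuous (fun t => Num.max 0 (1 - n%:R * z t w))} by [].
    apply: continuous_max; first exact: cvg_cst.
    by apply: cvgB; [exact: cvg_cst|apply: cvgM; [exact: cvg_cst|exact: c]].
  - move=> t w; rewrite le_max lexx/= ge_max ler01/= gerBl mulr_ge0//.
    by have /andP[] := b t w.
have mE n : @measurable _ bOmega [set w | (~` [set p | z p.1 p.2 = 0]) (T w, w) /\ y n (T w) w <> 0].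
  by apply: measurable_nonzero => //; rewrite (_ : [set w | _] = ~` [set w | z (T w) w = 0])//; exact: measurableC.
have [w|n hn] := @small_set _ _ P _ mE _ dl dl0; last first.
  exists (y n); split => // t w /= yn zn; move: yn; rewrite /y zn mulr0 subr0.
  by rewrite max_r// => /eqP; rewrite oner_eq0.
have [z0|z0] := pselect (z (T w) w = 0); first by exists 0%N => n _ [].
have zp : 0 < z (T w) w by rewrite lt_def; have /andP[-> _] := b (T w) w; rewrite andbT; apply/eqP.
exists (Num.truncn (z (T w) w)^-1).+1 => n hn [_]; apply; rewrite /y max_l//.
rewrite subr_le0 -ler_pdivrMr// mul1r; apply/ltW/(lt_le_trans (truncnS_gt _)).
by rewrite ler_nat.
Qed.

Definition Wreg : measurableType _ := g_sigma_algebraType regular_set.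

Lemma WregE : @measurable _ Wreg = regular_set.
Proof. by rewrite /measurable /= sigma_algebra_id//; exact: regular_sigma. Qed.

Lemma stop_subproof (s : R) w : continuous (fun t : time R => at_time w (Num.min (time_val t) s)).
Proof.
move=> t; apply: (@continuous_comp _ _ _ (fun t : time R => Num.min (time_val t) s) (at_time w)).
  apply: (@continuous_min R _ time_val (fun=> s)); first exact: time_val_continuous.
  exact: cst_continuous.
exact: at_time_continuous.
Qed.

(* By Galmarino's test tau(w) = t iff tau(stop_path t w) = t, which makes the
   graph of tau predictable. *)
Definition stop_path (s : R) w : Omega := mkcts (@stop_subproof s w).

Lemma at_time_stop s w r : 0 <= r -> at_time (stop_path s w) r = at_time w (Num.min r s).
Proof.
move=> r0; rewrite (_ : at_time _ r = at_time w (Num.min (time_val (mk_time r)) s)); last by [].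
by rewrite mk_timeK.
Qed.

Lemma stop_regular (V : set Omega) : @measurable _ bOmega V -> regular_set [set p | V (stop_path p.1 p.2)].
Proof.
move: V; suff : @measurable _ bOmega `<=` [set V | @measurable _ Wreg [set p | V (stop_path p.1 p.2)]].
  by rewrite WregE.
apply: (Omega_coordinates hX).
  split => [|A mA|F mF] /=.
  - by rewrite (_ : [set p | _] = set0); [exact: measurable0|apply/seteqP; split].
  - rewrite (_ : [set p | _] = ~` [set p | A (stop_path p.1 p.2)]); first exact: measurableC.
    by apply/seteqP; split => p /=; [move=> []|].
  - rewrite (_ : [set p | _] = \bigcup_i [set p | F i (stop_path p.1 p.2)]).
      by apply: bigcup_measurable => i _; exact: mF.
    by apply/seteqP; split.
move=> r r0 U /(open_cozero hX)[g [cg g01 gU]] /=.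
(* The path stopped at t has position w(min(r, t)) at time r, which is adapted and continuous in t;
   hence the preimage is the complement of a zero set. *)
pose z t (w : bOmega) := g (at_time w (Num.min r t)).
have az : adapted01 z.
  split.
  - move=> t; have [h _] := continuous_bmf cg (range01_bounded g01).
    apply: (measurableT_comp h); apply: filtration_at.
    by rewrite /time_val set_valE /= ge_min !le_max !lexx !orbT.
  - move=> w t; apply: (@continuous_comp _ _ _ (fun t => Num.min r t) (fun t => g (at_time w t))).
      by apply: (@continuous_min R _ (fun=> r) id); [exact: cst_continuous|exact: cvg_id].
    exact: along_path_continuous.
  - by move=> t w; exact: g01.
rewrite WregE; have /regularC := regular_zero az; congr regular_set.
have e t w : at_time (stop_path t w) r = at_time w (Num.min r t) := at_time_stop t w (ltW r0).
apply/seteqP; split => -[t w] h.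
  suff : U (at_time (stop_path t w) r) by [].
  rewrite e; apply/gU; rewrite lt_def; have /andP[-> _] := g01 (at_time w (Num.min r t)).
  by rewrite andbT; apply/eqP.
have : U (at_time (stop_path t w) r) by [].
by rewrite e => /gU; rewrite -/(z t w) => + h0; rewrite h0 ltxx.
Qed.

Lemma stopping_agree w w' (t : R) : 0 <= t -> (forall r, 0 <= r <= t -> at_time w r = at_time w' r) ->
  T w = t -> T w' = t.
Proof.
move=> t0 ag Tw; have le s : 0 <= s -> s <= t -> (T w <= s -> T w' <= s) /\ (T w' <= s -> T w <= s).
  move=> s0 s1; have h := @stopping_le _ _ _ st s; split.
    by apply: (galmarino h) => r /andP[r0]; rewrite mk_timeK// => rs; apply: ag; rewrite r0 (le_trans rs).
  by apply: (galmarino h) => r /andP[r0]; rewrite mk_timeK// => rs; apply/esym/ag; rewrite r0 (le_trans rs).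
have [h1 _] := le t t0 (lexx t); have {}h1 : T w' <= t by apply: h1; rewrite Tw.
have [_ h2] := le _ (time_val_ge0 (tau w')) h1.
by apply/eqP; rewrite eq_le h1 -{1}Tw h2.
Qed.

(** Regularity applied to the graph of tau, written through stopped paths: z vanishes at time t only
    if tau = t, and does vanish at tau outside a set of small probability. *)
Lemma predictable dl : 0 < dl -> exists z, [/\ adapted01 z,
  forall t w, 0 <= t -> z t w = 0 -> T w = t &
  (P [set w : bOmega | z (T w) w <> 0%R] <= dl%:E)%E].
Proof.
move=> dl0.
pose A (q : rat) : set Wreg := [set p | T (stop_path p.1 p.2) <= ratr q].
pose B (q : rat) : set Wreg := [set p | p.1 <= ratr q].
have mA q : measurable (A q).
  rewrite WregE; apply: (stop_regular (V := [set w | T w <= ratr q])).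
  by apply: (@filtration_borel _ _ (mk_time (ratr q))); exact: stopping_le.
have mB q : measurable (B q).
  rewrite WregE; pose z t (w : bOmega) := Num.min 1 (Num.max 0 (t - ratr q)).
  have az : adapted01 z.
    split.
    - by move=> t; exact: measurable_cst.
    - move=> w t.
      suff : {for t, continuous (fun t => Num.min 1 (Num.max 0 (t - ratr q)))} by [].
      apply: continuous_min; first exact: cvg_cst.
      apply: continuous_max; first exact: cvg_cst.
      by apply: cvgB; [exact: cvg_id|exact: cvg_cst].
    - by move=> t w; rewrite le_min ler01 le_max lexx ge_min lexx.
  have := regular_zero az; congr regular_set; apply/seteqP; split => -[t w] /=.
    move=> z0; suff : t <= ratr q by [].
    rewrite leNgt; apply/negP => h.
    have : 0 < Num.min 1 (Num.max 0 (t - ratr q)).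
      by rewrite lt_min ltr01 lt_max subr_gt0 h orbT.
    by have -> : Num.min 1 (Num.max 0 (t - ratr q)) = 0; [exact: z0|rewrite ltxx].
  move=> h; suff : Num.min 1 (Num.max 0 (t - ratr q)) = 0 by [].
  by rewrite max_l ?subr_le0// min_r.
(* Equality of t and of tau on the stopped path: no rational separates them. *)
pose E : set Wreg := \bigcap_(q in [set: rat]) ((A q `&` B q) `|` (~` A q `&` ~` B q)).
have mE : measurable E.
  apply: countable_bigcap_measurable => q; apply: measurableU; apply: measurableI => //;
  exact: measurableC.
have EE t w : E (t, w) -> T (stop_path t w) = t.
  move=> h; apply/eqP; rewrite eq_le; apply/andP; split; rewrite leNgt; apply/negP => lt.
    have [q] := rat_in_itvoo lt; rewrite in_itv/= => /andP[q1 q2].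
    by have [[+ _]|[_ +]] := h q I; rewrite /A /B /=; lra.
  have [q] := rat_in_itvoo lt; rewrite in_itv/= => /andP[q1 q2].
  by have [[_ +]|[+ _]] := h q I; rewrite /A /B /=; lra.
have ag t w r : 0 <= t -> 0 <= r <= t -> at_time (stop_path t w) r = at_time w r.
  by move=> t0 /andP[r0 rt]; rewrite at_time_stop// min_l.
have ET w : E (T w, w).
  have e : T (stop_path (T w) w) = T w.
    by apply: (@stopping_agree w _ (T w)) => [|r h|//]; [exact: time_val_ge0|rewrite ag// time_val_ge0].
  move=> q _; have [h|h] := leP (T w) (ratr q); [left|right]; split; rewrite /A /B /= ?e//;
  by apply/negP; rewrite -ltNge.
move: (mE); rewrite WregE => -[_ iE _]; have [z [az zE zP]] := iE dl dl0.
exists z; split => //.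
  move=> t w t0 /zE/EE h; apply: (@stopping_agree (stop_path t w)) => // r rt.
  exact: ag.
by apply: le_trans zP; rewrite (_ : [set w | z _ _ <> _] = [set w | E (T w, w) /\ z (T w) w <> 0]);
  [|apply/seteqP; split => w /=; [move=> h; split => //; exact: ET|case]].
Qed.

Lemma grid_before (y ep : R) : 0 < ep -> ep < y -> exists k : nat,
  [/\ (0 < k)%N, k%:R * ep < y & y <= k%:R * ep + ep].
Proof.
move=> ep0 epy; have hex : exists j : nat, y <= j%:R * ep.
  exists (Num.truncn (y / ep)).+1; rewrite -ler_pdivrMr//; exact/ltW/truncnS_gt.
have [j yj jm] := ex_minnP hex; case: j yj jm => [|k] yj jm.
  by rewrite mul0r in yj; lra.
exists k; split.
- by rewrite lt0n; apply: contraTneq yj => ->; rewrite mul1r -ltNge.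
- by rewrite ltNge; apply/negP => /jm; rewrite ltnn.
- by move: yj; rewrite -natr1 mulrDl mul1r.
Qed.

(** The announcement is z <= c on a grid. The level c is small enough to exclude alarms earlier than
    tau - eta, then the mesh is fine enough for an alarm before tau, then K is large enough to reach
    it. These three exceptional events and the failure of z to vanish at tau each get dl / 4. *)
Lemma announced (eta dl : R) : 0 < eta -> 0 < dl ->
  exists (ep : R) (K : nat) (p : nat -> set Omega) (H : set bOmega),
  [/\ 0 < ep, forall k, filtration (mk_time (k%:R * ep)) (p k), measurable H, (P H <= dl%:E)%E &
    forall w, ~ H w -> exists k, [/\ (0 < k <= K)%N, p k w,
        forall j, (0 < j < k)%N -> ~ p j w, k%:R * ep < T w & T w < k%:R * ep + eta]].
Proof.
move=> eta0 dl0; have d4 : 0 < dl / 4 by lra.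
have [z [az zT zb]] := predictable d4; have [mz cz z01] := az.
have mzt (t : R) := @adapted_borel z t az.
have mT := stopping_measurable st.
have mZ : @measurable _ bOmega [set w | z (T w) w = 0].
  by have := adapted_at_tau az measurableT (measurable_set1 0); rewrite setTI.
have mle (f : bOmega -> R) (c : R) : measurable_fun setT f -> @measurable _ bOmega [set w | f w <= c].
  move=> mf; have := mf measurableT _ (measurable_itv `]-oo, c]); rewrite setTI.
  by congr measurable; apply/seteqP; split => w /=; rewrite in_itv.
have mgt (f : bOmega -> R) (c : R) : measurable_fun setT f -> @measurable _ bOmega [set w | c < f w].
  move=> mf; rewrite (_ : [set w | _] = ~` [set w | f w <= c]); first by apply: measurableC; exact: (mle f c mf).
  by apply/seteqP; split => w /=; rewrite ltNge => /negP.
(* False alarms at least eta before tau. They cease for large n, since z has a positive minimum on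
   [0, tau - eta]; rational times keep the event measurable. *)
pose E n : set bOmega := [set w | z (T w) w = 0] `&`
  \bigcup_(q in [set q : rat | 0 <= ratr q :> R])
    ([set w | ratr q + eta <= T w] `&` [set w | z (ratr q) w <= n.+1%:R^-1]).
have mE n : measurable (E n).
  apply: measurableI => //; rewrite bigcup_mkcond; apply: countable_bigcupT_measurable => [|q].
    exact: countableP.
  case: ifP => // _; apply: measurableI; last exact: mle.
  rewrite (_ : [set w | _] = ~` [set w | T w < ratr q + eta]).
    apply: measurableC; have := mT measurableT _ (measurable_itv `]-oo, ratr q + eta[); rewrite setTI.
    by congr measurable; apply/seteqP; split => w /=; rewrite in_itv.
  by apply/seteqP; split => w /=; rewrite leNgt => /negP.
have [w|n hn] := small_set P mE _ d4.
  have [z0|z0] := pselect (z (T w) w = 0); last by exists 0%N => n _ [].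
  have [Te|Te] := ltP (T w) eta.
    by exists 0%N => n _ [_ [q /= q0 [/= h _]]]; lra.
  have e0 : 0 <= T w - eta by rewrite subr_ge0.
  have [|c cI hc] := @EVT_min R (z^~ w) 0 (T w - eta) e0.
    by apply: continuous_subspaceT; exact: cz.
  move: cI; rewrite in_itv/= => /andP[c0 c1].
  have zc : 0 < z c w.
    rewrite lt_def; have /andP[-> _] := z01 c w; rewrite andbT.
    by apply/eqP => /(zT _ _ c0) h; rewrite h in c1; lra.
  exists (Num.truncn (z c w)^-1) => n Nn [_ [q /= q0 [/= h1 h2]]].
  have /hc h3 : ratr q \in `[0, T w - eta] by rewrite in_itv/= q0; lra.
  have : (z c w)^-1 < n.+1%:R.
    by apply: (lt_le_trans (truncnS_gt _)); rewrite ler_nat.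
  rewrite -[X in _ < X]invrK ltf_pV2 ?posrE ?invr_gt0 ?ltr0n// => h4.
  by have := le_lt_trans (le_trans h3 h2) h4; rewrite ltxx.
pose c : R := n.+1%:R^-1; have c0 : 0 < c by rewrite invr_gt0.
pose ep m : R := m.+1%:R^-1; have ep0 m : 0 < ep m by rewrite invr_gt0.
pose p m k : set bOmega := [set w | z (k%:R * ep m) w <= c].
(* No alarm at a positive grid time before tau: excluded for a fine mesh, since z is continuous and
   vanishes at tau. *)
pose F m : set bOmega := [set w | z (T w) w = 0] `&`
  \bigcap_(k in [set k | (0 < k)%N]) ~` ([set w | k%:R * ep m < T w] `&` p m k).
have mF m : measurable (F m).
  apply: measurableI => //; apply: bigcap_measurable => [|k _]; first by exists 1%N.
  by apply: measurableC; apply: measurableI; [exact: mgt|exact: mle].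
have [w|m hm] := small_set P mF _ d4.
  have [z0|z0] := pselect (z (T w) w = 0); last by exists 0%N => m _ [].
  have /cvgrPdist_lt/(_ _ c0)/nbhs_ballP[rho /= rho0 hr] := cz w (T w).
  have T0 := pt w; have mn : 0 < Num.min rho (T w) by rewrite lt_min rho0.
  exists (Num.truncn (Num.min rho (T w))^-1) => m Nm [_ hF].
  have : (Num.min rho (T w))^-1 < m.+1%:R.
    by apply: (lt_le_trans (truncnS_gt _)); rewrite ler_nat.
  rewrite -[X in _ < X]invrK ltf_pV2 ?posrE ?invr_gt0 ?ltr0n// -/(ep m) lt_min => /andP[h1 h2].
  have [k [k0 k1 k2]] := grid_before (ep0 m) h2.
  apply: (hF k k0); split => //=.
  have /hr : ball (T w) rho (k%:R * ep m) by rewrite /ball/= ltr_norml; apply/andP; split; lra.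
  by rewrite z0 sub0r normrN => h3; apply: ltW; apply: le_lt_trans h3; exact: ler_norm.
pose L K : set bOmega := [set w | K%:R * ep m < T w].
have mL K : measurable (L K) by exact: mgt.
have [w|K hK] := small_set P mL _ d4.
  exists (Num.truncn (T w / ep m)).+1 => K NK /=; apply/negP; rewrite -leNgt -ler_pdivrMr//.
  by apply: ltW; apply: (lt_le_trans (truncnS_gt _)); rewrite ler_nat.
pose B0 : set bOmega := [set w | z (T w) w <> 0].
have mB0 : measurable B0 by exact: measurableC.
pose pr := (P : probability bOmega R).
have mU1 : measurable (B0 `|` E n) by exact: measurableU.
have mU2 : measurable (F m `|` L K) by exact: measurableU.
exists (ep m), K, (p m), ((B0 `|` E n) `|` (F m `|` L K)); split => //.
- move=> k; have := mz (k%:R * ep m) measurableT _ (measurable_itv `]-oo, c]); rewrite setTI FspE.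
  by congr filtration; apply/seteqP; split => w /=; rewrite in_itv.
- exact: measurableU.
- apply: le_trans (measureU2 pr mU1 mU2) _.
  have -> : dl%:E = ((dl / 4 + dl / 4)%:E + (dl / 4 + dl / 4)%:E)%E by rewrite -EFinD; congr EFin; lra.
  apply: leeD.
    by apply: le_trans (measureU2 pr mB0 (mE n)) _; rewrite EFinD; apply: leeD.
  by apply: le_trans (measureU2 pr (mF m) (mL K)) _; rewrite EFinD; apply: leeD.
move=> w nb.
have z0 : z (T w) w = 0 by apply: contrapT => h; apply: nb; left; left.
have nE : ~ E n w by move=> h; apply: nb; left; right.
have nF : ~ F m w by move=> h; apply: nb; right; left.
have TK : T w <= K%:R * ep m by rewrite leNgt; apply/negP => h; apply: nb; right; right.
have [k [k0 k1 k2]] : exists k, [/\ (0 < k)%N, k%:R * ep m < T w & p m k w].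
  apply: contrapT => h; apply: nF; split => // k k0 [k1 k2]; apply: h.
  by exists k.
have hex : exists j, (0 < j)%N && `[< p m j w >] by exists k; rewrite k0; apply/asboolP.
have [j /andP[j0 /asboolP pj] jm] := ex_minnP hex.
have jk : (j <= k)%N by apply: jm; rewrite k0; apply/asboolP.
have jT : j%:R * ep m < T w by apply: le_lt_trans k1; rewrite ler_wpM2r ?ler_nat// ltW.
exists j; split => //.
- rewrite j0 -(ler_nat R) -(ler_pM2r (ep0 m)); apply: le_trans TK.
  exact: ltW.
- by move=> i /andP[i0 ij] pi; have := jm i; rewrite i0 leqNgt ij/= => h; have := h (asboolT pi).
(* Grid times are rational, so an alarm that is too early would put w in [E n]. *)
- rewrite ltNge; apply/negP => h; apply: nE; split => //.
  have qE : ratr (j%:R * m.+1%:R^-1) = j%:R * ep m :> R.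
    by rewrite rmorphM/= fmorphV/= !ratr_nat.
  exists (j%:R * m.+1%:R^-1) => /=; first by rewrite qE mulr_ge0// ltW.
  by split; rewrite /= qE.
Qed.

End predictable.

(** * The discounted payoff at a stopping time *)

Section cone.
Context {R : realType} {X : ptopologicalType} (hX : polish R X).
Variables (Phi : set (X -> R)) (hPhi : separating_family Phi).
Variables (Lambda : set R) (hLambda : dense_rates Lambda).
Variables (lambda : nat -> R) (phi : nat -> X -> R).
Variable henum : range (fun n => (lambda n, phi n)) = Lambda `*` Phi.
Variables (C : X -> set (law R X)) (hC : strong_krylov lambda phi C).
Local Notation Omega := (cpath R X).
Local Notation law := (law R X).
Local Notation bOmega := (borel Omega).
Local Notation Fn := (Fn lambda phi).
Local Notation Zn := (Zn lambda phi).
Local Notation Doo := (chain_limit C Fn).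
Variables (S : X -> law) (SD : forall x, Doo x (S x)).
Variable N : nat.
Implicit Types (a : nat -> R) (w : Omega) (r s t : R).

Let l0 n : 0 < lambda n := lambda_gt0 hLambda henum n.
Let cphi n : continuous (phi n) := @phi_continuous _ _ _ hPhi _ _ _ henum n.
Let bphi n : bounded_fun (phi n) := phi_bounded hPhi henum n.
Let CFn := Fn_Cb hPhi hLambda henum.
Let bFn := Fn_bmf hPhi hLambda henum.
Let gC := good_C hC.
Let SC x : C x (S x). Proof. exact: (SD x (i := 0%N) I). Qed.
Let Sb (f : bOmega -> R) : bmf f -> bmf ((fun x => mean (S x) f) : borel X -> R).
Proof. exact: (S_bmf hX hPhi hLambda henum hC SD). Qed.
Let cond t x (G f : bOmega -> R) : 0 <= t -> bmf (G : Fsp (mk_time t) -> R) -> bmf f ->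
  mean (S x) (fun w => G w * f (Defs.shift (mk_time t) w)) =
  mean (S x) (fun w => G w * mean (S (at_time w t)) f).
Proof. by move=> t0 bG bf; exact: (conditional_markov hX hPhi hLambda henum hC SD x t0 bG bf). Qed.

(* For nonnegative weights a: f = FF a, its integral up to t is ZZ a t, its
   value under the selection is VV a, and dec a t holds the weights discounted
   to time t.  JJ a is the supermartingale. *)
Definition FF a w := \sum_(m < N) a m * Fn m w.
Definition ZZ a t w := \sum_(m < N) a m * Zn m t w.
Definition VV a y := mean (S y) (FF a).
Definition dec a t m := a m * expR (- (lambda m * t)).
Definition JJ a s w := ZZ a s w + upper C (at_time w s) (FF (dec a s)).

Lemma FF_Cb a : Cb R X (FF a).
Proof. by apply: Cb_sum => m; apply: CbZ. Qed.

Lemma FF_bmf a : bmf (FF a : bOmega -> R). Proof. exact/bmf_Cb/FF_Cb. Qed.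

Lemma ZZ_stop_bmf a (rho : bOmega -> R) : measurable_fun setT rho ->
  bmf ((fun w => ZZ a (rho w) w) : bOmega -> R).
Proof.
move=> mr; apply: bmf_sum => m; apply: bmfZ.
exact: (Zpath_stop_bmf (l0 m) (@cphi m) (bphi m) mr).
Qed.

Lemma ZZ_bmf a t : bmf (ZZ a t : bOmega -> R).
Proof. by apply: (@ZZ_stop_bmf a (fun=> t)); exact: measurable_cst. Qed.

Lemma VV_bmf a : bmf (VV a : borel X -> R).
Proof. by apply: Sb; exact: FF_bmf. Qed.

Lemma FF_split a t w : 0 <= t -> FF a w = ZZ a t w + FF (dec a t) (Defs.shift (mk_time t) w).
Proof.
move=> t0; rewrite /FF /ZZ -big_split /=; apply: eq_bigr => m _.
have e : Fn m w = Zn m t w + expR (- (lambda m * t)) * Fn m (Defs.shift (mk_time t) w).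
  exact: (Fpath_split (l0 m) (@cphi m) (bphi m) w t0).
by rewrite e mulrDr mulrA.
Qed.

Lemma ZZ_split a s t w : 0 <= s -> 0 <= t ->
  ZZ a (s + t) w = ZZ a s w + ZZ (dec a s) t (Defs.shift (mk_time s) w).
Proof.
move=> s0 t0; rewrite /ZZ -big_split /=; apply: eq_bigr => m _.
have e : Zn m (s + t) w = Zn m s w + expR (- (lambda m * s)) * Zn m t (Defs.shift (mk_time s) w).
  exact: (Zpath_split (lambda m) (@cphi m) w s0 t0).
by rewrite e mulrDr mulrA.
Qed.

Lemma ZZ0 a w : ZZ a 0 w = 0.
Proof.
rewrite /ZZ big1// => m _; rewrite (_ : Zn m 0 w = 0) ?mulr0//.
by apply: Iint_le0.
Qed.

Lemma dec_dec a s t : dec (dec a s) t = dec a (s + t).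
Proof. by apply/funext => m; rewrite /dec -mulrA -expRD mulrDr opprD. Qed.

Lemma dec0 a : dec a 0 = a.
Proof. by apply/funext => m; rewrite /dec mulr0 oppr0 expR0 mulr1. Qed.

Lemma dec_ge0 a t : (forall m, 0 <= a m) -> forall m, 0 <= dec a t m.
Proof. by move=> a0 m; rewrite mulr_ge0// expR_ge0. Qed.

Lemma dec_le a t : 0 <= t -> (forall m, 0 <= a m) -> forall m, dec a t m <= a m.
Proof.
move=> t0 a0 m; rewrite /dec ler_piMr// expR_le1 oppr_le0 mulr_ge0// ltW//; exact: l0.
Qed.

Variables (K : nat -> R) (hK : forall m x, `|phi m x| <= K m).

Let K0 m : 0 <= K m. Proof. exact: le_trans (normr_ge0 _) (hK m point). Qed.

(** [bF a] bounds the payoff of weights a; [bK a] bounds its change per unit of time when the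
    discount is frozen. *)
Definition bF a := \sum_(m < N) a m * (K m / lambda m).
Definition bK a := \sum_(m < N) a m * K m.

Lemma bF_dec a t : 0 <= t -> (forall m, 0 <= a m) -> bF (dec a t) <= bF a.
Proof.
move=> t0 a0; apply: ler_sum => m _; apply: ler_wpM2r; last exact: dec_le.
by rewrite divr_ge0// ltW//; exact: l0.
Qed.

Lemma bK_dec a t : 0 <= t -> (forall m, 0 <= a m) -> bK (dec a t) <= bK a.
Proof. by move=> t0 a0; apply: ler_sum => m _; apply: ler_wpM2r => //; exact: dec_le. Qed.

Lemma bF_ge0 a : (forall m, 0 <= a m) -> 0 <= bF a.
Proof.
move=> a0; apply: sumr_ge0 => m _; rewrite mulr_ge0// divr_ge0// ltW//; exact: l0.
Qed.

Lemma bK_ge0 a : (forall m, 0 <= a m) -> 0 <= bK a.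
Proof. by move=> a0; apply: sumr_ge0 => m _; rewrite mulr_ge0. Qed.

Lemma Fn_bound m w : `|Fn m w| <= K m / lambda m.
Proof. by apply: (Fpath_bound (l0 m)) => //; exact: hK. Qed.

Lemma FF_bound a w : (forall m, 0 <= a m) -> `|FF a w| <= bF a.
Proof.
move=> a0; apply: le_trans (ler_norm_sum _ _ _) _; apply: ler_sum => m _.
by rewrite normrM (ger0_norm (a0 m)) ler_wpM2l// Fn_bound.
Qed.

Lemma ZZ_bound a t w : (forall m, 0 <= a m) -> `|ZZ a t w| <= 2 * bF a.
Proof.
move=> a0; apply: le_trans (ler_norm_sum _ _ _) _; rewrite /bF mulr_sumr.
apply: ler_sum => m _; rewrite normrM (ger0_norm (a0 m)) mulrCA ler_wpM2l//.
by apply: (Zpath_bound (l0 m)) => //; exact: hK.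
Qed.

Lemma VV_bound a y : (forall m, 0 <= a m) -> `|VV a y| <= bF a.
Proof.
by move=> a0; apply: mean_norm_le => [|w]; [have [] := FF_bmf a|exact: FF_bound].
Qed.

(** The discount changes by at most lambda_m t while F_m is at most K_m / lambda_m, so the rate
    cancels. *)
Lemma FF_dec_close a t w : 0 <= t -> (forall m, 0 <= a m) -> `|FF (dec a t) w - FF a w| <= t * bK a.
Proof.
move=> t0 a0; rewrite /FF -sumrB; apply: le_trans (ler_norm_sum _ _ _) _.
rewrite /bK mulr_sumr; apply: ler_sum => m _.
rewrite /dec -mulrBl normrM -{2}(mulr1 (a m)) -mulrBr normrM (ger0_norm (a0 m)).
have h1 : `|expR (- (lambda m * t)) - 1| <= lambda m * t.
  have := expR_ge1Dx (- (lambda m * t)); have : expR (- (lambda m * t)) <= 1.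
    by rewrite expR_le1 oppr_le0 mulr_ge0// ltW//; exact: l0.
  by move=> h1 h2; rewrite ler0_norm ?subr_le0//; lra.
rewrite -mulrA [leRHS]mulrCA ler_wpM2l//.
apply: le_trans (ler_pM _ _ h1 (Fn_bound m w)) _ => //.
have ln0 : lambda m != 0 by rewrite gt_eqF//; exact: l0.
have -> : lambda m * t * (K m / lambda m) = t * K m by field.
exact: lexx.
Qed.

Lemma VV_dec_close a t y : 0 <= t -> (forall m, 0 <= a m) -> `|VV (dec a t) y - VV a y| <= t * bK a.
Proof.
move=> t0 a0; rewrite /VV -meanB; [|exact: FF_bmf|exact: FF_bmf].
apply: mean_norm_le => [|w]; last exact: FF_dec_close.
by have [] := bmfB (FF_bmf (dec a t)) (FF_bmf a).
Qed.

Lemma JJ_bmf a s : bmf (JJ a s : bOmega -> R).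
Proof.
apply: bmfD; first exact: ZZ_bmf.
by apply: (bmf_comp (upper_bmf gC (FF_Cb _))); exact: at_time_measurable.
Qed.

Lemma JJ_bound a s w : 0 <= s -> (forall m, 0 <= a m) -> `|JJ a s w| <= 3 * bF a.
Proof.
move=> s0 a0; have h1 := ZZ_bound s w a0.
have h2 : `|upper C (at_time w s) (FF (dec a s))| <= bF a.
  apply: (upper_bound gC) => [|w']; first exact: FF_Cb.
  by apply: le_trans (bF_dec s0 a0); apply: FF_bound; exact: dec_ge0.
by apply: le_trans (ler_normD _ _) _; lra.
Qed.

Lemma mean_FF P a : mean P (FF a) = \sum_(m < N) a m * mean P (Fn m).
Proof.
rewrite /FF mean_sum => [|m]; last exact/bmfZ/bFn.
by apply: eq_bigr => m _; rewrite meanZ//; exact: bFn.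
Qed.

Lemma mean_ZZ P a (rho : bOmega -> R) : measurable_fun setT rho ->
  mean P (fun w => ZZ a (rho w) w) = \sum_(m < N) a m * mean P (fun w => Zn m (rho w) w).
Proof.
move=> mr; have bZ m : bmf ((fun w => Zn m (rho w) w) : bOmega -> R).
  exact: (Zpath_stop_bmf (l0 m) (@cphi m) (bphi m) mr).
rewrite /ZZ mean_sum => [|m]; last exact/bmfZ/bZ.
by apply: eq_bigr => m _; rewrite meanZ//; exact: bZ.
Qed.

(** (KP2) turns an optimal continuation at time r into a law of C(y) whose integrals up to r are no
    smaller; nonnegative weights preserve these inequalities. *)
Lemma det_step a r y : (forall m, 0 <= a m) -> 0 < r ->
  mean (S y) (JJ a r) <= upper C y (FF a).
Proof.
move=> a0 r0; have st := @det_stopping R X r.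
have [M [KM eM]] := K_optimal hX (S y) gC st (FF_Cb (dec a r)).
have [_ hQ] := det_chain hX hPhi hLambda henum hC (n := 0%N) r0 (SC y).
have [Q [CQ QM QZ]] := hQ M KM.
apply: le_trans (upper_ge gC (FF_Cb a) CQ).
have bu : bmf ((fun w => upper C (at_time w r) (FF (dec a r))) : bOmega -> R).
  by apply: (bmf_comp (upper_bmf gC (FF_Cb _))); exact: at_time_measurable.
have bth := theta_bmf hX st (FF_bmf (dec a r)).
have -> : FF a = fun w => ZZ a r w + FF (dec a r) (theta (det r) w).
  by apply/funext => w; rewrite (FF_split a w (ltW r0)).
rewrite (meanD (S y) (ZZ_bmf a r) bu) (meanD Q (ZZ_bmf a r) bth).
apply: lerD; last by rewrite -(QM _ (FF_bmf _)) eM.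
rewrite !(mean_ZZ _ _ (measurable_cst r)); apply: ler_sum => m _.
by rewrite ler_wpM2l//; exact: QZ.
Qed.

(* As tau <= eta, neglecting the discount in f costs at most eta * bK a. *)
Lemma stop_step a (tau : Omega -> time R) (eta : R) y : (forall m, 0 <= a m) ->
  stopping_time tau -> positive_time tau -> (forall w, time_val (tau w) <= eta) ->
  mean (S y) (fun w => ZZ a (time_val (tau w)) w + VV a (at_time w (time_val (tau w)))) - eta * bK a
  <= upper C y (FF a).
Proof.
move=> a0 st pt te.
have mT := stopping_measurable st; have me := eval_tau_measurable hX st.
have bk (f : bOmega -> R) : bmf f -> bmf ((fun w => mean (S (eval_tau tau w)) f) : bOmega -> R).
  by move=> bf; exact: (bmf_comp (Sb bf) me).
(* The continuation by S itself is admissible, as each [S z] belongs to [C z]; (KP2) realises it by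
   a law of C(y). *)
have [M [_ eM]] := mixture_exists (S y) bk.
have KM : Kset (S y) tau C M.
  move=> f Cf; rewrite eM; last exact: bmf_Cb.
  apply: le_mean; [exact/bk/bmf_Cb|exact: (upper_eval_bmf hX st gC Cf)|move=> w].
  exact: upper_ge.
have [Q [CQ QM QZ]] := KP2 hX hC st pt (SC y) KM.
apply: le_trans (upper_ge gC (FF_Cb a) CQ).
have bZ := ZZ_stop_bmf a mT.
have bV : bmf ((fun w => VV a (at_time w (time_val (tau w)))) : bOmega -> R).
  by apply: (bmf_comp (VV_bmf a)); exact: (at_time_stopping_measurable hX mT).
have bth := theta_bmf hX st (FF_bmf a).
have bB := bmfB bth (bmf_cst bOmega (eta * bK a)).
have h1 : mean Q (fun w => ZZ a (time_val (tau w)) w + (FF a (theta tau w) - eta * bK a)) <= mean Q (FF a).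
  apply: le_mean; [exact: (bmfD bZ bB)|exact: FF_bmf|].
  move=> w; have T0 := ltW (pt w).
  rewrite (FF_split a w T0) time_valK lerD2l.
  have := FF_dec_close (theta tau w) T0 a0; rewrite ler_norml => /andP[h _].
  have := ler_wpM2r (bK_ge0 a0) (te w); rewrite -/(theta tau w); lra.
apply: le_trans h1; rewrite (meanD _ bZ bB) (meanB _ bth (bmf_cst bOmega _)).
rewrite mean_cst (meanD _ bZ bV) addrA lerD2r.
apply: lerD.
  rewrite !(mean_ZZ _ _ mT); apply: ler_sum => m _.
  by rewrite ler_wpM2l//; exact: QZ.
rewrite -(QM _ (FF_bmf a)) (eM _ (FF_bmf a)).
have -> : (fun w => mean (S (eval_tau tau w)) (FF a)) = fun w => VV a (at_time w (time_val (tau w))).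
  by apply/funext => w; rewrite eval_tauE.
exact: lexx.
Qed.

(** The Markov property at s reduces this to [det_step] from w(s), with the weights discounted to
    s. *)
Lemma supermartingale a s r x (G : bOmega -> R) : (forall m, 0 <= a m) -> 0 <= s -> 0 < r ->
  bmf (G : Fsp (mk_time s) -> R) -> (forall w, 0 <= G w) ->
  mean (S x) (fun w => G w * JJ a (s + r) w) <= mean (S x) (fun w => G w * JJ a s w).
Proof.
move=> a0 s0 r0 bG G0; have bG' := Fsp_bmf bG.
have eJ w : JJ a (s + r) w = ZZ a s w + JJ (dec a s) r (Defs.shift (mk_time s) w).
  rewrite /JJ ZZ_split// ?(ltW r0)// -addrA dec_dec at_time_shift ?(ltW r0)//.
  by rewrite mk_timeK.
have bJ := JJ_bmf (dec a s) r.
have bJs : bmf ((fun w => JJ (dec a s) r (Defs.shift (mk_time s) w)) : bOmega -> R).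
  by apply: (bmf_comp bJ); exact: shift_measurable.
have bu : bmf ((fun w => upper C (at_time w s) (FF (dec a s))) : bOmega -> R).
  by apply: (bmf_comp (upper_bmf gC (FF_Cb _))); exact: at_time_measurable.
have bGZ := bmfM bG' (ZZ_bmf a s).
have m1 : mean (S x) (fun w => G w * JJ a (s + r) w) =
    mean (S x) (fun w => G w * ZZ a s w) + mean (S x) (fun w => G w * JJ (dec a s) r (Defs.shift (mk_time s) w)).
  transitivity (mean (S x) (fun w => G w * ZZ a s w + G w * JJ (dec a s) r (Defs.shift (mk_time s) w))).
    by congr mean; apply/funext => w; rewrite eJ mulrDr.
  exact: (meanD _ bGZ (bmfM bG' bJs)).
have m2 : mean (S x) (fun w => G w * JJ a s w) =
    mean (S x) (fun w => G w * ZZ a s w) + mean (S x) (fun w => G w * upper C (at_time w s) (FF (dec a s))).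
  transitivity (mean (S x) (fun w => G w * ZZ a s w + G w * upper C (at_time w s) (FF (dec a s)))).
    by congr mean; apply/funext => w; exact: mulrDr.
  exact: (meanD _ bGZ (bmfM bG' bu)).
rewrite [leLHS]m1 [leRHS]m2 lerD2l.
rewrite (cond x s0 bG bJ); apply: le_mean.
- by apply: bmfM => //; apply: (bmf_comp (Sb bJ)); exact: at_time_measurable.
- exact: bmfM.
- by move=> w; rewrite ler_wpM2l//; apply: det_step => //; exact: dec_ge0.
Qed.

End cone.

Lemma ler_add_pieces (R : realType) (A1 A2 A3 B1 B3 c1 c2 c3 : R) :
  A1 <= B1 + c1 -> A3 <= B3 + c3 -> 0 <= c2 -> A1 + (A2 + A3) <= B1 + (A2 + B3) + (c1 + (c2 + c3)).
Proof. by move=> *; lra. Qed.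

Section cone_stopping.
Context {R : realType} {X : ptopologicalType} (hX : polish R X).
Variables (Phi : set (X -> R)) (hPhi : separating_family Phi).
Variables (Lambda : set R) (hLambda : dense_rates Lambda).
Variables (lambda : nat -> R) (phi : nat -> X -> R).
Variable henum : range (fun n => (lambda n, phi n)) = Lambda `*` Phi.
Variables (C : X -> set (law R X)) (hC : strong_krylov lambda phi C).
Local Notation Omega := (cpath R X).
Local Notation law := (law R X).
Local Notation bOmega := (borel Omega).
Local Notation Fn := (Fn lambda phi).
Local Notation Zn := (Zn lambda phi).
Local Notation Doo := (chain_limit C Fn).
Variables (S : X -> law) (SD : forall x, Doo x (S x)).
Variable N : nat.
Local Notation FF := (FF lambda phi N).
Local Notation ZZ := (ZZ lambda phi N).
Local Notation VV := (VV lambda phi S N).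
Local Notation JJ := (JJ lambda phi C N).
Local Notation dec := (dec lambda).
Variables (tau : Omega -> time R) (st : stopping_time tau) (pt : positive_time tau).
Local Notation T w := (time_val (tau w)).
Variables (K : nat -> R) (hK : forall m x, `|phi m x| <= K m).
Variables (a : nat -> R) (a0 : forall m, 0 <= a m).
Local Notation bK := (bK N K).
Local Notation bF := (bF lambda N K).
Implicit Types (w : Omega) (r s t : R).

Let CFn := Fn_Cb hPhi hLambda henum.
Let gC := good_C hC.
Let SC x : C x (S x). Proof. exact: (SD x (i := 0%N) I). Qed.
Let Sb (f : bOmega -> R) : bmf f -> bmf ((fun x => mean (S x) f) : borel X -> R).
Proof. exact: (S_bmf hX hPhi hLambda henum hC SD). Qed.
Let cond t x (G f : bOmega -> R) : 0 <= t -> bmf (G : Fsp (mk_time t) -> R) -> bmf f ->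
  mean (S x) (fun w => G w * f (Defs.shift (mk_time t) w)) =
  mean (S x) (fun w => G w * mean (S (at_time w t)) f).
Proof. by move=> t0 bG bf; exact: (conditional_markov hX hPhi hLambda henum hC SD x t0 bG bf). Qed.
Let ZZs b (rho : bOmega -> R) : measurable_fun setT rho -> bmf ((fun w => ZZ b (rho w) w) : bOmega -> R).
Proof. exact: (ZZ_stop_bmf hPhi hLambda henum N b). Qed.
Let VVb b : bmf (VV b : borel X -> R).
Proof. exact: (VV_bmf hX hPhi hLambda henum hC SD N b). Qed.
Let JJb b s : bmf (JJ b s : bOmega -> R).
Proof. exact: (JJ_bmf hPhi hLambda henum hC N b s). Qed.

Lemma ZZ_agree b s w w' : (forall r, 0 <= r <= s -> at_time w r = at_time w' r) ->
  ZZ b s w = ZZ b s w'.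
Proof.
move=> h; apply: eq_bigr => m _; congr (_ * _); apply: Iint_ext => r rs.
by rewrite h.
Qed.

(* The time at which to stop once tau has been announced at time s, and the
   payoff then, with the discount frozen at s. *)
Definition rho s eta w := Num.min (T w) (s + eta).
Definition Psi s eta w := ZZ a (rho s eta w) w + VV (dec a s) (at_time w (rho s eta w)).

Lemma Psi_bmf s eta : bmf (Psi s eta : bOmega -> R).
Proof.
have mr : measurable_fun setT (rho s eta : bOmega -> R).
  apply: measurable_minr; first exact: (stopping_measurable st).
  exact: measurable_cst.
apply: bmfD; first exact: ZZs.
by apply: (bmf_comp (VVb _)); exact: at_time_stopping_measurable.
Qed.

Lemma Psi_bound s eta w : 0 <= s -> `|Psi s eta w| <= 3 * bF a.
Proof.
move=> s0; have h1 := ZZ_bound hPhi hLambda henum N hK (rho s eta w) w a0.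
have d0 := dec_ge0 lambda s a0.
have h2 := VV_bound hPhi hLambda henum S N hK (at_time w (rho s eta w)) d0.
have h3 := bF_dec hLambda henum N hK s0 a0.
by apply: le_trans (ler_normD _ _) _; lra.
Qed.

(* Given the path w up to s < tau(w), the remaining time up to tau is a stopping
   time of the future path. *)
Lemma jump s eta w : 0 <= s -> 0 < eta -> s < T w ->
  after S s (Psi s eta) w - eta * bK a <= JJ a s w.
Proof.
move=> s0 eta0 sT; set y := at_time w s.
have ag w' r : 0 <= r <= s -> at_time (splice s w w') r = at_time w r.
  by move=> /andP[r0 rs]; rewrite cat_before.
have Tc w' : s < T (splice s w w').
  rewrite ltNge; apply/negP => h; have h1 := @stopping_le _ _ _ st s.
  have := galmarino (w := splice s w w') (w' := w) h1; rewrite mk_timeK// => /(_ (ag w') h) /=.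
  by rewrite leNgt sT.
(* The remaining time up to tau, capped at eta so that [stop_step] applies. *)
pose T' w' := Num.min (T (splice s w w') - s) eta.
have T'0 w' : 0 < T' w' by rewrite lt_min eta0 subr_gt0 Tc.
pose tau' w' : time R := mk_time (T' w').
have tE w' : time_val (tau' w') = T' w' by rewrite mk_timeK// ltW.
have st' : stopping_time tau'.
  apply: stopping_timeP => [w'|r r0]; first exact: ltW.
  have [er|re] := leP eta r.
    rewrite (_ : [set w' | _] = setT); first by rewrite -FspE; exact: measurableT.
    by apply/seteqP; split => // w' _ /=; rewrite ge_min er orbT.
  have sr0 : 0 <= s + time_val (mk_time r) by rewrite addr_ge0// time_val_ge0.
  have mA : @measurable _ (Fsp (mk_time (s + time_val (mk_time r)))) [set u | T u <= s + r].
    by rewrite FspE mk_timeK//; exact: stopping_le.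
  (* For r < eta the event is the preimage of {tau <= s + r} under concatenation with the fixed
     past. *)
  have := @cat_filtration _ _ hX s w (mk_time r) s0 measurableT _ mA; rewrite setTI FspE.
  congr filtration; apply/seteqP; split => w' /=; rewrite /T' ge_min lerBlDl.
    by move=> ->.
  by move=> /orP[//|]; rewrite leNgt re.
have pt' : positive_time tau' by move=> w'; rewrite tE.
have te w' : time_val (tau' w') <= eta by rewrite tE ge_min lexx orbT.
have d0 := dec_ge0 lambda s a0.
have := stop_step hX hPhi hLambda henum hC SD N hK y d0 st' pt' te.
set G1 := (fun w' => ZZ (dec a s) _ _ + _) => h.
have bG1 : bmf (G1 : bOmega -> R).
  have mT := stopping_measurable st'; apply: bmfD; first exact: ZZs.
  by apply: (bmf_comp (VVb _)); exact: (at_time_stopping_measurable hX mT).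
have e : after S s (Psi s eta) w = ZZ a s w + mean (S y) G1.
  rewrite -{1}[ZZ a s w](mean_cst (S y)) -meanD//; last exact: bmf_cst.
  apply: (mean_as (start_at_measurable hX y) (krylov_C3 hC (SC y))).
  - by apply: (bmf_comp (Psi_bmf s eta)); exact: cat_measurable.
  - by apply: bmfD => //; exact: bmf_cst.
  - move=> w' w'y; have {}w'y : at_time w' 0 = at_time w s by [].
    have T'0' := ltW (T'0 w').
    have er : rho s eta (splice s w w') = s + T' w'.
      by rewrite /rho /T' addr_minr [s + (_ - s)]addrC subrK.
    rewrite /Psi er (ZZ_split hPhi henum)// cat_after// shift_cat// (ZZ_agree a (ag w')).
    by rewrite /G1 tE addrA.
have hb := bK_dec hLambda henum N hK s0 a0; have := ler_wpM2l (ltW eta0) hb.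
by rewrite e /JJ -/y; lra.
Qed.

Section run.
Variables (ep eta : R) (p : nat -> set Omega).
Hypotheses (ep0 : 0 < ep) (eta0 : 0 < eta) (pF : forall k, filtration (mk_time (k%:R * ep)) (p k)).
Let L k : set bOmega := [set w | k%:R * ep < T w].
Let pk k : set bOmega := p k.
Let kep0 k : 0 <= k%:R * ep. Proof. by rewrite mulr_ge0// ltW. Qed.

(* The payoff when tau is announced at the first grid time j * ep with j > k and
   p j, the supermartingale being stopped after n steps at the latest. *)
Fixpoint run (n k : nat) (w : bOmega) : R :=
  if n is n'.+1 then
    \1_(pk k.+1) w * (\1_(L k.+1) w * Psi (k.+1%:R * ep) eta w + \1_(~` L k.+1) w * JJ a (k.+1%:R * ep) w)
    + \1_(~` pk k.+1) w * run n' k.+1 w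
  else JJ a (k%:R * ep) w.

Let LF k : filtration (mk_time (k%:R * ep)) (L k).
Proof.
rewrite (_ : L k = ~` [set w | T w <= k%:R * ep]); last first.
  by apply/seteqP; split => w /=; rewrite /L/= ltNge => /negP.
by rewrite -FspE; apply: measurableC; rewrite FspE; exact: stopping_le.
Qed.

Let iF k (A : set Omega) : filtration (mk_time (k%:R * ep)) A ->
  bmf (\1_A : @Fsp R X (mk_time (k%:R * ep)) -> R) /\ bmf (\1_(~` A) : @Fsp R X (mk_time (k%:R * ep)) -> R).
Proof.
move=> fA; have mA : @measurable _ (@Fsp R X (mk_time (k%:R * ep))) A by rewrite FspE.
by split; apply: bmf_indic => //; exact: measurableC.
Qed.

Lemma run_bmf n k : bmf (run n k).
Proof.
elim: n k => [|n IH] k /=; first exact: JJb.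
have [b1 b2] := iF (@pF k.+1); have [b3 b4] := iF (@LF k.+1).
apply: bmfD; last by apply: bmfM => //; exact: Fsp_bmf b2.
apply: bmfM; first exact: Fsp_bmf b1.
apply: bmfD; apply: bmfM => //; [exact: Fsp_bmf b3|exact: Psi_bmf|exact: Fsp_bmf b4].
Qed.

Lemma run_bound n k w : `|run n k w| <= 3 * bF a.
Proof.
elim: n k => [|n IH] k /=; first exact: (JJ_bound hPhi hLambda henum hC N hK w (kep0 k) a0).
rewrite !indicE !in_setC; case: (w \in pk k.+1) => /=; rewrite !(mul1r, mul0r, add0r, addr0)//.
case: (w \in L k.+1) => /=; rewrite !(mul1r, mul0r, add0r, addr0)//; first exact: Psi_bound.
exact: (JJ_bound hPhi hLambda henum hC N hK w (kep0 k.+1) a0).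
Qed.

(** The mass G splits at the next grid time into announced before tau, announced too late, and not
    announced. The error eta * bK a of [jump] is charged only to the first piece, and the induction
    to the third; each path is charged at most once, so the total does not grow with n. *)
Lemma run_le n k x (G : bOmega -> R) : bmf (G : Fsp (mk_time (k%:R * ep)) -> R) -> (forall w, 0 <= G w) ->
  mean (S x) (fun w => G w * run n k w) <=
  mean (S x) (fun w => G w * JJ a (k%:R * ep) w) + eta * bK a * mean (S x) G.
Proof.
have bKa : 0 <= bK a by exact: (bK_ge0 N hK a0).
elim: n k G => [|n IH] k G bG G0.
  by rewrite lerDl mulr_ge0//; [exact: mulr_ge0 (ltW eta0) bKa|rewrite -(mean_cst (S x) 0);
    apply: le_mean => //; [exact: bmf_cst|exact: Fsp_bmf bG]].
have bGb := Fsp_bmf bG.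
set s := k.+1%:R * ep; have s0 : 0 <= s by exact: kep0.
have sE : s = k%:R * ep + ep by rewrite /s -natr1 mulrDl mul1r.
have sm : mean (S x) (fun w => G w * JJ a s w) <= mean (S x) (fun w => G w * JJ a (k%:R * ep) w).
  by rewrite sE; exact: (supermartingale hX hPhi hLambda henum hC SD N x a0 (kep0 k) ep0 bG G0).
apply: (@le_trans _ _ (mean (S x) (fun w => G w * JJ a s w) + eta * bK a * mean (S x) G)); last first.
  by rewrite lerD2r.
have bGs : bmf (G : Fsp (mk_time s) -> R).
  have [mG [c hc]] := bG; split; last by exists c.
  move=> _ B mB; have := mG measurableT B mB; rewrite !FspE; apply: filtration_mono.
  by rewrite !mk_timeK// sE lerDl ltW.
have [b1 b2] := iF (@pF k.+1); have [b3 b4] := iF (@LF k.+1).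
rewrite -/s in b1 b2 b3 b4.
pose G1 w := G w * \1_(pk k.+1) w * \1_(L k.+1) w.
pose G2 w := G w * \1_(pk k.+1) w * \1_(~` L k.+1) w.
pose G3 w := G w * \1_(~` pk k.+1) w.
have bG1 : bmf (G1 : Fsp (mk_time s) -> R) by apply: bmfM => //; exact: bmfM.
have bG2 : bmf (G2 : Fsp (mk_time s) -> R) by apply: bmfM => //; exact: bmfM.
have bG3 : bmf (G3 : Fsp (mk_time s) -> R) by apply: bmfM.
have [[c1 c2] c3] := (Fsp_bmf bG1, Fsp_bmf bG2, Fsp_bmf bG3).
have i0 A (w : bOmega) : 0 <= (\1_A w : R) by rewrite indicE.
have GE w : G w = G1 w + G2 w + G3 w.
  rewrite /G1 /G2 /G3 !indicE !in_setC; case: (w \in pk k.+1); case: (w \in L k.+1) => /=; ring.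
have bPs := Psi_bmf s eta; have bJs := JJb a s; have br := run_bmf n k.+1.
have m1 : mean (S x) (fun w => G w * run n.+1 k w) = mean (S x) (fun w => G1 w * Psi s eta w) +
    (mean (S x) (fun w => G2 w * JJ a s w) + mean (S x) (fun w => G3 w * run n k.+1 w)).
  rewrite -(meanD _ (bmfM c2 bJs) (bmfM c3 br)) -(meanD _ (bmfM c1 bPs) (bmfD (bmfM c2 bJs) (bmfM c3 br))).
  by congr mean; apply/funext => w; rewrite /= /G1 /G2 /G3 -/s; ring.
have m2 : mean (S x) (fun w => G w * JJ a s w) = mean (S x) (fun w => G1 w * JJ a s w) +
    (mean (S x) (fun w => G2 w * JJ a s w) + mean (S x) (fun w => G3 w * JJ a s w)).
  rewrite -(meanD _ (bmfM c2 bJs) (bmfM c3 bJs)) -(meanD _ (bmfM c1 bJs) (bmfD (bmfM c2 bJs) (bmfM c3 bJs))).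
  by congr mean; apply/funext => w; rewrite GE; ring.
have m3 : mean (S x) G = mean (S x) G1 + (mean (S x) G2 + mean (S x) G3).
  rewrite -(meanD _ c2 c3) -(meanD _ c1 (bmfD c2 c3)).
  by congr mean; apply/funext => w; rewrite GE addrA.
rewrite [leLHS]m1 m2 m3.
have h3 := IH k.+1 G3 bG3 (fun w => mulr_ge0 (G0 w) (i0 _ w)); rewrite -/s in h3.
have p2 : 0 <= mean (S x) G2.
  rewrite -(mean_cst (S x) 0); apply: le_mean => //; first exact: bmf_cst.
  by move=> w; rewrite !mulr_ge0.
have p2' : 0 <= eta * bK a * mean (S x) G2 by rewrite !mulr_ge0// ltW.
have [ba hd] := disintegration hX hC SC (@Sb) (@cond) s0 bG1 bPs.
have h1 : mean (S x) (fun w => G1 w * Psi s eta w) <=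
    mean (S x) (fun w => G1 w * JJ a s w) + eta * bK a * mean (S x) G1.
  rewrite [leLHS]hd -(meanZ _ _ c1) -(meanD _ (bmfM c1 bJs) (bmfZ _ c1)).
  apply: le_mean; [exact: bmfM|exact: (bmfD (bmfM c1 bJs) (bmfZ _ c1))|move=> w].
  have [Lw|nL] := pselect (L k.+1 w); last first.
    have -> : G1 w = 0 by rewrite /G1 [\1_(L _) _]indicE memNset// mulr0.
    by rewrite !mul0r mulr0 addr0.
  have g0 : 0 <= G1 w by rewrite /G1 !mulr_ge0.
  have := jump s0 eta0 Lw; rewrite lerBlDr => h.
  by rewrite [eta * bK a * _]mulrC -mulrDr; exact: ler_wpM2l.
by rewrite !mulrDr; exact: ler_add_pieces.
Qed.

Lemma run_good n i k w : (i < k <= i + n)%N -> p k w -> (forall j, (i < j < k)%N -> ~ p j w) ->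
  k%:R * ep < T w -> run n i w = Psi (k%:R * ep) eta w.
Proof.
move=> + pkw + Lw; elim: n i => [|n IH] i ik hp.
  by move: ik; rewrite addn0 ltnNge => /andP[/negbTE->].
rewrite /= !indicE !in_setC; have /andP[ik1 ik2] := ik.
have [e|ne] := eqVneq k i.+1.
  by rewrite -e !mem_set//= !mul1r !mul0r !addr0.
have ik3 : (i.+1 < k)%N by rewrite ltn_neqAle eq_sym ne.
rewrite memNset/=; last by apply: hp; rewrite ltnSn.
rewrite mul0r mul1r add0r; apply: IH; first by rewrite ik3 addSnnS.
by move=> j /andP[j1 j2]; apply: hp; rewrite j2 (ltn_trans _ j1).
Qed.

End run.

Definition Yst w := ZZ a (T w) w + VV (dec a (T w)) (at_time w (T w)).

Lemma Yst_sum w : Yst w = \sum_(m < N) a m *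
  (Zn m (T w) w + expR (- (lambda m * T w)) * mean (S (at_time w (T w))) (Fn m)).
Proof.
rewrite /Yst /VV (mean_FF hPhi hLambda henum) /ZZ -big_split /=; apply: eq_bigr => m _.
by rewrite mulrDr mulrA.
Qed.

Lemma Yst_bmf : bmf (Yst : bOmega -> R).
Proof.
have mT := stopping_measurable st; apply: bmfD; first exact: ZZs.
rewrite (_ : (fun w => _) = fun w => \sum_(m < N) a m * expR (- (lambda m * T w)) *
    mean (S (at_time w (T w))) (Fn m)); last first.
  by apply/funext => w; rewrite /VV (mean_FF hPhi hLambda henum).
apply: bmf_sum => m; rewrite (_ : (fun w => _) = fun w : bOmega => a m * (expR (- (lambda m * T w)) *
    mean (S (at_time w (T w))) (Fn m))); last by apply/funext => w; rewrite mulrA.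
apply: bmfZ; apply: bmfM; last first.
  by apply: (bmf_comp (Sb (bmf_Cb (CFn m)))); exact: (at_time_stopping_measurable hX mT).
split.
  apply: measurableT_comp; first exact: measurable_expR.
  by apply: measurableT_comp => //; exact: measurable_funM.
exists 1 => w; rewrite ger0_norm ?expR_ge0// expR_le1 oppr_le0 mulr_ge0 ?time_val_ge0// ltW//.
exact: (lambda_gt0 hLambda henum).
Qed.

(** The run starts at time 0 with value [upper C x (FF a)]. Where the announcement succeeds it ends
    with the payoff at tau, up to the discount between announcement and tau; the failures have small
    probability. *)
Lemma cone_stopping x : mean (S x) Yst <= upper C x (FF a).
Proof.
have bKa : 0 <= bK a by exact: (bK_ge0 N hK a0).
have bFa : 0 <= bF a by exact: (bF_ge0 hLambda henum N hK a0).
(* One [bK a] comes from [run_le], the other from unfreezing the discount; on failures payoff and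
   run are each at most 3 bF a in absolute value. *)
suff key d : 0 < d -> mean (S x) Yst <= upper C x (FF a) + d * (2 * bK a + 6 * bF a).
  set c := 2 * bK a + 6 * bF a in key; have c0 : 0 <= c by rewrite /c; lra.
  apply/ler_addgt0Pr => e e0; have := key (e / (c + 1)); rewrite divr_gt0//; last by lra.
  move=> /(_ isT) h; apply: le_trans h _; rewrite lerD2l mulrAC ler_pdivrMr; last by lra.
  by rewrite ler_pM2l//; lra.
move=> d0; have [ep [M [p [H [ep0 pF mH PH hH]]]]] := announced hX (S x) st pt d0 d0.
have J0 : mean (S x) (JJ a 0) = upper C x (FF a).
  have Cf := FF_Cb hPhi hLambda henum N a.
  have := mean_start hX hC (SC x) (upper_bmf gC Cf) (bmf_cst bOmega 1); rewrite mean_cst mulr1 => <-.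
  congr mean; apply/funext => w; rewrite mulr1 /JJ ZZ0 add0r.
  by rewrite dec0.
have bR : bmf (run ep d p M 0 : bOmega -> R) by exact: run_bmf.
have hR : mean (S x) (run ep d p M 0) <= upper C x (FF a) + d * bK a.
  have b1 : bmf ((fun=> 1) : @Fsp R X (mk_time (0%:R * ep)) -> R) by exact: bmf_cst.
  have := run_le ep0 d0 pF M x b1 (fun=> ler01).
  have m1 (h : bOmega -> R) : (fun w => 1 * h w) = h by apply/funext => w; rewrite mul1r.
  by rewrite !m1 mean_cst mulr1 mul0r J0.
have bI : bmf (\1_H : bOmega -> R) by exact: bmf_indic.
have IH : mean (S x) (\1_H) <= d by rewrite -lee_fin mean_indic.
have dK : 0 <= d * bK a by rewrite mulr_ge0// ltW.
have pw w : Yst w <= run ep d p M 0 w + (d * bK a + 6 * bF a * \1_H w).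
  have T0 := time_val_ge0 (tau w).
  rewrite indicE; have [wH|nH] := boolP (w \in H).
    have h1 := ZZ_bound hPhi hLambda henum N hK (T w) w a0.
    have h2 := VV_bound hPhi hLambda henum S N hK (at_time w (T w)) (dec_ge0 lambda (T w) a0).
    have h3 := bF_dec hLambda henum N hK T0 a0.
    have : `|run ep d p M 0 w| <= 3 * bF a by exact: run_bound.
    rewrite /Yst mulr1; move: h1 h2; rewrite !ler_norml => /andP[? ?] /andP[? ?] /andP[? ?]; lra.
  have [k [k1 k2 k3 k4 k5]] := hH w (fun h => negP nH (mem_set h)).
  have s0 : 0 <= k%:R * ep by rewrite mulr_ge0// ltW.
  rewrite (@run_good ep d p M 0 k)//= mulr0 addr0.
  rewrite /Psi /rho (min_l (ltW k5)) /Yst -addrA lerD2l.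
  have d1 := dec_ge0 lambda (k%:R * ep) a0; have t0 : 0 <= T w - k%:R * ep by lra.
  have := VV_dec_close hPhi hLambda henum S N hK (at_time w (T w)) t0 d1.
  rewrite dec_dec [k%:R * ep + _]addrC subrK ler_norml => /andP[_ h].
  have h4 := bK_dec hLambda henum N hK s0 a0.
  have h5 : (T w - k%:R * ep) * bK (dec a (k%:R * ep)) <= d * bK a.
    by apply: ler_pM h4 => //; [exact: (bK_ge0 N hK d1)|rewrite lerBlDl ltW].
  by rewrite -lerBlDl; exact: le_trans h h5.
apply: le_trans (le_mean (S x) Yst_bmf (bmfD bR (bmfD (bmf_cst bOmega _) (bmfZ _ bI))) pw) _.
rewrite (meanD _ bR (bmfD (bmf_cst bOmega _) (bmfZ _ bI))) (meanD _ (bmf_cst bOmega _) (bmfZ _ bI)).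
rewrite mean_cst (meanZ _ _ bI).
have : 6 * bF a * mean (S x) (\1_H) <= 6 * bF a * d by rewrite ler_wpM2l// mulr_ge0.
lra.
Qed.

End cone_stopping.

(* Adding j F_n to a cone element, for the limit j -> oo in the maximisation. *)
Lemma cone_combine (R : realType) (N n : nat) (a : nat -> R) (j : R) :
  (forall m, 0 <= a m) -> 0 <= j -> exists (N' : nat) (a' : nat -> R), (forall m, 0 <= a' m) /\
  forall x : nat -> R, \sum_(m < N') a' m * x m = \sum_(m < N) a m * x m + j * x n.
Proof.
move=> a0 j0; exists (N + n.+1)%N, (fun m => (m < N)%N%:R * a m + (m == n)%:R * j); split.
  by move=> m; rewrite addr_ge0// mulr_ge0.
move=> x; under eq_bigr do rewrite mulrDl; rewrite big_split /=; congr (_ + _).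
  rewrite big_split_ord /= [X in _ + X]big1 ?addr0 => [|i _]; last by rewrite ltnNge leq_addr/= !mul0r.
  by apply: eq_bigr => i _; rewrite ltn_ord mul1r.
have nN : (n < N + n.+1)%N by rewrite addnS ltnS leq_addl.
rewrite (bigD1 (Ordinal nN))//= eqxx mul1r big1 ?addr0// => i.
by rewrite -val_eqE /= => /negbTE ->; rewrite !mul0r.
Qed.

Section layers.
Context {R : realType} {X : ptopologicalType}.
Local Notation Omega := (cpath R X).
Local Notation bOmega := (borel Omega).
Variable P : law R X.

Lemma sum_ltn (K t : nat) : (t <= K)%N -> \sum_(i < K) (i < t)%N%:R = t%:R :> R.
Proof.
move=> tK; rewrite -(subnKC tK) big_split_ord /= [X in _ + X]big1 ?addr0 => [|i _]; last first.
  by rewrite ltnNge leq_addr.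
by under eq_bigr do rewrite ltn_ord; rewrite sumr_const card_ord.
Qed.

(** Layer-cake: g is approximated by floor(g (j+1)) / (j+1), a nonnegative combination of indicators
    of its superlevel sets. *)
Lemma layer_le (u g : bOmega -> R) (M : R) : bmf u -> measurable_fun setT g ->
  (forall w, 0 <= g w <= M) ->
  (forall r, mean P (fun w => \1_[set w | r <= g w] w * u w) <= 0) ->
  mean P (fun w => g w * u w) <= 0.
Proof.
move=> bu mg gM hr.
have M0 : 0 <= M by have /andP[h1 h2] := gM point; exact: le_trans h1 h2.
pose K j := (Num.truncn (M * j.+1%:R)).+1.
pose G j (w : bOmega) : R := \sum_(i < K j) j.+1%:R^-1 * \1_[set w | i.+1%:R / j.+1%:R <= g w] w.
have mI r : @measurable _ bOmega [set w | r <= g w].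
  have := mg measurableT _ (measurable_itv `[r, +oo[); rewrite setTI.
  by congr measurable; apply/seteqP; split => w /=; rewrite in_itv/= andbT.
have bI r : bmf (\1_[set w | r <= g w] : bOmega -> R) by exact: bmf_indic.
have GE j w : G j w = j.+1%:R^-1 * (Num.truncn (g w * j.+1%:R))%:R.
  have /andP[g0 g1] := gM w.
  have h : (Num.truncn (g w * j.+1%:R) <= Num.truncn (M * j.+1%:R))%N.
    by apply: le_truncn; rewrite ler_wpM2r.
  rewrite /G -mulr_sumr; congr (_ * _); rewrite -[RHS](@sum_ltn (K j)) ?leqW//.
  apply: eq_bigr => i _; rewrite indicE truncn_gt_nat; congr (_ %:R); congr nat_of_bool.
  by apply/idP/idP; rewrite inE /= ler_pdivrMr.
have Gc j w : `|g w - G j w| <= j.+1%:R^-1.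
  have /andP[g0 g1] := gM w; have j0 : 0 < j.+1%:R :> R by rewrite ltr0n.
  have gj0 : 0 <= g w * j.+1%:R by rewrite mulr_ge0.
  have /andP[t1 t2] := truncn_itv gj0.
  have gE : g w = j.+1%:R^-1 * (g w * j.+1%:R) by rewrite mulrCA mulVf ?mulr1// gt_eqF.
  rewrite GE [X in X - _]gE -mulrBr normrM gtr0_norm ?invr_gt0// ger_pMr ?invr_gt0//.
  by rewrite ger0_norm ?subr_ge0//; move: t2; rewrite -natr1; lra.
have bg : bmf g by split => //; exists M => w; have /andP[? ?] := gM w; rewrite ger0_norm.
have bG j : bmf (G j) by apply: bmf_sum => i; apply: bmfZ; exact: bI.
have Gl j : mean P (fun w => G j w * u w) <= 0.
  have -> : (fun w => G j w * u w) =
      fun w => \sum_(i < K j) j.+1%:R^-1 * (\1_[set w | i.+1%:R / j.+1%:R <= g w] w * u w).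
    by apply/funext => w; rewrite /G mulr_suml; apply: eq_bigr => i _; rewrite mulrA.
  rewrite mean_sum => [|i]; last exact/bmfZ/bmfM.
  apply: sumr_le0 => i _; rewrite meanZ; last exact: bmfM.
  by rewrite mulr_ge0_le0.
have [_ [U hU]] := bu; have U0 : 0 <= U by exact: le_trans (normr_ge0 _) (hU point).
have cv : mean P (fun w => G j w * u w) @[j --> \oo] --> mean P (fun w => g w * u w).
  apply: (cvg_mean (M := (M + 1) * U)).
  - by move=> j; exact: bmfM.
  - move=> j w; rewrite normrM; apply: ler_pM => //.
    have q1 : (j.+1%:R : R)^-1 <= 1 by rewrite invf_le1// ler1n.
    have := le_trans (Gc j w) q1; have /andP[? ?] := gM w.
    by rewrite !ler_norml => /andP[? ?]; apply/andP; split; lra.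
  - move=> w; apply: cvgM; last exact: cvg_cst.
    apply/cvgrPdist_le => e e0.
    have /cvgrPdist_le/(_ _ e0) := @cvg_harmonic R; apply: filterS => j.
    by rewrite sub0r normrN /harmonic/= ger0_norm// => h; exact: le_trans (Gc j w) h.
rewrite -(cvg_lim _ cv)//; apply: limr_le; first by apply/cvg_ex; eexists; exact: cv.
exact: nearW.
Qed.

End layers.

(** * Induction over the stages of the maximisation *)

Section induction.
Context {R : realType} {X : ptopologicalType} (hX : polish R X).
Variables (Phi : set (X -> R)) (hPhi : separating_family Phi).
Variables (Lambda : set R) (hLambda : dense_rates Lambda).
Variables (lambda : nat -> R) (phi : nat -> X -> R).
Variable henum : range (fun n => (lambda n, phi n)) = Lambda `*` Phi.
Variables (C : X -> set (law R X)) (hC : strong_krylov lambda phi C).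
Local Notation Omega := (cpath R X).
Local Notation law := (law R X).
Local Notation bOmega := (borel Omega).
Local Notation Fn := (Fn lambda phi).
Local Notation Zn := (Zn lambda phi).
Local Notation Doo := (chain_limit C Fn).
Local Notation Dn := (chain C Fn).
Variables (S : X -> law) (SD : forall x, Doo x (S x)).
Implicit Types (w : Omega) (r s t : R) (tau : Omega -> time R) (n m : nat).
Local Notation T tau w := (time_val (tau w)).

Let l0 n : 0 < lambda n := lambda_gt0 hLambda henum n.
Let CFn n : Cb R X (Fn n) := Fn_Cb hPhi hLambda henum n.
Let bFn n : bmf (Fn n : bOmega -> R) := bmf_Cb (CFn n).
Let gn n : good (Dn n) := good_chain n (good_C hC) CFn.
Let Sb (f : bOmega -> R) : bmf f -> bmf ((fun x => mean (S x) f) : borel X -> R).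
Proof. exact: (S_bmf hX hPhi hLambda henum hC SD). Qed.

Definition value n tau w := mean (S (eval_tau tau w)) (Fn n).
Definition disc n tau w := expR (- (lambda n * T tau w)).
(* The defect of the strong Markov property for F_n. *)
Definition Delta n tau w := value n tau w - Fn n (theta tau w).
Definition payoff n tau w := Zn n (T tau w) w + disc n tau w * value n tau w.

(** With [BP_at], the induction hypothesis at stage n: (KP1) at stopping times for D_n, and the
    bound of discounted payoffs by the optimum over D_n. Both concern only the laws S x. *)
Definition KP_at n := forall x tau, stopping_time tau -> positive_time tau -> KPin tau (Dn n) (S x).
Definition BP_at n := forall x tau, stopping_time tau -> positive_time tau ->
  forall N (a : nat -> R), (forall m, 0 <= a m) ->
  mean (S x) (fun w => \sum_(m < N) a m * payoff m tau w) <=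
  upper (Dn n) x (fun w => \sum_(m < N) a m * Fn m w).

Lemma value_upper n y : mean (S y) (Fn n) = upper (Dn n) y (Fn n).
Proof. exact: (argmaxE (gn n) (CFn n) (SD y (i := n.+1) I)). Qed.

Section tau.
Variables (tau : Omega -> time R) (st : stopping_time tau) (pt : positive_time tau).

Lemma value_bmf n : bmf (value n tau : bOmega -> R).
Proof. exact: (bmf_comp (Sb (bFn n)) (eval_tau_measurable hX st)). Qed.

Lemma Fn_theta_bmf n : bmf ((fun w => Fn n (theta tau w)) : bOmega -> R).
Proof. exact: (theta_bmf hX st (bFn n)). Qed.

Lemma Delta_bmf n : bmf (Delta n tau : bOmega -> R).
Proof. by apply: bmfB; [exact: value_bmf|exact: Fn_theta_bmf]. Qed.

Lemma disc_range n w : 0 < disc n tau w <= 1.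
Proof.
by rewrite expR_gt0 expR_le1 oppr_le0 mulr_ge0 ?time_val_ge0// ltW//; exact: l0.
Qed.

Lemma disc_measurable n : measurable_fun setT (disc n tau : bOmega -> R).
Proof.
apply: measurableT_comp; first exact: measurable_expR.
apply: measurableT_comp => //; apply: measurable_funM; first exact: measurable_cst.
exact: (stopping_measurable st).
Qed.

Lemma disc_bmf n : bmf (disc n tau : bOmega -> R).
Proof.
split; first exact: disc_measurable.
by exists 1 => w; have /andP[? ?] := disc_range n w; rewrite ger0_norm// ltW.
Qed.

(** Splitting F_n at tau shows that the payoff exceeds F_n exactly by the discounted defect. *)
Lemma payoffE n w : payoff n tau w = Fn n w + disc n tau w * Delta n tau w.
Proof.
have T0 := time_val_ge0 (tau w).
have e : Fn n w = Zn n (T tau w) w + disc n tau w * Fn n (theta tau w).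
  have := Fpath_split (l0 n) (@phi_continuous _ _ _ hPhi _ _ _ henum n) (phi_bounded hPhi henum n) w T0.
  by rewrite time_valK.
by rewrite e /payoff /Delta; ring.
Qed.

Lemma payoff_bmf n : bmf (payoff n tau : bOmega -> R).
Proof.
rewrite (_ : payoff n tau = fun w => Fn n w + disc n tau w * Delta n tau w); last first.
  by apply/funext => w; exact: payoffE.
by apply: bmfD => //; apply: bmfM; [exact: disc_bmf|exact: Delta_bmf].
Qed.

Lemma mean_payoff n P : mean P (payoff n tau) = mean P (Fn n) + mean P (fun w => disc n tau w * Delta n tau w).
Proof.
rewrite -(meanD _ (bFn n) (bmfM (disc_bmf n) (Delta_bmf n))).
by congr mean; apply/funext => w; exact: payoffE.
Qed.

(** The weights are concentrated on F_n, whose optimum over D_n is its mean under S x and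
    cancels. *)
Lemma BP_disc n x : BP_at n -> mean (S x) (fun w => disc n tau w * Delta n tau w) <= 0.
Proof.
move=> B; have [|//|N [a [a0 hs]]] := @cone_combine R 0 n (fun=> 0) 1 => //.
have := B x tau st pt N a a0.
have -> : (fun w => \sum_(m < N) a m * payoff m tau w) = payoff n tau.
  by apply/funext => w; rewrite (hs (fun m => payoff m tau w)) big_ord0 add0r mul1r.
have -> : (fun w => \sum_(m < N) a m * Fn m w) = Fn n.
  by apply/funext => w; rewrite (hs (fun m => Fn m w)) big_ord0 add0r mul1r.
by rewrite mean_payoff -value_upper gerDl.
Qed.

Lemma stopped_bmf (g : bOmega -> R) r : measurable_fun setT (g : stopped_type tau -> R) ->
  stopped_field tau [set w | r <= g w].
Proof.
move=> mg; have := mg measurableT _ (measurable_itv `[r, +oo[); rewrite setTI (stopped_typeE st).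
by congr stopped_field; apply/seteqP; split => w /=; rewrite in_itv/= andbT.
Qed.

Lemma stopped_T : measurable_fun setT ((fun w => T tau w) : stopped_type tau -> R).
Proof.
have h (s : R) : @measurable _ (stopped_type tau) [set w | T tau w <= s].
  by rewrite (stopped_typeE st); exact: stopped_le.
exact: (measurable_of_sublevel h).
Qed.

Lemma stoppedI A B : stopped_field tau A -> stopped_field tau B -> stopped_field tau (A `&` B).
Proof.
move=> hA hB; have mA : @measurable _ (stopped_type tau) A by rewrite (stopped_typeE st).
have mB : @measurable _ (stopped_type tau) B by rewrite (stopped_typeE st).
by have := measurableI _ _ mA mB; rewrite (stopped_typeE st).
Qed.

End tau.

Section level.
Variable n : nat.
Hypotheses (BPn : BP_at n) (KPn : KP_at n).
Variables (tau : Omega -> time R) (st : stopping_time tau) (pt : positive_time tau).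

(* The inequality for tau + c off A and tau on A, as c tends to infinity. *)
Lemma disc_Delta_le A x : stopped_field tau A ->
  mean (S x) (fun w => \1_A w * (disc n tau w * Delta n tau w)) <= 0.
Proof.
move=> hA; have mA : @measurable _ bOmega A by case: hA.
have [b b0 hb] := bounded_fun_bound (CFn n).2.
have Db tau' w : `|Delta n tau' w| <= 2 * b.
  rewrite (le_trans (ler_normB _ _))// mulrDl mul1r lerD//.
  by apply: mean_norm_le; [have [] := bFn n|exact: hb].
have bI : bmf (\1_A : bOmega -> R) by exact: bmf_indic.
have bdD := bmfM (disc_bmf st n) (Delta_bmf st n).
apply/ler_addgt0Pr => e e0; rewrite add0r.
(* A delay after which the discounted defect, at most 2 b exp(-lambda_n c), is below e, by exp(y) >=
   1 + y. *)
pose c := 2 * b / (lambda n * e).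
have ln := l0 n; have c0 : 0 <= c by rewrite divr_ge0// mulr_ge0// ltW.
pose tc w : time R := mk_time (T tau w + (if w \in A then 0 else c)).
have tc_ge w : 0 <= T tau w + (if w \in A then 0 else c).
  by rewrite addr_ge0 ?time_val_ge0//; case: ifP.
have stc : stopping_time tc by exact: stopping_delay.
have ptc : positive_time tc.
  by move=> w; rewrite mk_timeK//; apply: ltr_wpDr; [case: ifP|exact: pt].
have bdc := bmfM (disc_bmf stc n) (Delta_bmf stc n).
have ec : 2 * b * expR (- (lambda n * c)) <= e.
  rewrite expRN ler_pdivrMr ?expR_gt0//.
  have := expR_ge1Dx (lambda n * c); rewrite /c => h.
  have lb : lambda n * (2 * b / (lambda n * e)) = 2 * b / e by field; rewrite !gt_eqF.
  rewrite lb in h *; apply: le_trans (ler_wpM2l (ltW e0) h).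
  by rewrite mulrDr mulr1 mulrC [e * _]mulrC divfK ?gt_eqF// lerDr ltW.
have h1 : mean (S x) (fun w => \1_A w * (disc n tau w * Delta n tau w)) <=
    mean (S x) (fun w => disc n tc w * Delta n tc w + e).
  apply: le_mean; [exact: bmfM|by apply: bmfD => //; exact: bmf_cst|move=> w].
  rewrite indicE; have [wA|wA] := boolP (w \in A) => /=.
    have e1 : tc w = tau w by rewrite /tc wA addr0 time_valK.
    have -> : disc n tc w = disc n tau w by rewrite /disc e1.
    have -> : Delta n tc w = Delta n tau w by rewrite /Delta /value /eval_tau /theta e1.
    by rewrite mul1r lerDl ltW.
  rewrite mul0r -lerBlDr sub0r.
  have : `|disc n tc w * Delta n tc w| <= e.
    apply: le_trans ec; rewrite normrM mulrC; apply: ler_pM => //.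
    have /andP[d0 _] := disc_range tc n w; rewrite (gtr0_norm d0) /disc ler_expR lerN2 ler_pM2l//.
    by rewrite /tc mk_timeK// (negbTE wA) lerDr time_val_ge0.
  by rewrite ler_norml => /andP[].
apply: le_trans h1 _; rewrite (meanD _ bdc (bmf_cst bOmega e)) mean_cst.
by rewrite gerDr; exact: (BP_disc stc ptc x BPn).
Qed.

(** The discount is undone by the factor exp(lambda_n tau) truncated at M: its superlevel sets lie
    in F_tau, so [layer_le] applies, and M tends to infinity. *)
Lemma Delta_le A x : stopped_field tau A -> mean (S x) (fun w => \1_A w * Delta n tau w) <= 0.
Proof.
move=> hA; have mA : @measurable _ bOmega A by case: hA.
have bI : bmf (\1_A : bOmega -> R) by exact: bmf_indic.
have bD := Delta_bmf st n; have bdD := bmfM (disc_bmf st n) bD.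
pose g M w : R := Num.min (expR (lambda n * T tau w)) M%:R.
have mg M : measurable_fun setT (g M : stopped_type tau -> R).
  apply: measurable_minr; last exact: measurable_cst.
  apply: measurableT_comp; first exact: measurable_expR.
  by apply: measurable_funM; [exact: measurable_cst|exact: stopped_T].
have mgb M : measurable_fun setT (g M : bOmega -> R).
  move=> _ B mB; have := mg M measurableT B mB; rewrite setTI (stopped_typeE st) => -[h _]; exact: h.
have hM M : mean (S x) (fun w => g M w * (\1_A w * (disc n tau w * Delta n tau w))) <= 0.
  apply: (layer_le (M := M%:R)) => //.
  - exact: bmfM.
  - by move=> w; rewrite /g le_min expR_ge0 ge_min lexx orbT andbT ler0n.
  - move=> r; have hr := stopped_bmf st r (mg M).
    have := disc_Delta_le x (stoppedI st hr hA); apply: le_trans.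
    rewrite le_eqVlt; apply/orP; left; apply/eqP; congr mean; apply/funext => w.
    by rewrite indicI mulrA.
have [_ [b hb]] := bD.
have cv : mean (S x) (fun w => g M w * (\1_A w * (disc n tau w * Delta n tau w))) @[M --> \oo] -->
    mean (S x) (fun w => \1_A w * Delta n tau w).
  have ed w : expR (lambda n * T tau w) * disc n tau w = 1.
    by rewrite /disc expRN mulfV// gt_eqF// expR_gt0.
  apply: (cvg_mean (M := b)).
  - by move=> M; apply: bmfM; [split; [exact: mgb|exists M%:R => w]|exact: bmfM];
      rewrite /g ger0_norm ?le_min ?expR_ge0 ?ler0n// ge_min lexx orbT.
  - move=> M w; rewrite indicE; case: (w \in A) => /=; last first.
      by rewrite mul0r mulr0 normr0 (le_trans (normr_ge0 _) (hb w)).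
    rewrite mul1r mulrA normrM -[leRHS]mul1r; apply: ler_pM => //.
    have /andP[d0 _] := disc_range tau n w.
    rewrite ger0_norm; last by rewrite mulr_ge0 ?(ltW d0)// /g le_min expR_ge0 ler0n.
    by rewrite -(ed w) ler_wpM2r ?(ltW d0)// /g ge_min lexx.
  - move=> w; apply: cvg_near_cst; exists (Num.truncn (expR (lambda n * T tau w))).+1 => // M /= hM'.
    rewrite /g min_l; last first.
      by apply/ltW/(lt_le_trans (truncnS_gt _)); rewrite ler_nat.
    by rewrite mulrCA; congr (_ * _); rewrite mulrA ed mul1r.
rewrite -(cvg_lim _ cv)//; apply: limr_le; first by apply/cvg_ex; eexists; exact: cv.
exact: nearW.
Qed.

(** The integrals over A and over its complement are both nonpositive, while [KP_at] makes their sum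
    nonnegative. *)
Lemma Delta_eq A x : stopped_field tau A -> mean (S x) (fun w => \1_A w * Delta n tau w) = 0.
Proof.
move=> hA; have mA : @measurable _ bOmega A by case: hA.
apply/eqP; rewrite eq_le Delta_le//=.
have bD := Delta_bmf st n.
have bI : bmf (\1_A : bOmega -> R) by exact: bmf_indic.
have bC : bmf (\1_(~` A) : bOmega -> R) by apply: bmf_indic; exact: measurableC.
have h1 : 0 <= mean (S x) (Delta n tau).
  rewrite (meanB _ (value_bmf st n) (Fn_theta_bmf st n)) subr_ge0.
  have := KPn x st pt (CFn n); set a := mean _ _; set b := mean _ _ => h.
  apply: le_trans h _; rewrite le_eqVlt; apply/orP; left; apply/eqP; congr mean; apply/funext => w.
  by rewrite /value value_upper.
have h2 : mean (S x) (Delta n tau) =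
    mean (S x) (fun w => \1_A w * Delta n tau w) + mean (S x) (fun w => \1_(~` A) w * Delta n tau w).
  rewrite -(meanD _ (bmfM bI bD) (bmfM bC bD)); congr mean; apply/funext => w.
  by rewrite !indicE in_setC; case: (w \in A); rewrite ?mul1r ?mul0r ?addr0 ?add0r.
have := Delta_le x (stoppedC st hA); move: h1; rewrite h2; lra.
Qed.

(** The discount is sliced into level sets in F_tau, for Delta and for -Delta; it follows that the
    payoff has exactly the mean of F_n. *)
Lemma disc_Delta_eq x : mean (S x) (fun w => disc n tau w * Delta n tau w) = 0.
Proof.
have bD := Delta_bmf st n.
have md : measurable_fun setT (disc n tau : stopped_type tau -> R).
  apply: measurableT_comp; first exact: measurable_expR.
  apply: measurableT_comp => //; apply: measurable_funM; first exact: measurable_cst.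
  exact: stopped_T.
have dr w : 0 <= disc n tau w <= 1 by have /andP[d0 ->] := disc_range tau n w; rewrite (ltW d0).
apply/eqP; rewrite eq_le; apply/andP; split.
  apply: (layer_le (M := 1)) => //; first exact: disc_measurable.
  by move=> r; rewrite Delta_eq//; exact: stopped_bmf.
rewrite -oppr_le0 -(meanN _ (bmfM (disc_bmf st n) bD)).
have -> : (fun w => - (disc n tau w * Delta n tau w)) = fun w => disc n tau w * - Delta n tau w.
  by apply/funext => w; rewrite mulrN.
apply: (layer_le (M := 1)) => //; [exact: bmfN|exact: disc_measurable|move=> r].
have hr := stopped_bmf st r md; have mr : @measurable _ bOmega [set w | r <= disc n tau w] by case: hr.
have -> : (fun w => \1_[set w | r <= disc n tau w] w * - Delta n tau w) =
    fun w => - (\1_[set w | r <= disc n tau w] w * Delta n tau w).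
  by apply/funext => w; rewrite mulrN.
by rewrite (meanN _ (bmfM (bmf_indic R mr) bD)) Delta_eq// oppr0.
Qed.

End level.

(** (KP1) passes on by [KPin_argmax]. For the payoff bound, j F_n is added to the cone element; its
    payoff has mean j times the optimum of F_n, so subtracting it and letting j grow replaces D_n by
    its argmax. *)
Lemma next_level n : BP_at n -> KP_at n -> BP_at n.+1 /\ KP_at n.+1.
Proof.
move=> B Kn; split; last first.
  move=> x tau st pt; apply: (KPin_argmax hX st (gn n) (CFn n)); first exact: Kn.
  have := Delta_eq B Kn st pt x (stoppedT st).
  have -> : (fun w => \1_setT w * Delta n tau w) = Delta n tau.
    by apply/funext => w; rewrite indicT mul1r.
  rewrite (meanB _ (value_bmf st n) (Fn_theta_bmf st n)) => /eqP; rewrite subr_eq0 => /eqP <-.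
  by congr mean; apply/funext => w; rewrite /value value_upper.
move=> x tau st pt N a a0.
set Y := fun w => _; set F := fun w => _.
have CF : Cb R X F by apply: Cb_sum => m; exact: CbZ.
have bY : bmf (Y : bOmega -> R) by apply: bmf_sum => m; apply: bmfZ; exact: payoff_bmf.
have h j : mean (S x) Y <= upper (Dn n) x (fun w => F w + j%:R * Fn n w) - j%:R * upper (Dn n) x (Fn n).
  have [N' [a' [a0' hs]]] := cone_combine N n a0 (ler0n R j).
  have := B x tau st pt N' a' a0'.
  have -> : (fun w => \sum_(m < N') a' m * payoff m tau w) = fun w => Y w + j%:R * payoff n tau w.
    by apply/funext => w; rewrite (hs (fun m => payoff m tau w)).
  have -> : (fun w => \sum_(m < N') a' m * Fn m w) = fun w => F w + j%:R * Fn n w.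
    by apply/funext => w; rewrite (hs (fun m => Fn m w)).
  rewrite (meanD _ bY (bmfZ _ (payoff_bmf st n))) (meanZ _ _ (payoff_bmf st n)).
  by rewrite (mean_payoff st) (disc_Delta_eq B Kn st pt) addr0 value_upper lerBrDr.
have cv := @cvg_upper_argmax _ _ _ (gn n) _ _ x CF (CFn n).
rewrite -[leRHS](cvg_lim _ cv)//; apply: limr_ge; first by apply/cvg_ex; eexists; exact: cv.
exact: nearW.
Qed.

Lemma BP0 : BP_at 0.
Proof.
move=> x tau st pt N a a0.
have hK m : exists K : R, forall y, `|phi m y| <= K.
  by have [c _ hc] := bounded_fun_bound (phi_bounded hPhi henum m); exists c.
have [K hK'] := choice hK.
have := cone_stopping hX hPhi hLambda henum hC SD N st pt hK' a0 x.
apply: le_trans; rewrite le_eqVlt; apply/orP; left; apply/eqP; congr mean.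
apply/funext => w; rewrite (Yst_sum hPhi hLambda henum); apply: eq_bigr => m _.
by rewrite /payoff /value eval_tauE.
Qed.

Lemma KP0 : KP_at 0.
Proof. by move=> x tau st pt; apply: (KP1 hX hC st pt); exact: (SD x (i := 0%N) I). Qed.

Lemma all_levels n : BP_at n /\ KP_at n.
Proof.
elim: n => [|n [B Kn]]; first by split; [exact: BP0|exact: KP0].
exact: next_level.
Qed.

Lemma Delta_zero n tau x A : stopping_time tau -> positive_time tau -> stopped_field tau A ->
  mean (S x) (fun w => \1_A w * Delta n tau w) = 0.
Proof. by move=> st pt hA; have [B Kn] := all_levels n; exact: (Delta_eq B Kn st pt). Qed.

End induction.

(** * The strong Markov property *)

Section strong_markov.
Context {R : realType} {X : ptopologicalType} (hX : polish R X).
Variables (Phi : set (X -> R)) (hPhi : separating_family Phi).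
Variables (Lambda : set R) (hLambda : dense_rates Lambda).
Variables (lambda : nat -> R) (phi : nat -> X -> R).
Variable henum : range (fun n => (lambda n, phi n)) = Lambda `*` Phi.
Variables (C : X -> set (law R X)) (hC : strong_krylov lambda phi C).
Local Notation Omega := (cpath R X).
Local Notation law := (law R X).
Local Notation bOmega := (borel Omega).
Local Notation Fn := (Fn lambda phi).
Local Notation Doo := (chain_limit C Fn).
Variables (S : X -> law) (SD : forall x, Doo x (S x)).
Implicit Types (w : Omega) (r s t : R) (tau : Omega -> time R) (n m : nat).
Local Notation T tau w := (time_val (tau w)).

Let CFn n : Cb R X (Fn n) := Fn_Cb hPhi hLambda henum n.
Let bFn n : bmf (Fn n : bOmega -> R) := bmf_Cb (CFn n).
Let Sb (f : bOmega -> R) : bmf f -> bmf ((fun x => mean (S x) f) : borel X -> R).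
Proof. exact: (S_bmf hX hPhi hLambda henum hC SD). Qed.

Lemma stopped_borel tau A : stopped_field tau A -> @measurable _ bOmega A.
Proof. by case. Qed.

Lemma stopped_id_measurable tau : stopping_time tau ->
  measurable_fun setT (id : bOmega -> stopped_type tau).
Proof.
move=> st _ B mB; rewrite setTI; apply: (@stopped_borel tau).
by move: mB; rewrite (stopped_typeE st).
Qed.

Lemma stopped_bmf_borel tau (G : bOmega -> R) : stopping_time tau ->
  bmf (G : stopped_type tau -> R) -> bmf G.
Proof. by move=> st bG; exact: (bmf_comp bG (stopped_id_measurable st)). Qed.

Lemma S_eval_bmf tau (f : bOmega -> R) : stopping_time tau -> bmf f ->
  bmf ((fun w => mean (S (eval_tau tau w)) f) : bOmega -> R).
Proof. by move=> st bf; exact: (bmf_comp (Sb bf) (eval_tau_measurable hX st)). Qed.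

(** [Delta_zero] extended from indicators of F_tau to bounded weights, as the uniqueness argument
    for Laplace transforms requires. *)
Lemma weighted_value tau x n (G : bOmega -> R) : stopping_time tau -> positive_time tau ->
  bmf (G : stopped_type tau -> R) ->
  mean (S x) (fun w => G w * Fn n (theta tau w)) =
  mean (S x) (fun w => G w * mean (S (eval_tau tau w)) (Fn n)).
Proof.
move=> st pt bG.
have b1 := theta_bmf hX st (bFn n); have b2 := S_eval_bmf st (bFn n).
pose L (u : bOmega -> R) (G : bOmega -> R) := mean (S x) (fun w => u w * G w).
have lL u : bmf u -> bounded_linear (L u : (stopped_type tau -> R) -> R).
  by move=> bu; exact: (bounded_linear_comp (stopped_id_measurable st) (bounded_linear_weight (S x) bu)).
have e u : mean (S x) (fun w => G w * u w) = L u G.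
  by congr mean; apply/funext => w; rewrite mulrC.
rewrite !e; apply: (eq_functionals (lL _ b1) (lL _ b2)) => //.
move=> A; rewrite (stopped_typeE st) => hA.
have := Delta_zero hX hPhi hLambda henum hC SD n x st pt hA.
have bI : bmf (\1_A : bOmega -> R) by apply: bmf_indic; exact: stopped_borel hA.
have -> : (fun w => \1_A w * Delta lambda phi S n tau w) = fun w =>
    mean (S (eval_tau tau w)) (Fn n) * \1_A w - Fn n (theta tau w) * \1_A w.
  by apply/funext => w; rewrite /Delta /value mulrC mulrBl.
rewrite (meanB _ (bmfM b2 bI) (bmfM b1 bI)) => /eqP; rewrite subr_eq0 => /eqP h.
by rewrite /L h.
Qed.

Lemma one_dim_strong tau x (G : bOmega -> R) t (psi : borel X -> R) :
  stopping_time tau -> positive_time tau -> bmf (G : stopped_type tau -> R) -> bmf psi ->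
  mean (S x) (fun w => G w * psi (at_time (theta tau w) t)) =
  mean (S x) (fun w => G w * mean (S (eval_tau tau w)) (fun w' => psi (at_time w' t))).
Proof.
move=> st pt bG bpsi; have bGb := stopped_bmf_borel st bG.
have n1 := nice_weight (S x) bGb (theta_measurable hX st).
have n2 := nice_kernel (S x) bGb (fun f bf => S_eval_bmf st bf).
apply: (nice_one_dim hPhi hLambda n1 n2) => //.
  by congr mean; apply/funext => w; rewrite mean_cst.
move=> l p Ll Pp; have [n ->] := Fn_enum henum Ll Pp.
exact: weighted_value.
Qed.

Lemma delay_stopping tau d : 0 <= d -> stopping_time tau ->
  stopping_time (fun w => mk_time (T tau w + d)).
Proof.
move=> d0 st; have h0 : stopped_field tau set0.
  by rewrite -setCT; apply: (stoppedC st); exact: stoppedT.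
have := stopping_delay st d0 h0; congr stopping_time.
by apply/funext => w; rewrite in_set0.
Qed.

(** With first time d, the factor g(w(tau + d)) joins the weight and the induction hypothesis is
    used at tau + d, in whose past the new weight lies. What remains depends on w(tau + d) alone,
    and the Markov property at time d puts f back together. *)
Lemma fdd_strong b f : fdd b f -> forall tau x (G : bOmega -> R),
  stopping_time tau -> positive_time tau -> bmf (G : stopped_type tau -> R) ->
  mean (S x) (fun w => G w * f (theta tau w)) =
  mean (S x) (fun w => G w * mean (S (eval_tau tau w)) f).
Proof.
elim=> {b f} [b|b d g f d0 db cg bg hf IH] tau x G st pt bG.
  by congr mean; apply/funext => w; rewrite mean_cst.
have bf := bmf_Cb (fdd_Cb hf); have bgb := continuous_bmf cg bg.
pose tau' w : time R := mk_time (T tau w + d).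
have Td0 w : 0 <= T tau w + d by rewrite addr_ge0// time_val_ge0.
have st' : stopping_time tau' by exact: delay_stopping.
have pt' : positive_time tau' by move=> w; rewrite mk_timeK// ltr_wpDr.
have thE w : theta tau' w = Defs.shift (mk_time d) (theta tau w).
  by rewrite /theta -(time_valK (tau w)) shift_shift// time_val_ge0.
have evE w : eval_tau tau' w = at_time (theta tau w) d.
  by rewrite eval_tauE mk_timeK// at_time_theta.
pose G' w := G w * g (at_time w (T tau w + d)).
have bG' : bmf (G' : stopped_type tau' -> R).
  apply: bmfM.
    have [mG [c hc]] := bG; split; last by exists c.
    move=> _ B mB; have := mG measurableT B mB; rewrite !setTI (stopped_typeE st) (stopped_typeE st').
    exact: stopped_delay.
  apply: (@bmf_comp _ _ (stopped_type tau') (borel X) R g _ bgb) => //.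
  move=> _ B mB; rewrite setTI (stopped_typeE st'); exact: (stopped_at hX st d0 mB).
pose psi (y : borel X) := g y * mean (S y) f.
have bpsi : bmf psi by apply: bmfM => //; exact: Sb.
transitivity (mean (S x) (fun w => G' w * f (theta tau' w))).
  by congr mean; apply/funext => w; rewrite /G' thE at_time_theta// mulrA.
rewrite (IH tau' x G' st' pt' bG').
transitivity (mean (S x) (fun w => G w * psi (at_time (theta tau w) d))).
  by congr mean; apply/funext => w; rewrite /G' /psi evE at_time_theta// mulrA.
rewrite (one_dim_strong x d st pt bG bpsi); congr mean; apply/funext => w; congr (_ * _).
apply/esym; apply: (conditional_markov hX hPhi hLambda henum hC SD) => //.
apply: (bmf_comp bgb); apply: filtration_at.
by rewrite mk_timeK.
Qed.

Lemma strong_markov_mean tau x (G f : bOmega -> R) : stopping_time tau -> positive_time tau ->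
  bmf (G : stopped_type tau -> R) -> bmf f ->
  mean (S x) (fun w => G w * f (theta tau w)) =
  mean (S x) (fun w => G w * mean (S (eval_tau tau w)) f).
Proof.
move=> st pt bG bf; have bGb := stopped_bmf_borel st bG.
have l1 := bounded_linear_comp (theta_measurable hX st) (bounded_linear_weight (S x) bGb).
have l2 := bounded_linear_kernel (S x) bGb (fun f bf => S_eval_bmf st bf).
have e1 : mean (S x) (fun w => G w * 1) = mean (S x) (fun w => G w * mean (S (eval_tau tau w)) (fun=> 1)).
  by congr mean; apply/funext => w; rewrite mean_cst.
have HH := eq_functional_class l1 l2 e1.
have [|//] := fdd_determining hX HH _ bf.
by move=> b h hh; split; [exact/bmf_Cb/(fdd_Cb hh)|exact: fdd_strong hh _ _ _ st pt bG].
Qed.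

Lemma integrated tau x : stopping_time tau -> positive_time tau ->
  same_measure (push_theta tau (S x))
    (fun A => \int[S x : probability bOmega R]_w S (eval_tau tau w) A)%E.
Proof.
move=> st pt A mA; have [M [MA hM]] := mixture_exists (S x) (fun f bf => S_eval_bmf st bf).
rewrite -(MA A mA) -mean_indic// hM; last exact: bmf_indic.
have b1 : bmf ((fun=> 1) : stopped_type tau -> R) by exact: bmf_cst.
have := strong_markov_mean x st pt b1 (bmf_indic R mA).
have m1 (h : bOmega -> R) : (fun w => 1 * h w) = h by apply/funext => w; rewrite mul1r.
rewrite !m1 => <-.
have mt : @measurable _ bOmega (theta tau @^-1` A).
  by have := theta_measurable hX st measurableT mA; rewrite setTI.
by rewrite /push_theta /pushforward -mean_indic.
Qed.

Section conditional.
Variables (tau : Omega -> time R) (st : stopping_time tau) (pt : positive_time tau).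
Variables (P : law) (kappa : Omega -> law) (hk : is_rcpd P (stopped_field tau) kappa).

Lemma rcpd_mean (f : bOmega -> R) : bmf f ->
  bmf ((fun w => mean (kappa w) f) : stopped_type tau -> R) /\
  forall A, stopped_field tau A ->
    mean P (fun w => \1_A w * f w) = mean P (fun w => \1_A w * mean (kappa w) f).
Proof.
have [mk ik] := hk => bf.
pose H : set (bOmega -> R) := [set f : bOmega -> R | bmf f /\
  bmf ((fun w => mean (kappa w) f) : stopped_type tau -> R) /\
  forall A, stopped_field tau A ->
    mean P (fun w => \1_A w * f w) = mean P (fun w => \1_A w * mean (kappa w) f)].
have bI A : stopped_field tau A -> bmf (\1_A : bOmega -> R).
  by move=> hA; apply: bmf_indic; exact: stopped_borel hA.
have HH : bounded_class H.
  split.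
  - have e : (fun w => mean (kappa w) (cst 1)) = fun=> 1 by apply/funext => w; exact: mean_cst.
    split; first exact: bmf_cst.
    split; first by rewrite e; exact: bmf_cst.
    by move=> A _; congr mean; apply/funext => w; rewrite mean_cst.
  - move=> a f1 g1 [b1 [k1 e1]] [b2 [k2 e2]].
    have ew w : mean (kappa w) (fun x => a * f1 x + g1 x) = a * mean (kappa w) f1 + mean (kappa w) g1.
      by rewrite (meanD _ (bmfZ _ b1) b2) meanZ.
    have e := funext ew.
    split; first by apply: bmfD => //; exact: bmfZ.
    split; first rewrite e; first by apply: bmfD => //; exact: bmfZ.
    move=> A hA; have [l _] := bounded_linear_weight P (bI A hA).
    have c1 := stopped_bmf_borel st k1; have c2 := stopped_bmf_borel st k2.
    have h1 := l a _ _ b1 b2; have h2 := l a _ _ c1 c2.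
    transitivity (mean P (fun w => \1_A w * (a * mean (kappa w) f1 + mean (kappa w) g1))).
      by rewrite [LHS]h1 [RHS]h2 e1// e2.
    by congr mean; apply/funext => w; rewrite ew.
  - move=> f_ f1 M hf fM ff; have bf_ n : bmf (f_ n) by case: (hf n).
    have bk_ n : bmf ((fun w => mean (kappa w) (f_ n)) : stopped_type tau -> R) by case: (hf n) => _ [].
    have kM n (w : bOmega) : `|mean (kappa w) (f_ n)| <= M.
      by apply: mean_norm_le => //; case: (bf_ n).
    have kcv (w : bOmega) : mean (kappa w) (f_ n) @[n --> \oo] --> mean (kappa w) f1.
      exact: (cvg_mean bf_ fM ff).
    split; first by apply: (bmf_lim _ fM ff) => n; case: (bf_ n).
    split.
      apply: (@bmf_lim _ (stopped_type tau) R (fun n w => mean (kappa w) (f_ n)) _ M) => //.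
      by move=> n; case: (bk_ n).
    move=> A hA; have [_ cl] := bounded_linear_weight P (bI A hA).
    have h1 := cl _ _ _ bf_ fM ff.
    have h2 := cl _ _ _ (fun n => stopped_bmf_borel st (bk_ n)) kM kcv.
    have e : (fun n => mean P (fun w => \1_A w * f_ n w)) =
        (fun n => mean P (fun w => \1_A w * mean (kappa w) (f_ n))).
      by apply/funext => n; case: (hf n) => _ [_ ->].
    by rewrite e in h1; exact: (cvg_unique _ h1 h2).
suff [_ //] : H f.
apply: (bclass_bmf HH (G := measurable)) bf.
- by rewrite sigma_algebra_id//; exact: sigma_algebra_measurable.
- by move=> A B mA mB; exact: measurableI.
- move=> B mB; have bB : bmf (\1_B : bOmega -> R) by exact: bmf_indic.
  have bkB : bmf ((fun w => mean (kappa w) (\1_B)) : stopped_type tau -> R).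
    split; last by exists 1 => w; apply: mean_norm_le => [|w'];
      [case: bB|rewrite indicE normr_nat lern1; case: (_ \in _)].
    apply/measurable_EFinP; have := mk B mB.
    by congr measurable_fun; apply/funext => w; rewrite /= mean_indic.
  split => //; split => // A hA; have mA := stopped_borel hA.
  have bk1 := bmfM (bI A hA) (stopped_bmf_borel st bkB).
  have -> : (fun w => \1_A w * \1_B w) = (\1_(A `&` B) : bOmega -> R).
    by apply/funext => w; rewrite indicI.
  apply: EFin_inj; rewrite mean_indic; last exact: measurableI.
  rewrite ik//; rewrite /mean /Rintegral fineK; last first.
    apply: integrable_fin_num => //.
    by apply: bmf_integrable => //; exact: law_fin.
  rewrite [LHS]integral_mkcond; apply: eq_integral => w _.
  rewrite patchE indicE; case: (w \in A); rewrite ?mul1r ?mul0r//.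
  by rewrite -[in LHS]mean_indic.
Qed.

(** One half of almost sure equality: each event where h1 - h2 is at least 1 / (n + 1) belongs to
    F_tau, and is null by testing on it. The other half is obtained by exchanging h1 and h2. *)
Lemma equal_off_null (h1 h2 : bOmega -> R) :
  bmf (h1 : stopped_type tau -> R) -> bmf (h2 : stopped_type tau -> R) ->
  (forall A, stopped_field tau A -> mean P (fun w => \1_A w * h1 w) = mean P (fun w => \1_A w * h2 w)) ->
  exists N, [/\ stopped_field tau N, P N = 0%E & forall w, ~ N w -> h1 w <= h2 w].
Proof.
move=> b1 b2 e; pose D w := h1 w - h2 w.
have bD : bmf (D : stopped_type tau -> R) by exact: bmfB.
pose A n : set bOmega := [set w | n.+1%:R^-1 <= D w].
have hA n : stopped_field tau (A n).
  by apply: (stopped_bmf st); case: bD.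
have c1 := stopped_bmf_borel st b1; have c2 := stopped_bmf_borel st b2.
have mA n : @measurable _ bOmega (A n) := stopped_borel (hA n).
have A0 n : P (A n) = 0%E.
  have bI : bmf (\1_(A n) : bOmega -> R) by exact: bmf_indic.
  rewrite -mean_indic//; congr EFin; apply/eqP; rewrite eq_le; apply/andP; split; last first.
    have := le_mean P (bmf_cst bOmega 0) bI; rewrite mean_cst; apply => w.
    by rewrite indicE.
  have n0 : 0 < (n.+1%:R : R)^-1 by rewrite invr_gt0.
  rewrite -(ler_pM2l n0) mulr0 -(meanZ _ _ bI).
  have h0 : mean P (fun w => \1_(A n) w * h1 w - \1_(A n) w * h2 w) = 0.
    by rewrite (meanB _ (bmfM bI c1) (bmfM bI c2)) (e _ (hA n)) subrr.
  rewrite -h0; apply: le_mean; [exact: bmfZ|exact: (bmfB (bmfM bI c1) (bmfM bI c2))|move=> w].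
  rewrite -mulrBr indicE; have [/set_mem h|_] := boolP (w \in A n); last by rewrite mulr0 mul0r.
  by rewrite mulr1 mul1r.
exists (\bigcup_n A n); split.
- by have [_ _] := stopped_sigma st; apply.
- apply/eqP; rewrite eq_le measure_ge0 andbT.
  apply: (le_trans (measure_sigma_subadditive (P : probability bOmega R) mA _ (@subset_refl _ _))).
    exact: bigcupT_measurable.
  by rewrite eseries0// => i _ _; exact: A0.
- move=> w nN; rewrite leNgt; apply/negP => lt; apply: nN.
  have D0 : 0 < D w by rewrite subr_gt0.
  exists (Num.truncn (D w)^-1) => //; suff : (Num.truncn (D w)^-1).+1%:R^-1 <= D w by [].
  rewrite -[leRHS]invrK lef_pV2 ?posrE ?invr_gt0// ?ltr0n//; exact/ltW/truncnS_gt.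
Qed.

End conditional.

(** Both kernels are F_tau-measurable with equal integrals over events of F_tau, so they agree
    almost surely on each function of a countable determining family. The union of the exceptional
    sets serves all Borel events at once. *)
Lemma conditional tau x kappa : stopping_time tau -> positive_time tau ->
  is_rcpd (S x) (stopped_field tau) kappa ->
  exists N, [/\ stopped_field tau N, S x N = 0%E &
    forall w, ~ N w -> same_measure (push_theta tau (kappa w)) (S (eval_tau tau w))].
Proof.
move=> st pt hk; have [D [CD DH]] := Omega_determining hX.
have mth := theta_measurable hX st.
pose h1 k w := mean (kappa w) (fun w' => D k (theta tau w')).
pose h2 k w := mean (S (eval_tau tau w)) (D k).
have bD k : bmf ((fun w' => D k (theta tau w')) : bOmega -> R).
  by apply: (bmf_comp _ mth); exact/bmf_Cb/CD.
have b1 k : bmf (h1 k : stopped_type tau -> R) by have [] := rcpd_mean st hk (bD k).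
have b2 k : bmf (h2 k : stopped_type tau -> R).
  by apply: (bmf_comp (Sb (bmf_Cb (CD k)))); exact: (stopped_eval_tau hX st).
have e k A : stopped_field tau A ->
    mean (S x) (fun w => \1_A w * h1 k w) = mean (S x) (fun w => \1_A w * h2 k w).
  move=> hA; have [_ h] := rcpd_mean st hk (bD k); rewrite -h//.
  apply: strong_markov_mean => //; last exact/bmf_Cb/CD.
  by apply: bmf_indic; rewrite (stopped_typeE st).
have /choice[N1 hN1] k := equal_off_null st (b1 k) (b2 k) (e k).
have /choice[N2 hN2] k := equal_off_null st (b2 k) (b1 k) (fun A hA => esym (e k A hA)).
pose N k := N1 k `|` N2 k.
have fN k : stopped_field tau (N k).
  have m1 : @measurable _ (stopped_type tau) (N1 k) by rewrite (stopped_typeE st); case: (hN1 k).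
  have m2 : @measurable _ (stopped_type tau) (N2 k) by rewrite (stopped_typeE st); case: (hN2 k).
  by have := measurableU _ _ m1 m2; rewrite (stopped_typeE st).
have mNb k : @measurable _ bOmega (N k) := stopped_borel (fN k).
exists (\bigcup_k N k); split.
- by have [_ _] := stopped_sigma st; apply.
- apply/eqP; rewrite eq_le measure_ge0 andbT.
  apply: (le_trans (measure_sigma_subadditive (S x : probability bOmega R) mNb _ (@subset_refl _ _))).
    exact: bigcupT_measurable.
  rewrite eseries0// => k _ _; apply/eqP; rewrite eq_le measure_ge0 andbT.
  have [f1 z1 _] := hN1 k; have [f2 z2 _] := hN2 k.
  apply: le_trans (measureU2 _ (stopped_borel f1) (stopped_borel f2)) _.
  by rewrite [X in (X + _)%E]z1 [X in (_ + X)%E]z2 adde0.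
- move=> w nN A mA; set y := eval_tau tau w.
  have ek k : mean (kappa w) (fun w' => D k (theta tau w')) = mean (S y) (D k).
    have n1 : ~ N1 k w by move=> h; apply: nN; exists k => //; left.
    have n2 : ~ N2 k w by move=> h; apply: nN; exists k => //; right.
    have [_ _ /(_ w n1) le1] := hN1 k; have [_ _ /(_ w n2) le2] := hN2 k.
    by apply/eqP; rewrite eq_le le1 le2.
  have l1 := bounded_linear_comp mth (bounded_linear_mean (kappa w)).
  have e1 : mean (kappa w) (fun=> 1) = mean (S y) (fun=> 1) by rewrite !mean_cst.
  have HH := eq_functional_class l1 (bounded_linear_mean (S y)) e1.
  have HD k : [set f : bOmega -> R | bmf f /\ mean (kappa w) (fun w' => f (theta tau w')) = mean (S y) f] (D k).
    by split; [exact/bmf_Cb/CD|exact: ek].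
  have [_ h] := DH _ HH HD _ (bmf_indic R mA).
  have mt : @measurable _ bOmega (theta tau @^-1` A).
    by have := mth measurableT _ mA; rewrite setTI.
  by rewrite /push_theta /pushforward -mean_indic// -[RHS]mean_indic// -h.
Qed.

Lemma selection_measurable : measurable_selection C S.
Proof.
split; last by move=> x; exact: (SD x (i := 0%N) I).
apply: measurable_to_borel => A oA.
have h := measurable_of_unique (good_chain_limit (good_C hC) CFn) SD
  (fun x P Q => @Doo_unique _ _ hX _ hPhi _ hLambda _ _ henum _ hC x P Q).
rewrite -[X in measurable X]setCK; apply: measurableC.
by have := h (~` A) (open_closedC oA).
Qed.

End strong_markov.

Theorem theorem14 (R : realType) (X : ptopologicalType) (hX : polish R X)
  (Phi : set (X -> R)) (hPhi : separating_family Phi)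
  (Lambda : set R) (hLambda : dense_rates Lambda)
  (lambda : nat -> R) (phi : nat -> X -> R)
  (henum : range (fun n => (lambda n, phi n)) = Lambda `*` Phi)
  (C : X -> set (law R X)) (hC : strong_krylov lambda phi C) :
  exists S : X -> law R X, measurable_selection C S /\ strong_markov S.
Proof.
have [S SD] := choice (good_ne (good_chain_limit (good_C hC) (Fn_Cb hPhi hLambda henum))).
exists S; split; first exact: (selection_measurable hX hPhi hLambda henum hC SD).
move=> x tau st pt; split; first exact: (integrated hX hPhi hLambda henum hC SD).
by move=> kappa hk; exact: (conditional hX hPhi hLambda henum hC SD st pt hk).
Qed.
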